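(* Let $0<\alpha<1/2$ and let $f\in L^2(\mathbb R^n)$ be log-concave. Then \[\frac{\alpha}{\Gamma(n+1)^{\frac{2\alpha}n}\Gamma(1-2\alpha)}\,|\Pi_2^{*,\alpha}f|^{-\frac{2\alpha}n}\le\|f\|_2^{2+\frac{4\alpha}n}\|f\|_1^{-\frac{4\alpha}n}\le\Vert f\Vert_{\frac{2n}{n-2\alpha}}^2.\] There is equality in the first inequality if $f(x)=a\,e^{-\Vert x-x_0\Vert_\Delta}$ for $x\in\mathbb R^n$, with $a\ge0$, $x_0\in\mathbb R^n$ and $\Delta$ an $n$-dimensional simplex having a vertex at the origin.
   Context: For measurable $f$ and $0<\alpha<1$, $\Pi_2^{*,\alpha}f$ is the star-shaped set whose radial function on $\mathbb S^{n-1}$ is given by $\rho_{\Pi_2^{*,\alpha}f}(\xi)^{-2\alpha}=\int_0^\infty t^{-2\alpha-1}\int_{\mathbb R^n}|f(x+t\xi)-f(x)|^2\,dx\,dt$, and $|\Pi_2^{*,\alpha}f|=\frac1n\int_{\mathbb S^{n-1}}\rho_{\Pi_2^{*,\alpha}f}(\xi)^n\,d\xi$ is its volume. $\Vert x\Vert_\Delta=\inf\{\lambda>0:x\in\lambda\Delta\}$. Log-concave means $\log f$ is concave with values in $[-\infty,\infty)$. *)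

(* Defs.v *)
From HB Require Import structures.
From mathcomp Require Import all_boot all_order all_algebra.
From mathcomp Require Import all_classical all_reals all_analysis.

Set Implicit Arguments.
Unset Strict Implicit.
Unset Printing Implicit Defensive.

Import Order.TTheory GRing.Theory Num.Theory.
Import numFieldNormedType.Exports.

Local Open Scope classical_set_scope.
Local Open Scope ring_scope.

Section Defs.
Variable R : realType.

(* Lebesgue integral of a nonnegative extended-real function on R^n
   ('rV[R]_n), computed as an iterated one-dimensional Lebesgue integral
   (Tonelli).  R^(m+1) = R x R^m via row_mx. *)
Fixpoint lebint (n : nat) : ('rV[R]_n -> \bar R) -> \bar R :=
  match n return ('rV[R]_n -> \bar R) -> \bar R with
  | 0 => fun F => F 0
  | m.+1 => fun F =>
      (\int[@lebesgue_measure R]_(x in [set: R])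
          lebint (fun v : 'rV[R]_m => F (row_mx (const_mx x : 'rV[R]_1) v)))%E
  end.

Definition vol (n : nat) (A : set 'rV[R]_n) : \bar R :=
  lebint (fun x => (\1_A x)%:E).

Definition Lpnorm (n : nat) (p : R) (f : 'rV[R]_n -> R) : \bar R :=
  poweR (lebint (fun x => (`|f x| `^ p)%:E)) p^-1.

(* x^(-c) for an extended real x >= 0 and c > 0, i.e. 1 / x^c
   (with 0^(-c) = +oo and (+oo)^(-c) = 0). *)
Definition epowN (x : \bar R) (c : R) : \bar R := ((poweR x c)^-1)%E.

Definition Gamma (s : R) : R :=
  Rintegral (@lebesgue_measure R) `]0%R, +oo[%classic
    (fun t => t `^ (s - 1) * expR (- t)).

Definition enorm (n : nat) (v : 'rV[R]_n) : R :=
  Num.sqrt (\sum_(i < n) v ord0 i ^+ 2).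

Definition elog (x : R) : \bar R := if x == 0 then -oo%E else (ln x)%:E.

Definition log_concave (n : nat) (f : 'rV[R]_n -> R) : Prop :=
  (forall x, 0 <= f x) /\
  forall (x y : 'rV[R]_n) (l : R), 0 <= l <= 1 ->
    ((1 - l)%:E * elog (f x) + l%:E * elog (f y)
       <= elog (f ((1 - l) *: x + l *: y)%R))%E.

Definition Pi_integral (n : nat) (alpha : R) (f : 'rV[R]_n -> R)
  (xi : 'rV[R]_n) : \bar R :=
  (\int[@lebesgue_measure R]_(t in `]0%R, +oo[%classic)
     ((t `^ (- (2 * alpha) - 1))%:E *
       lebint (fun x => ((f (x + t *: xi) - f x) ^+ 2)%:E)))%E.

Definition Pi_radial (n : nat) (alpha : R) (f : 'rV[R]_n -> R)
  (xi : 'rV[R]_n) : \bar R :=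
  epowN (Pi_integral alpha f xi) (2 * alpha)^-1.

Definition Pi_star (n : nat) (alpha : R) (f : 'rV[R]_n -> R) : set 'rV[R]_n :=
  [set x | x = 0 \/
     ((enorm x)%:E <= Pi_radial alpha f ((enorm x)^-1 *: x))%E].

Definition simplex0 (n : nat) (V : 'M[R]_n) : set 'rV[R]_n :=
  [set x | exists l : 'rV[R]_n, (forall i, 0 <= l ord0 i) /\
     \sum_(i < n) l ord0 i <= 1 /\ x = l *m V].

(* Gauge (Minkowski functional) ||x||_Delta = inf {lambda > 0 : x in lambda Delta}
   (= +oo if no such lambda). *)
Definition gauge (n : nat) (D : set 'rV[R]_n) (x : 'rV[R]_n) : \bar R :=
  ereal_inf [set l%:E | l in [set l : R | 0 < l /\ exists y, D y /\ x = l *: y]].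

End Defs.

(* Main.v *)
(* Let g z = \int f x * f (x + z) dx be the covariogram of f.  Then
   \int |f (x + t xi) - f x|^2 dx = 2 (g 0 - g (t xi)) and \int g = ||f||_1^2.
   By Prekopa-Leindler g is log-concave, hence along a ray u t = g (t xi) / g 0
   crosses every exponential exp (- c t) at most once.  Comparison with the
   exponential for which \int t^(- 2 alpha - 1) (1 - u) is the same bounds
   \int t^(n - 1) u dt by a power of that integral, i.e. by a multiple of
   rho (xi)^n.  Summing over all rays gives ||f||_1^2 <= D |Pi^* f|, which is the
   first inequality.  The second one interpolates L^2 between L^1 and
   L^(2n / (n - 2 alpha)).  For a simplex, f x * f (x + z) is
   exp (- N z) * f (x + w)^2 with N homogeneous, so u is exactly exponential and
   all the estimates are equalities. *)
Require Import Defs.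
From HB Require Import structures.
From mathcomp Require Import all_boot all_order all_algebra.
From mathcomp Require Import all_classical all_reals all_analysis.
From mathcomp Require Import measurable_realfun.
From mathcomp Require Import ring lra.

Set Implicit Arguments.
Unset Strict Implicit.
Unset Printing Implicit Defensive.

Import Order.TTheory GRing.Theory Num.Theory.
Import numFieldNormedType.Exports.
Local Open Scope classical_set_scope.
Local Open Scope ring_scope.

(** * Measurability and Tonelli on row vectors *)

(** A log-concave function may be non-Borel, whereas additivity, comparison and Tonelli for [lebint]
    are at hand for measurable integrands. So two functions are carried along: [f], which is
    log-concave, and a Borel [h] that differs from it only on a set invisible to iterated integrals.
    Tonelli, rays and interpolation are applied to [h]; Prekopa-Leindler is applied to [f], in a
    form where the measurability of marginals follows from log-concavity. Both functions have the
    same covariogram, and that is where the two halves meet.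

    Origin of the sharp constant: for u = exp (- c t), both \int t^(n - 1) u and the n-th power of
    the radius defined by \int t^(- 2 alpha - 1) (1 - u) are multiples of c^(- n). Their ratio
    depends neither on c nor on the ray, so functions that decay exponentially at different rates in
    different directions are still extremal. The condition alpha < 1/2 makes \int t^(- 2 alpha - 1)
    (1 - exp (- t)) converge at 0. *)

Definition rv_display : measure_display.
Proof. exact. Qed.

Section rv_measurable.
Context (R : realType) (n : nat).

(** Generators of the product sigma-algebra, chosen so that a map into row vectors is measurable as
    soon as its coordinates are. *)
Definition rv_cylinder : set (set 'rV[R]_n) :=
  [set A | exists (i : 'I_n) (B : set (measurableTypeR R)),
     measurable B /\ A = (fun v : 'rV[R]_n => v ord0 i) @^-1` B].

HB.instance Definition _ := @isMeasurable.Build rv_display 'rV[R]_n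
  <<s rv_cylinder >> (@sigma_algebra0 _ setT _) (@sigma_algebraC _ _)
  (@sigma_algebra_bigcup _ setT _).

End rv_measurable.

Lemma measurable_coord (R : realType) (n : nat) (i : 'I_n) :
  measurable_fun setT (fun v : 'rV[R]_n => v ord0 i : measurableTypeR R).
Proof.
move=> _ B mB; rewrite setTI; apply: sub_sigma_algebra.
by exists i, B.
Qed.

Lemma measurable_rv_funP (R : realType) (n : nat) d (T : measurableType d)
    (F : T -> 'rV[R]_n) :
  (forall i, measurable_fun setT (fun t => F t ord0 i : measurableTypeR R)) ->
  measurable_fun setT F.
Proof.
move=> mF; apply: (@measurability _ _ _ _ _ F (@rv_cylinder R n)) => //.
move=> _ [_ [i [B [mB ->]] <-]].
rewrite setTI -comp_preimage; have := mF i measurableT B mB.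
by rewrite setTI.
Qed.

Definition rv_cons (R : realType) (n : nat) (x : R) (v : 'rV[R]_n) : 'rV[R]_n.+1 :=
  row_mx (const_mx x : 'rV[R]_1) v.

Lemma rv_cons0 (R : realType) n (x : R) (v : 'rV[R]_n) : rv_cons x v ord0 ord0 = x.
Proof.
rewrite /rv_cons mxE; case: (@splitP 1 n (ord0 : 'I_(1 + n))) => [k _|k //].
by rewrite mxE.
Qed.

Lemma rv_consS (R : realType) n (x : R) (v : 'rV[R]_n) (j : 'I_n) :
  rv_cons x v ord0 (lift ord0 j) = v ord0 j.
Proof.
rewrite /rv_cons mxE.
case: (@splitP 1 n (lift ord0 j : 'I_(1 + n))) => [[[] // i] //|k].
by rewrite lift0 add1n => -[] /val_inj ->.
Qed.

Lemma measurable_rv_cons (R : realType) (n : nat) d (T : measurableType d)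
    (x : T -> measurableTypeR R) (v : T -> 'rV[R]_n) :
  measurable_fun setT x -> measurable_fun setT v ->
  measurable_fun setT (fun t => rv_cons (x t) (v t)).
Proof.
move=> mx mv; apply: measurable_rv_funP => i.
have [->|[j ->]] : i = ord0 \/ exists j, i = lift ord0 j.
  by case: (unliftP ord0 i) => [j ->|]; [right; exists j|left].
  by under eq_fun do rewrite rv_cons0.
under eq_fun do rewrite rv_consS.
exact: (measurableT_comp (measurable_coord j) mv).
Qed.

Section lebint_basic.
Context {R : realType}.
Local Open Scope ereal_scope.
Notation mu := (@lebesgue_measure R).

Lemma lebintS n (F : 'rV[R]_n.+1 -> \bar R) :
  lebint F = \int[mu]_x lebint (fun v => F (rv_cons x v)).
Proof. by []. Qed.

Lemma lebint_ge0 n (F : 'rV[R]_n -> \bar R) :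
  (forall v, 0 <= F v) -> 0 <= lebint F.
Proof.
elim: n F => [|n IH] F F0 /=; first exact: F0.
by apply: integral_ge0 => x _; apply: IH.
Qed.

(** The parameter space [T] is arbitrary because the induction moves the first coordinate of the
    vector into the parameter. *)
Lemma measurable_lebint n d (T : measurableType d) (F : T * 'rV[R]_n -> \bar R) :
  (forall p, 0 <= F p) -> measurable_fun setT F ->
  measurable_fun setT (fun t => lebint (fun v => F (t, v))).
Proof.
elim: n d T F => [|n IH] d T F F0 mF /=.
  by apply: (measurableT_comp mF); exact: measurable_fun_pair.
pose G (p : T * measurableTypeR R) :=
  lebint (fun v : 'rV[R]_n => F (p.1, rv_cons p.2 v)).
apply: (@measurable_fun_fubini_tonelli_F _ _ _ _ _ mu G).
  pose H (q : (T * measurableTypeR R) * 'rV[R]_n) :=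
    F (q.1.1, rv_cons q.1.2 q.2).
  apply: (IH _ _ H) => [pt|]; first exact: F0.
  apply: (measurableT_comp mF); apply: measurable_fun_pair.
    exact: measurableT_comp.
  by apply: measurable_rv_cons => //; exact: measurableT_comp.
by move=> p; apply: lebint_ge0.
Qed.

Lemma measurable_slice n (F : 'rV[R]_n.+1 -> \bar R) (x : R) :
  measurable_fun setT F ->
  measurable_fun setT (fun v : 'rV[R]_n => F (rv_cons x v)).
Proof.
by move=> mF; apply: (measurableT_comp mF); apply: measurable_rv_cons.
Qed.

Lemma measurable_marginal n (F : 'rV[R]_n.+1 -> \bar R) :
  (forall v, 0 <= F v) -> measurable_fun setT F ->
  measurable_fun setT (fun x : measurableTypeR R =>
    lebint (fun v : 'rV[R]_n => F (rv_cons x v))).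
Proof.
move=> F0 mF.
apply: (@measurable_lebint n _ (measurableTypeR R)
  (fun p => F (rv_cons p.1 p.2))) => //.
by apply: (measurableT_comp mF); apply: measurable_rv_cons.
Qed.

Lemma eq_lebint n (F G : 'rV[R]_n -> \bar R) :
  (forall v, F v = G v) -> lebint F = lebint G.
Proof. by move=> FG; congr lebint; apply/funext. Qed.

Lemma le_lebint n (F G : 'rV[R]_n -> \bar R) :
  (forall v, 0 <= F v) -> measurable_fun setT F -> measurable_fun setT G ->
  (forall v, F v <= G v) -> lebint F <= lebint G.
Proof.
elim: n F G => [|n IH] F G F0 mF mG FG /=; first exact: FG.
have G0 v : 0 <= G v by apply: le_trans (FG v).
apply: ge0_le_integral => //.
- by move=> x _; apply: lebint_ge0.
- exact: measurable_marginal.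
- exact: measurable_marginal.
- by move=> x _; apply: IH => //; exact: measurable_slice.
Qed.

Lemma lebintD n (F G : 'rV[R]_n -> \bar R) :
  (forall v, 0 <= F v) -> measurable_fun setT F ->
  (forall v, 0 <= G v) -> measurable_fun setT G ->
  lebint (fun v => F v + G v) = lebint F + lebint G.
Proof.
elim: n F G => [//|n IH] F G F0 mF G0 mG /=.
rewrite -ge0_integralD//.
- by apply: eq_integral => x _; apply: IH => //; exact: measurable_slice.
- by move=> x _; apply: lebint_ge0.
- exact: measurable_marginal.
- by move=> x _; apply: lebint_ge0.
- exact: measurable_marginal.
Qed.

Lemma lebintZ n (k : \bar R) (F : 'rV[R]_n -> \bar R) : 0 <= k ->
  (forall v, 0 <= F v) -> measurable_fun setT F ->
  lebint (fun v => k * F v) = k * lebint F.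
Proof.
move=> k0; elim: n F => [//|n IH] F F0 mF /=.
rewrite -ge0_integralZl//.
- by apply: eq_integral => x _; apply: IH => //; exact: measurable_slice.
- exact: measurable_marginal.
- by move=> x _; apply: lebint_ge0.
Qed.

Lemma lebint_tonelli n d (T : measurableType d)
    (m : {sigma_finite_measure set T -> \bar R}) (F : 'rV[R]_n * T -> \bar R) :
  (forall p, 0 <= F p) -> measurable_fun setT F ->
  lebint (fun v => \int[m]_t F (v, t)) = \int[m]_t lebint (fun v => F (v, t)).
Proof.
elim: n F => [//|n IH] F F0 mF /=.
pose G (p : measurableTypeR R * T) :=
  lebint (fun v : 'rV[R]_n => F (rv_cons p.1 v, p.2)).
rewrite -(@fubini_tonelli _ _ _ _ _ mu m G); last 2 first.
- pose H (q : (measurableTypeR R * T) * 'rV[R]_n) :=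
    F (rv_cons q.1.1 q.2, q.1.2).
  apply: (measurable_lebint (F := H)) => [pt|]; first exact: F0.
  apply: (measurableT_comp mF); apply: measurable_fun_pair.
    by apply: measurable_rv_cons => //; exact: measurableT_comp.
  exact: measurableT_comp.
- by move=> p; apply: lebint_ge0.
apply: eq_integral => x _.
rewrite (IH (fun q => F (rv_cons x q.1, q.2)))//.
apply: (measurableT_comp mF); apply: measurable_fun_pair => //.
exact: measurable_rv_cons.
Qed.

Lemma lebint_swap n p (F : 'rV[R]_n * 'rV[R]_p -> \bar R) :
  (forall q, 0 <= F q) -> measurable_fun setT F ->
  lebint (fun v => lebint (fun w => F (v, w))) =
  lebint (fun w => lebint (fun v => F (v, w))).
Proof.
elim: n F => [//|n IH] F F0 mF /=.
pose G (q : 'rV[R]_p * measurableTypeR R) :=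
  lebint (fun v : 'rV[R]_n => F (rv_cons q.2 v, q.1)).
rewrite (@lebint_tonelli p _ _ mu G); last 2 first.
- by move=> q; apply: lebint_ge0.
- pose H (q : ('rV[R]_p * measurableTypeR R) * 'rV[R]_n) :=
    F (rv_cons q.1.2 q.2, q.1.1).
  apply: (measurable_lebint (F := H)) => [pt|]; first exact: F0.
  apply: (measurableT_comp mF); apply: measurable_fun_pair.
    by apply: measurable_rv_cons => //; exact: measurableT_comp.
  exact: measurableT_comp.
apply: eq_integral => x _.
rewrite (IH (fun q => F (rv_cons x q.1, q.2)))//.
apply: (measurableT_comp mF); apply: measurable_fun_pair => //.
exact: measurable_rv_cons.
Qed.

End lebint_basic.

(** * Translations, dilations and rays *)

Section change_of_variables.
Context {R : realType}.
Local Open Scope ereal_scope.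
Notation mu := (@lebesgue_measure R).

Lemma measurable_affine (k c : R) :
  measurable_fun setT (fun x : measurableTypeR R => (k * x + c)%R : measurableTypeR R).
Proof. by apply: measurable_funD => //; exact: mulrl_measurable. Qed.

(** Uniqueness of Lebesgue measure: [k] times the pushforward under x -> k x + c gives every
    half-open interval its length. *)
Lemma lebesgue_measure_affine (k c : R) (A : set (measurableTypeR R)) :
  (0 < k)%R -> measurable A ->
  mu A = k%:E * mu ((fun x => (k * x + c)%R) @^-1` A).
Proof.
move=> k0 mA.
pose phi := (fun x => (k * x + c)%R) : measurableTypeR R -> measurableTypeR R.
have mphi : measurable_fun setT phi by exact: measurable_affine.
have [p pE] : exists p : {measure set (measurableTypeR R) -> \bar R},
    p = pushforward mu phi :> (set (measurableTypeR R) -> \bar R).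
  by unshelve eexists (pushforward mu phi : {measure set _ -> \bar R}).
pose m := mscale (NngNum (ltW k0)) p.
have mE B : m B = k%:E * mu (phi @^-1` B).
  by transitivity (k%:E * p B) => //; rewrite pE.
rewrite (@lebesgue_measure_unique R m)//; move=> _ [[a b] _ <-] /=; apply: etrans (esym (mE _)).
have -> : phi @^-1` `]a, b]%classic = `](k^-1 * (a - c))%R, (k^-1 * (b - c))%R]%classic.
  apply/seteqP; split => x; rewrite /phi /= !in_itv /=.
    move=> /andP[ax xb]; rewrite mulrC ltr_pdivrMr// ltrBlDr (mulrC x) ax/=.
    by rewrite mulrC ler_pdivlMr// lerBrDr (mulrC x).
  rewrite mulrC ltr_pdivrMr// ltrBlDr (mulrC x) => /andP[-> /=].
  by rewrite mulrC ler_pdivlMr// lerBrDr (mulrC x).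
rewrite !lebesgue_measure_itv/= !lte_fin ltr_pM2l ?invr_gt0// ltrD2r.
case: ifPn => // _; last by rewrite mule0.
by rewrite -!EFinD -EFinM; congr EFin; field; rewrite gt_eqF.
Qed.

Lemma ge0_integral_affine (k c : R) (F : measurableTypeR R -> \bar R) :
  (0 < k)%R -> (forall x, 0 <= F x) -> measurable_fun setT F ->
  \int[mu]_x F x = k%:E * \int[mu]_x F (k * x + c)%R.
Proof.
move=> k0 F0 mF.
pose phi := (fun x => (k * x + c)%R) : measurableTypeR R -> measurableTypeR R.
have mphi : measurable_fun setT phi by exact: measurable_affine.
have [p pE] : exists p : {measure set (measurableTypeR R) -> \bar R},
    p = pushforward mu phi :> (set (measurableTypeR R) -> \bar R).
  by unshelve eexists (pushforward mu phi : {measure set _ -> \bar R}).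
pose m := mscale (NngNum (ltW k0)) p.
have mE B : m B = k%:E * mu (phi @^-1` B).
  by transitivity (k%:E * p B) => //; rewrite pE.
rewrite (@eq_measure_integral _ _ _ _ m); last first.
  by move=> A mA _; apply: etrans (esym (mE _)); exact: lebesgue_measure_affine.
rewrite ge0_integral_mscale//=; congr (_ * _).
rewrite (eq_measure_integral (pushforward mu phi)) => [|A _ _]; last by rewrite pE.
by rewrite (@ge0_integral_pushforward _ _ _ _ _ phi)// preimage_setT.
Qed.

Lemma ge0_integral_opp (F : measurableTypeR R -> \bar R) :
  (forall x, 0 <= F x) -> measurable_fun setT F ->
  \int[mu]_x F x = \int[mu]_(x in `]0%R, +oo[) F x + \int[mu]_(x in `]0%R, +oo[) F (- x)%R.
Proof.
move=> F0 mF.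
have mFN : measurable_fun setT (fun x : measurableTypeR R => F (- x)%R).
  by apply: (measurableT_comp mF); exact: oppr_measurable.
rewrite [X in _ + X]integral_itv_obnd_cbnd; last exact: measurable_funTS.
rewrite ge0_integration_by_substitution0//.
under [X in _ + X]eq_integral do rewrite opprK.
rewrite -ge0_integral_setU//; last 2 first.
- exact: measurable_funTS.
- apply/disj_setPRL => x /=; rewrite !in_itv/= ?andbT => x0.
  by apply/negP; move: x0; case: (ltgtP x 0%R).
congr integral; apply/seteqP; split => x //= _; rewrite !in_itv/= andbT.
by case: (leP x 0%R); [right|left].
Qed.

Lemma ge0_integral_scale_gt0 (k : R) (F : measurableTypeR R -> \bar R) :
  (0 < k)%R -> (forall x, (0 < x)%R -> 0 <= F x) -> measurable_fun setT F ->
  \int[mu]_(x in `]0%R, +oo[) F x = k%:E * \int[mu]_(x in `]0%R, +oo[) F (k * x)%R.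
Proof.
move=> k0 F0 mF; rewrite integral_mkcond [in RHS]integral_mkcond.
rewrite (@ge0_integral_affine k 0)//.
- congr (_ * _); apply: eq_integral => x _; rewrite addr0 /patch.
  by rewrite !mem_setE !in_itv/= !andbT pmulr_rgt0.
- move=> x; apply: erestrict_ge0 => y /=; rewrite in_itv/= andbT; exact: F0.
- apply/(measurable_restrictT F); first exact: measurable_itv.
  exact: measurable_funTS.
Qed.

Lemma measurable_addrv n (z : 'rV[R]_n) : measurable_fun setT (fun v : 'rV[R]_n => v + z)%R.
Proof.
apply: measurable_rv_funP => i; under eq_fun do rewrite mxE.
by apply: measurable_funD => //; exact: measurable_coord.
Qed.

Lemma measurable_addrv2 n d (T : measurableType d) (F G : T -> 'rV[R]_n) :
  measurable_fun setT F -> measurable_fun setT G ->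
  measurable_fun setT (fun t => F t + G t)%R.
Proof.
move=> mF mG; apply: measurable_rv_funP => i; under eq_fun do rewrite mxE.
apply: measurable_funD; first exact: (measurableT_comp (measurable_coord i) mF).
exact: (measurableT_comp (measurable_coord i) mG).
Qed.

Lemma measurable_scalerv n d (T : measurableType d) (k : T -> measurableTypeR R)
    (F : T -> 'rV[R]_n) :
  measurable_fun setT k -> measurable_fun setT F ->
  measurable_fun setT (fun t => k t *: F t)%R.
Proof.
move=> mk mF; apply: measurable_rv_funP => i; under eq_fun do rewrite mxE.
apply: measurable_funM => //.
exact: (measurableT_comp (measurable_coord i) mF).
Qed.

Lemma rv_consD n (x y : R) (v w : 'rV[R]_n) :
  (rv_cons x v + rv_cons y w)%R = rv_cons (x + y) (v + w)%R.
Proof.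
apply/rowP => i; rewrite [LHS]mxE.
by have [j ->|->] := unliftP ord0 i; rewrite ?rv_consS ?rv_cons0 ?mxE.
Qed.

Lemma rv_consZ n (k x : R) (v : 'rV[R]_n) :
  (k *: rv_cons x v)%R = rv_cons (k * x) (k *: v)%R.
Proof.
apply/rowP => i; rewrite [LHS]mxE.
by have [j ->|->] := unliftP ord0 i; rewrite ?rv_consS ?rv_cons0 ?mxE.
Qed.

Lemma rv_cons_eta n (z : 'rV[R]_n.+1) :
  z = rv_cons (z ord0 ord0) (\row_j z ord0 (lift ord0 j)).
Proof.
apply/rowP => i; have [j ->|->] := unliftP ord0 i.
  by rewrite rv_consS mxE.
by rewrite rv_cons0.
Qed.

Lemma lebint_translate n (F : 'rV[R]_n -> \bar R) (z : 'rV[R]_n) :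
  (forall v, 0 <= F v) -> measurable_fun setT F ->
  lebint (fun v => F (v + z)%R) = lebint F.
Proof.
elim: n F z => [|n IH] F z F0 mF; first by rewrite /= thinmx0.
rewrite !lebintS [RHS](@ge0_integral_affine 1 (z ord0 ord0))//; last 2 first.
- by move=> x /=; apply: lebint_ge0.
- exact: measurable_marginal.
rewrite mul1e; apply: eq_integral => x _.
rewrite mul1r -(IH (fun v => F (rv_cons (x + z ord0 ord0) v))
  (\row_j z ord0 (lift ord0 j)))//; last exact: measurable_slice.
by apply: eq_lebint => v; rewrite [X in (_ + X)%R]rv_cons_eta rv_consD.
Qed.

Lemma lebint_scale n (F : 'rV[R]_n -> \bar R) (k : R) : (0 < k)%R ->
  (forall v, 0 <= F v) -> measurable_fun setT F ->
  lebint F = (k ^+ n)%:E * lebint (fun v => F (k *: v)%R).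
Proof.
move=> k0; elim: n F => [|n IH] F F0 mF.
  by rewrite /= expr0 mul1e scaler0.
rewrite !lebintS (@ge0_integral_affine k 0)//; last 2 first.
- by move=> x /=; apply: lebint_ge0.
- exact: measurable_marginal.
rewrite exprS EFinM -muleA; congr (_ * _).
have mkF : measurable_fun setT (fun v : 'rV[R]_n.+1 => F (k *: v)%R).
  by apply: (measurableT_comp mF); exact: measurable_scalerv.
rewrite -ge0_integralZl//; last 3 first.
- exact: (measurable_marginal (F := fun v => F (k *: v)%R)).
- by move=> x _; apply: lebint_ge0.
- by rewrite lee_fin exprn_ge0// ltW.
apply: eq_integral => x _; rewrite addr0.
rewrite (IH (fun v => F (rv_cons (k * x) v)))//; last exact: measurable_slice.
by congr (_ * _); apply: eq_lebint => v; rewrite rv_consZ.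
Qed.

Lemma lebint_cst0 n : lebint (fun _ : 'rV[R]_n => 0) = 0.
Proof.
elim: n => [//|n IH] /=; under eq_integral do rewrite IH.
by rewrite integral0.
Qed.

Lemma lebint_tonelli_in n (D : set (measurableTypeR R))
    (F : 'rV[R]_n * measurableTypeR R -> \bar R) : measurable D ->
  (forall p, 0 <= F p) -> measurable_fun setT F ->
  lebint (fun v => \int[mu]_(t in D) F (v, t)) =
  \int[mu]_(t in D) lebint (fun v => F (v, t)).
Proof.
move=> mD F0 mF; rewrite [RHS]integral_mkcond.
transitivity (lebint (fun v => \int[mu]_t (F (v, t) * (\1_D t)%:E))).
  apply: eq_lebint => v; rewrite integral_mkcond; apply: eq_integral => t _.
  by rewrite /patch indicE; case: (t \in D); rewrite ?mule1 ?mule0.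
rewrite (@lebint_tonelli R n _ _ mu (fun p => F p * (\1_D p.2)%:E))//.
- apply: eq_integral => t _ /=; rewrite /patch indicE; case: (t \in D).
    by apply: eq_lebint => v; rewrite mule1.
  by rewrite -[RHS](lebint_cst0 n); apply: eq_lebint => v; rewrite mule0.
- by move=> p; rewrite mule_ge0// lee_fin.
- apply: emeasurable_funM => //; apply/measurable_EFinP.
  exact: (measurableT_comp (measurable_indic mD)).
Qed.

(* Polar coordinates with the hyperplanes [x_0 = 1] and [x_0 = -1] in place of the
   sphere: rays can be compared without a surface measure. *)
Lemma lebint_polar m (F : 'rV[R]_m.+1 -> \bar R) :
  (forall v, 0 <= F v) -> measurable_fun setT F ->
  lebint F =
    lebint (fun w => \int[mu]_(t in `]0%R, +oo[)
       ((t ^+ m)%:E * F (t *: rv_cons 1 w)%R)) +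
    lebint (fun w => \int[mu]_(t in `]0%R, +oo[)
       ((t ^+ m)%:E * F (t *: rv_cons (-1) w)%R)).
Proof.
move=> F0 mF.
(* For fixed [t] the substitution v = t w on R^m has Jacobian t^m, so a family of rays turns into
   the hyperplanes with first coordinate [t * s]. *)
have ray (s : R) : lebint (fun w => \int[mu]_(t in `]0%R, +oo[)
       ((t ^+ m)%:E * F (t *: rv_cons s w)%R)) =
    \int[mu]_(t in `]0%R, +oo[) lebint (fun v => F (rv_cons (t * s) v)).
  (* The absolute value makes the integrand nonnegative for all real [t], as Tonelli asks; it
     disappears for [t > 0]. *)
  pose F' (p : 'rV[R]_m * measurableTypeR R) :=
    (`|p.2| ^+ m)%:E * F (p.2 *: rv_cons s p.1)%R.
  have F'0 p : 0 <= F' p by rewrite mule_ge0// lee_fin exprn_ge0.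
  have mF' : measurable_fun setT F'.
    apply: emeasurable_funM.
      apply/measurable_EFinP; apply: measurable_funX.
      exact: (measurableT_comp (@normr_measurable R setT) measurable_snd).
    apply: (measurableT_comp mF); apply: measurable_scalerv => //.
    exact: measurable_rv_cons.
  transitivity (lebint (fun v => \int[mu]_(t in `]0%R, +oo[) F' (v, t))).
    apply: eq_lebint => v; apply: eq_integral => t.
    by rewrite inE/= in_itv/= andbT => t0; rewrite /F'/= gtr0_norm.
  rewrite lebint_tonelli_in//; apply: eq_integral => t.
  rewrite inE/= in_itv/= andbT => t0; rewrite /F'/= gtr0_norm//.
  rewrite [RHS](lebint_scale t0)//; last exact: measurable_slice.
  rewrite lebintZ//; last 2 first.
  - by rewrite lee_fin exprn_ge0// ltW.
  - apply: (measurableT_comp mF); apply: measurable_scalerv => //.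
    exact: measurable_rv_cons.
  by congr (_ * _); apply: eq_lebint => v; rewrite rv_consZ.
rewrite !ray lebintS ge0_integral_opp//.
- congr (_ + _); apply: eq_integral => t _; first by rewrite mulr1.
  by rewrite mulrN1.
- by move=> x /=; apply: lebint_ge0.
- exact: measurable_marginal.
Qed.

(** Both integrals decompose over the same two hyperplanes of directions with the same weight t^m,
    so an inequality on each ray can be integrated over directions. *)
Lemma le_lebint_rays m (F G : 'rV[R]_m.+1 -> \bar R) :
  (forall v, 0 <= F v) -> measurable_fun setT F ->
  (forall v, 0 <= G v) -> measurable_fun setT G ->
  (forall y, y != 0%R ->
    \int[mu]_(t in `]0%R, +oo[) ((t ^+ m)%:E * F (t *: y)%R) <=
    \int[mu]_(t in `]0%R, +oo[) ((t ^+ m)%:E * G (t *: y)%R)) ->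
  lebint F <= lebint G.
Proof.
move=> F0 mF G0 mG FG; rewrite !lebint_polar//.
have ray0 (H : 'rV[R]_m.+1 -> \bar R) s w : (forall v, 0 <= H v) ->
    0 <= \int[mu]_(t in `]0%R, +oo[) ((t ^+ m)%:E * H (t *: rv_cons s w)%R).
  move=> H0; apply: integral_ge0 => t /=; rewrite in_itv/= andbT => t0.
  by rewrite mule_ge0// lee_fin exprn_ge0// ltW.
have mray (H : 'rV[R]_m.+1 -> \bar R) s : (forall v, 0 <= H v) ->
    measurable_fun setT H -> measurable_fun setT (fun w =>
    \int[mu]_(t in `]0%R, +oo[) ((t ^+ m)%:E * H (t *: rv_cons s w)%R)).
  move=> H0 mH; under eq_fun do rewrite integral_mkcond.
  pose H' (p : 'rV[R]_m * measurableTypeR R) :=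
    (`|p.2| ^+ m)%:E * H (p.2 *: rv_cons s p.1)%R * (\1_`]0%R, +oo[ p.2)%:E.
  apply: (eq_measurable_fun (fun w => \int[mu]_t H' (w, t))).
    move=> w _; apply: eq_integral => t _.
    rewrite /H' /patch indicE/= mem_setE in_itv/= andbT.
    by case: ifPn => t0; rewrite ?mule0 ?mule1// gtr0_norm.
  apply: (@measurable_fun_fubini_tonelli_F _ _ _ _ _ mu H').
    apply: emeasurable_funM.
      apply: emeasurable_funM.
        apply/measurable_EFinP; apply: measurable_funX.
        exact: (measurableT_comp (@normr_measurable R setT) measurable_snd).
      apply: (measurableT_comp mH); apply: measurable_scalerv => //.
      exact: measurable_rv_cons.
    by apply/measurable_EFinP; apply: (measurableT_comp (measurable_indic _)).
  by move=> p; rewrite !mule_ge0// lee_fin// exprn_ge0.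
apply: leeD; apply: le_lebint; (try by move=> w; exact: ray0);
  (try exact: mray) => w; apply: FG; apply/eqP => /rowP /(_ ord0);
  rewrite rv_cons0 mxE => /eqP; rewrite ?oppr_eq0 oner_eq0//.
Qed.

End change_of_variables.

(** * Regularization of quasiconcave functions *)

Section thin_sets.
Context {R : realType}.
Notation mu := (@lebesgue_measure R).

(* A log-concave function need not be Borel, so [lebint] is not known to be additive
   on it.  Modification on a thin set does not change an iterated integral,
   measurable or not: at each level only countably many slices are affected. *)
Fixpoint thin (n : nat) : set 'rV[R]_n -> Prop :=
  match n return set 'rV[R]_n -> Prop with
  | 0 => fun A => ~ A 0
  | m.+1 => fun A => countable [set x : R | ~ thin (fun v : 'rV[R]_m => A (rv_cons x v))]
  end.

Lemma thin_subset n (A B : set 'rV[R]_n) : A `<=` B -> thin B -> thin A.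
Proof.
elim: n A B => [|n IH] A B AB /=; first by move=> B0 /AB.
apply: sub_countable; apply: subset_card_le => x /=; apply: contra_not.
by apply: IH => v; exact: AB.
Qed.

Lemma thin_bigcup n (A : (set 'rV[R]_n)^nat) :
  (forall k, thin (A k)) -> thin (\bigcup_k A k).
Proof.
elim: n A => [|n IH] A tA /=; first by move=> [k _]; exact: tA.
apply: (@sub_countable _ _ _ (\bigcup_k
  [set x : R | ~ thin (fun v : 'rV[R]_n => A k (rv_cons x v))])); last first.
  by apply: bigcup_countable => // k _; exact: tA.
apply: subset_card_le => x /=; apply: contra_notP => nA.
have xA k : thin (fun v : 'rV[R]_n => A k (rv_cons x v)).
  by apply: contrapT => ?; apply: nA; exists k.
apply: (@thin_subset _ _ (\bigcup_k (fun v => A k (rv_cons x v)))).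
  by move=> v [k _ Akv]; exists k.
exact: IH.
Qed.

Lemma thin0 n : thin (set0 : set 'rV[R]_n).
Proof.
elim: n => [//|n IH] /=; rewrite (_ : [set _ | _] = set0)//.
by apply/seteqP; split => // x /=; apply; exact: IH.
Qed.

Lemma thinU n (A B : set 'rV[R]_n) : thin A -> thin B -> thin (A `|` B).
Proof.
move=> tA tB; rewrite -bigcup2E; apply: thin_bigcup => -[//|[//|k]].
exact: thin0.
Qed.

Lemma thin_translate n (A : set 'rV[R]_n) (z : 'rV[R]_n) :
  thin A -> thin [set v | A (v + z)].
Proof.
elim: n A z => [|n IH] A z /=; first by rewrite thinmx0.
move=> cA; apply: (@sub_countable _ _ _ ((fun y => y - z ord0 ord0) @`
    [set x : R | ~ thin (fun v : 'rV[R]_n => A (rv_cons x v))])); last first.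
  exact: card_le_trans (card_image_le _ _) cA.
apply: subset_card_le => x /= ntx; exists (x + z ord0 ord0); last by rewrite addrK.
apply: contra_not ntx => /(IH _ (\row_j z ord0 (lift ord0 j))).
by apply: thin_subset => v /=; rewrite [X in _ + X]rv_cons_eta rv_consD.
Qed.

(** Off a countable set [S] of first coordinates the slices have equal integrals by induction. The
    marginal of [F] is measurable although [F] may not be: it agrees with that of [G] off [S], and
    every subset of a countable set is measurable. *)
Lemma lebint_thin n (F G : 'rV[R]_n -> \bar R) :
  (forall v, (0 <= F v)%E) -> (forall v, (0 <= G v)%E) -> measurable_fun setT G ->
  thin [set v | F v <> G v] -> lebint F = lebint G.
Proof.
elim: n F G => [|n IH] F G F0 G0 mG; first by move=> /= /contrapT.
rewrite !lebintS => cS0.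
pose S := [set x : R | ~ thin [set v | F (rv_cons x v) <> G (rv_cons x v)]].
have {cS0} cS : countable S by exact: cS0.
have SP x : ~ S x -> lebint (fun v => F (rv_cons x v)) = lebint (fun v => G (rv_cons x v)).
  by move=> /contrapT; apply: IH => //; exact: measurable_slice.
have mS (B : set (measurableTypeR R)) : B `<=` S -> measurable B.
  move=> BS; apply: countable_measurable => [t|]; first exact: measurable_set1.
  by apply: sub_countable cS; exact: subset_card_le.
have mg := measurable_marginal G0 mG.
have mf : measurable_fun setT (fun x : measurableTypeR R =>
    lebint (fun v => F (rv_cons x v))).
  move=> _ B mB; rewrite setTI.
  rewrite -(@setUIDK _ ((fun x => lebint (fun v => F (rv_cons x v))) @^-1` B) S).
  apply: measurableU; first by apply: mS => x [].
  rewrite (_ : _ `\` S = (fun x => lebint (fun v => G (rv_cons x v))) @^-1` B `\` S).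
    apply: measurableD; last exact: mS.
    by rewrite -[X in measurable X]setTI; exact: mg.
  by apply/seteqP; split => x /= [Bx Sx]; split => //; rewrite ?SP// -?SP.
apply: ge0_ae_eq_integral => //.
- by move=> x _; exact: lebint_ge0.
- by move=> x _; exact: lebint_ge0.
exists S; split; first exact: mS.
  exact: countable_lebesgue_measure0.
by move=> x /=; apply: contra_notP => /SP -> _.
Qed.

Definition cube n (q : 'rV[R]_n) (e : R) : set 'rV[R]_n :=
  [set x | forall i, `|x ord0 i - q ord0 i| < e].

(* Interior for the sup norm; a countable union of rational cubes, hence Borel. *)
Definition cint n (A : set 'rV[R]_n) : set 'rV[R]_n :=
  [set x | exists2 e, 0 < e & cube x e `<=` A].

Lemma measurable_cube n (q : 'rV[R]_n) (e : R) : measurable (cube q e).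
Proof.
rewrite -[cube q e]setCK; apply: measurableC.
rewrite (_ : ~` _ = \bigcup_(i : 'I_n) ((fun x : 'rV[R]_n => x ord0 i) @^-1`
    [set y | e <= `|y - q ord0 i|])); last first.
  apply/seteqP; split => [x /= /existsNP[i /negP]|x [i _ /= xi] /(_ i)].
    by rewrite -leNgt => xi; exists i.
  by rewrite ltNge xi.
apply: countable_bigcupT_measurable => [|i]; first exact: countableP.
rewrite -[X in measurable X]setTI; apply: measurable_coord => //.
rewrite -[X in measurable X]setTI.
have mf : measurable_fun setT (fun y : measurableTypeR R => `|y - q ord0 i|).
  by apply: measurableT_comp => //; apply: measurable_funB.
rewrite (_ : [set _ | _] = (fun y : R => `|y - q ord0 i|) @^-1` `[e, +oo[).
  by apply: mf => //; exact: measurable_itv.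
by apply/seteqP; split => y /=; rewrite in_itv/= andbT.
Qed.

Lemma measurable_cint n (A : set 'rV[R]_n) : measurable (cint A).
Proof.
pose Q := ('rV[rat]_n * nat)%type.
pose c (p : Q) := cube (map_mx ratr p.1 : 'rV[R]_n) p.2.+1%:R^-1.
rewrite (_ : cint A = \bigcup_(p : Q) [set x | c p x /\ c p `<=` A]).
  apply: countable_bigcupT_measurable => [|p]; first exact: countableP.
  have [cA|ncA] := pselect (c p `<=` A).
    rewrite (_ : [set _ | _] = c p); first exact: measurable_cube.
    by apply/seteqP; split => [x []|].
  by rewrite (_ : [set _ | _] = set0)//; apply/seteqP; split => [x []|].
apply/seteqP; split => [x [e e0 xA]|x [p _ [cx cA]]].
  (* Makes the radius 1 / (k + 1) smaller than e / 2, so a cube of that radius whose rational centre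
     is that close to [x] stays inside the cube of radius [e] around [x]. *)
  pose k := Num.truncn (2 / e).
  have k0 : 0 < k.+1%:R :> R by [].
  have ke : k.+1%:R^-1 < e / 2.
    rewrite -[ltRHS]invrK ltf_pV2 ?posrE ?invr_gt0 ?divr_gt0// invf_div.
    exact: truncnS_gt.
  have /choice[q qP] : forall i : 'I_n, exists q : rat,
      `|x ord0 i - ratr q| < k.+1%:R^-1.
    move=> i; have : x ord0 i - k.+1%:R^-1 < x ord0 i + k.+1%:R^-1.
      by rewrite ltrD2l gtrN// invr_gt0.
    move=> /rat_in_itvoo[r]; rewrite in_itv/= => /andP[r1 r2]; exists r.
    by rewrite ltr_distlC r1.
  exists (\row_i q i, k) => //; split => [i|y cy]; first by rewrite !mxE.
  apply: xA => i; have := cy i; have := qP i; rewrite !mxE /= => xq yq.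
  have -> : y ord0 i - x ord0 i = (y ord0 i - ratr (q i)) - (x ord0 i - ratr (q i)).
    by ring.
  apply: (le_lt_trans (ler_normB _ _)).
  by rewrite (lt_trans (ltrD yq xq))// [ltRHS](splitr e) ltrD.
have /choice[e eP] : forall i, exists e, 0 < e /\
    `|x ord0 i - ratr (p.1 ord0 i)| + e <= p.2.+1%:R^-1.
  move=> i; have := cx i; rewrite mxE => xi.
  exists (p.2.+1%:R^-1 - `|x ord0 i - ratr (p.1 ord0 i)|); split.
    by rewrite subr_gt0.
  by rewrite addrC subrK.
(* The smallest slack over all coordinates; the default value 1 keeps the radius positive when there
   are no coordinates. *)
exists (\big[Num.min/1]_i e i).
  by elim/big_ind: _ => // [a b a0 b0|i _]; [rewrite lt_min a0|case: (eP i)].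
move=> y yx; apply: cA => i; rewrite mxE; have [_ ei] := eP i.
have yi : `|y ord0 i - x ord0 i| < e i.
  by apply: lt_le_trans (yx i) _; exact: bigmin_le_cond.
have -> : y ord0 i - ratr (p.1 ord0 i) =
  (y ord0 i - x ord0 i) + (x ord0 i - ratr (p.1 ord0 i)) by ring.
apply: (le_lt_trans (ler_normD _ _)); apply: lt_le_trans ei.
by rewrite addrC ltrD2l.
Qed.

Definition convex_set_rv n (C : set 'rV[R]_n) := forall x y (l : R),
  0 <= l <= 1 -> C x -> C y -> C ((1 - l) *: x + l *: y).

Lemma convex_slice n (C : set 'rV[R]_n.+1) (x : R) :
  convex_set_rv C -> convex_set_rv (fun v => C (rv_cons x v)).
Proof.
move=> cC v w l l01 Cv Cw; have := cC _ _ _ l01 Cv Cw.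
by rewrite !rv_consZ rv_consD -mulrDl subrK mul1r.
Qed.

(** A convex set that contains a cube in the slice at [x] and a further point [a] contains the cone
    joining them. Near its base this cone has slices containing a cube of one fixed radius [d]. *)
Lemma convex_cone n (C : set 'rV[R]_n.+1) (x e : R) (v : 'rV[R]_n) (a : 'rV[R]_n.+1) :
  convex_set_rv C -> 0 < e -> cube v e `<=` (fun w => C (rv_cons x w)) -> C a ->
  exists2 d, 0 < d & forall l y, 0 <= l <= d -> cube v d y ->
    C (rv_cons ((1 - l) * x + l * a ord0 ord0) y).
Proof.
move=> cC e0 ve Ca.
pose M := \sum_i `|a ord0 (lift ord0 i) - v ord0 i|.
have M0 : 0 <= M by exact: sumr_ge0.
(* With l <= d <= 1/2, the point [w] below differs from [v] by less than d (1 + M) / (1 - l) in each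
   coordinate, and this is at most (e / 2) / (1 / 2) = e. *)
pose d := Num.min 2^-1 (e / (2 * (1 + M))).
have d0 : 0 < d by rewrite lt_min invr_gt0 ltr0n/= divr_gt0// mulr_gt0//; lra.
have dM : d * (1 + M) <= e / 2.
  rewrite -ler_pdivlMr; last lra.
  rewrite -mulrA -invfM; by rewrite /d ge_min lexx orbT.
exists d => // l y /andP[l0 ld] vy.
have l1 : l <= 2^-1 by apply: le_trans ld _; rewrite /d ge_min lexx.
pose a' := \row_j a ord0 (lift ord0 j).
(* Projection of the target point from the apex [a] back to the slice at [x]. *)
pose w := (1 - l)^-1 *: (y - l *: a').
have -> : rv_cons ((1 - l) * x + l * a ord0 ord0) y = (1 - l) *: rv_cons x w + l *: a.
  rewrite [in RHS](rv_cons_eta a) !rv_consZ rv_consD; congr rv_cons.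
  by rewrite scalerA divff ?scale1r ?subrK//; lra.
apply: cC => //; first by apply/andP; split; lra.
apply: ve => i; rewrite !mxE.
have vyi := vy i.
have aM : `|a ord0 (lift ord0 i) - v ord0 i| <= M.
  by rewrite /M (bigD1 i)//= lerDl; exact: sumr_ge0.
have -> : (1 - l)^-1 * (y ord0 i - l * a ord0 (lift ord0 i)) - v ord0 i =
   (1 - l)^-1 * ((y ord0 i - v ord0 i) - l * (a ord0 (lift ord0 i) - v ord0 i)).
  by field; lra.
rewrite normrM gtr0_norm ?invr_gt0; last lra.
rewrite mulrC ltr_pdivrMr; last lra.
apply: (le_lt_trans (ler_normB _ _)).
rewrite normrM (ger0_norm l0).
have : l * `|a ord0 (lift ord0 i) - v ord0 i| <= d * M by exact: ler_pM.
nra.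
Qed.

(* A point interior to its slice is interior to the convex set, unless that slice is
   one of the two extreme ones. *)
Lemma thin_convex n (C : set 'rV[R]_n) :
  convex_set_rv C -> thin (C `\` cint C).
Proof.
elim: n C => [|n IH] C cC /=.
  by move=> [C0]; apply; exists 1 => // y _; rewrite thinmx0 in C0 *.
pose P := [set x | exists v, C (rv_cons x v)].
pose Smin := [set x | P x /\ forall y, P y -> x <= y].
pose Smax := [set x | P x /\ forall y, P y -> y <= x].
apply: (@sub_countable _ _ _ (Smin `|` Smax)); last first.
  rewrite -bigcup2E; apply: bigcup_countable => // -[|[|k]] _ /=.
  - apply: finite_set_countable; have [[x Sx]|/forallNP nS] := pselect (exists x, Smin x).
      apply: sub_finite_set (finite_set1 x) => y [Py yP] /=.
      by apply/le_anti; rewrite yP ?Sx.2//; case: Sx.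
    by rewrite (_ : Smin = set0)//; apply/seteqP; split => // y /nS.
  - apply: finite_set_countable; have [[x Sx]|/forallNP nS] := pselect (exists x, Smax x).
      apply: sub_finite_set (finite_set1 x) => y [Py yP] /=.
      by apply/le_anti; rewrite yP ?Sx.2//; case: Sx.
    by rewrite (_ : Smax = set0)//; apply/seteqP; split => // y /nS.
  - exact: finite_set_countable.
apply: subset_card_le => x /=; apply: contra_notP => /not_orP[nmin nmax].
have [Px|nPx] := pselect (P x); last first.
  apply: thin_subset (thin0 n) => v [Cv _]; apply: nPx.
  by exists v.
(* As [x] is neither the least nor the greatest first coordinate occurring in [C], there are points
   of [C] on both sides, and each is the apex of a cone over the slice at [x]. *)
have [a aP ax] : exists2 a, P a & a < x.
  apply: contrapT => nex; apply: nmin; split => // y Py; rewrite leNgt.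
  by apply/negP => yx; apply: nex; exists y.
have [b bP bx] : exists2 b, P b & x < b.
  apply: contrapT => nex; apply: nmax; split => // y Py; rewrite leNgt.
  by apply/negP => yx; apply: nex; exists y.
apply: thin_subset (IH (fun v => C (rv_cons x v)) (convex_slice cC)).
move=> v [Cv ncv]; split => //; apply: contra_not ncv => -[e e0 ve].
have [a' a'P] := aP; have [b' b'P] := bP.
have [d1 d10 d1P] := convex_cone cC e0 ve a'P.
have [d2 d20 d2P] := convex_cone cC e0 ve b'P.
rewrite !rv_cons0 in d1P d2P.
have xa0 : 0 < x - a by rewrite subr_gt0.
have xb0 : 0 < b - x by rewrite subr_gt0.
(* The first two radii keep the remaining coordinates within the base cubes of the two cones. The
   last two keep the parameter |y_0 - x| / (x - a), respectively |y_0 - x| / (b - x), below [d1],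
   respectively [d2]. *)
exists (Num.min (Num.min d1 d2) (Num.min (d1 * (x - a)) (d2 * (b - x)))).
  by rewrite !lt_min d10 d20 !mulr_gt0.
move=> y yP.
have {yP} yP i : [/\ `|y ord0 i - rv_cons x v ord0 i| < d1,
    `|y ord0 i - rv_cons x v ord0 i| < d2,
    `|y ord0 i - rv_cons x v ord0 i| < d1 * (x - a) &
    `|y ord0 i - rv_cons x v ord0 i| < d2 * (b - x)].
  by have := yP i; rewrite !lt_min => /andP[/andP[? ?] /andP[? ?]].
rewrite (rv_cons_eta y).
have [_ _] := yP ord0; rewrite rv_cons0 !ltr_norml => /andP[y1 y1'] /andP[y2 y2'].
have c1 : cube v d1 (\row_j y ord0 (lift ord0 j)).
  by move=> i; rewrite mxE; have [+ _ _ _] := yP (lift ord0 i); rewrite rv_consS.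
have c2 : cube v d2 (\row_j y ord0 (lift ord0 j)).
  by move=> i; rewrite mxE; have [_ + _ _] := yP (lift ord0 i); rewrite rv_consS.
have [yx|xy] := leP (y ord0 ord0) x.
  have -> : y ord0 ord0 = (1 - (x - y ord0 ord0) / (x - a)) * x + (x - y ord0 ord0) / (x - a) * a.
    by field; lra.
  apply: d1P => //; apply/andP; split; last by rewrite ler_pdivrMr//; lra.
  by rewrite divr_ge0 ?subr_ge0 ?(ltW ax).
have -> : y ord0 ord0 = (1 - (y ord0 ord0 - x) / (b - x)) * x + (y ord0 ord0 - x) / (b - x) * b.
  by field; lra.
apply: d2P => //; apply/andP; split; last by rewrite ler_pdivrMr//; lra.
by rewrite divr_ge0// ltW// subr_gt0.
Qed.

(** The Borel representative is the supremum over rationals q >= 0 of q times the indicator of the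
    interior of {q < f}. It never exceeds [f]. Where it is smaller, a rational q in between puts the
    point in {q < f} but outside its interior; these exceptional points form a countable union of
    thin sets. *)
Lemma quasiconcave_measurable n (f : 'rV[R]_n -> R) :
  (forall x, 0 <= f x) -> (forall c, convex_set_rv [set x | c < f x]) ->
  exists g : 'rV[R]_n -> R, [/\ measurable_fun setT g, forall x, 0 <= g x &
    thin [set x | f x <> g x]].
Proof.
move=> f0 cf.
pose q (k : nat) : R := if unpickle k is Some r then `|ratr (r : rat)| else 0.
have q0 k : 0 <= q k by rewrite /q; case: (unpickle k).
pose C k := cint [set x | q k < f x].
pose h k x : \bar R := (q k * \1_(C k) x)%:E.
pose s x := ereal_sup [set h k x | k in setT].
have CA k : C k `<=` [set x | q k < f x].
  by move=> x [e e0]; apply => i; rewrite subrr normr0.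
have hf k x : (h k x <= (f x)%:E)%E.
  rewrite /h lee_fin indicE; case: (boolP (x \in C k)) => [|_].
    by rewrite inE mulr1 => /CA/ltW.
  by rewrite mulr0.
have sf x : (s x <= (f x)%:E)%E by apply: ge_ereal_sup => _ [k _ <-].
have hs k x : (h k x <= s x)%E by apply: ereal_sup_ubound; exists k.
have s0 x : (0 <= s x)%E.
  by apply: le_trans (hs 0 x); rewrite lee_fin mulr_ge0.
have sfin x : s x \is a fin_num.
  by rewrite ge0_fin_numE// (le_lt_trans (sf x))// ltry.
exists (fun x => fine (s x)); split.
- apply: measurableT_comp => //.
  have -> : s = fun x => esups (h ^~ x) 0%N.
    apply/funext => x; rewrite /s /esups /=; congr ereal_sup.
    by apply/seteqP; split => y [k _ <-]; exists k.
  apply: measurable_fun_esups => k; apply/measurable_EFinP.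
  apply: measurable_funM => //.
  exact: measurable_indic (measurable_cint _).
- by move=> x; exact: fine_ge0.
apply: (@thin_subset _ _ (\bigcup_k ([set x | q k < f x] `\` C k))); last first.
  by apply: thin_bigcup => k; exact: thin_convex.
move=> x /= /eqP; apply: contraPP => nx; apply/negP; rewrite negbK.
rewrite eq_le; apply/andP; split; last by rewrite -lee_fin fineK.
rewrite leNgt; apply/negP => /rat_in_itvoo[r]; rewrite in_itv/= => /andP[r1 r2].
have r0 : 0 <= ratr r :> R by rewrite (le_trans _ (ltW r1))// fine_ge0.
pose k := pickle r.
have qk : q k = ratr r by rewrite /q /k pickleK ger0_norm.
have Ck : C k x.
  by apply: contrapT => nC; apply: nx; exists k => //; split => //=; rewrite qk.
have := hs k x; rewrite -(fineK (sfin x)) lee_fin indicE mem_set// mulr1 qk.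
by rewrite leNgt r1.
Qed.

End thin_sets.

(** * The Prekopa-Leindler inequality *)

Section prekopa_leindler.
Context {R : realType}.
Notation mu := (@lebesgue_measure R).

Lemma weighted_amgm (l a b : R) : 0 < l < 1 -> 0 < a -> 0 < b ->
  a `^ (1 - l) * b `^ l <= (1 - l) * a + l * b.
Proof.
move=> /andP[l0 l1] a0 b0.
have l1' : 0 < 1 - l by rewrite subr_gt0.
have := @conjugate_powR R (a `^ (1 - l)) (b `^ l) (1 - l)^-1 l^-1.
rewrite !powR_ge0 !invr_gt0 !invrK subrK => /(_ isT isT l1' l0 erefl).
rewrite -!powRrM !divff ?gt_eqF// !powRr1 ?(ltW a0) ?(ltW b0)//.
by rewrite [(1 - l) * a]mulrC [l * b]mulrC.
Qed.

Lemma real_between (x : \bar R) (a : R) : (a%:E < x)%E ->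
  exists2 b, a < b & (b%:E < x)%E.
Proof.
case: x => [x| |]//; rewrite ?lte_fin => ax; last by exists (a + 1); rewrite ?ltrDl ?ltry.
by exists ((a + x) / 2); rewrite ?lte_fin; lra.
Qed.

(** Reduces an inequality between extended reals to real numbers strictly below the two terms, which
    is the form in which interval lengths are compared. *)
Lemma lee_conv (x y w : \bar R) (l : R) : 0 < l < 1 -> (0 <= x)%E -> (0 <= y)%E ->
  (forall r s, (r%:E < x)%E -> (s%:E < y)%E -> (((1 - l) * r + l * s)%:E <= w)%E) ->
  ((1 - l)%:E * x + l%:E * y <= w)%E.
Proof.
move=> /andP[l0 l1] x0 y0 H.
have l1' : 0 < 1 - l by rewrite subr_gt0.
case: w H => [w| |] H; last 2 first.
- by rewrite leey.
- have := H (-1) (-1); rewrite (lt_le_trans _ x0) ?lte_fin ?ltrN10//.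
  by rewrite (lt_le_trans _ y0) ?lte_fin ?ltrN10// => /(_ isT isT).
case: x x0 H => [x| |]// x0 H; last first.
  (* Paired with the lower bound -1 for the other term, this value makes the combination equal to w
     + 1, which contradicts the bound [w]. *)
  have := H ((w + 1 + l) / (1 - l)) (-1).
  rewrite ltry (lt_le_trans _ y0) ?lte_fin ?ltrN10// lee_fin => /(_ isT isT).
  rewrite mulrC divfK ?gt_eqF// => h; exfalso; clear -l0 l1 h; lra.
case: y y0 H => [y| |]// y0 H; last first.
  have := H (-1) ((w + 1 + (1 - l)) / l).
  rewrite ltry (lt_le_trans _ x0) ?lte_fin ?ltrN10// lee_fin => /(_ isT isT).
  rewrite (mulrC l) divfK ?gt_eqF// => h; exfalso; clear -l0 l1 h; lra.
apply/lee_subgt0Pr => e e0.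
have := H (x - e) (y - e); rewrite !lte_fin !gtrBl !lee_fin => /(_ e0 e0).
by move=> h; apply: le_trans h; clear -l0 l1; nra.
Qed.

(** Otherwise the interval is bounded and lies in [inf I, sup I], whose length is at most [r]. *)
Lemma interval_length (I : set R) (r : R) : is_interval I -> I !=set0 ->
  (r%:E < mu I)%E -> exists p q, [/\ I p, I q & r <= q - p].
Proof.
move=> iI [p0 Ip0] rI; apply: contrapT => nex.
have H p q : I p -> I q -> q - p < r.
  by move=> Ip Iq; rewrite ltNge; apply/negP => rpq; apply: nex; exists p, q.
have I0 : I !=set0 by exists p0.
have hs : has_sup I.
  by split => //; exists (p0 + r) => q Iq; have := H _ _ Ip0 Iq; lra.
have hi : has_inf I.
  by split => //; exists (p0 - r) => q Iq; have := H _ _ Iq Ip0; lra.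
have sub : I `<=` `[inf I, sup I]%classic.
  move=> q Iq /=; rewrite in_itv/= ge_inf//; last by case: hi.
  by rewrite ub_le_sup//; case: hs.
have le : sup I <= inf I + r.
  apply: ge_sup => // q Iq; rewrite -lerBlDr; apply: lb_le_inf => // p Ip.
  by have := H _ _ Ip Iq; lra.
have : (mu I <= mu `[inf I, sup I]%classic)%E.
  apply: le_measure => //; rewrite inE; first exact: is_interval_measurable.
  exact: measurable_itv.
move=> /(lt_le_trans rI); rewrite lebesgue_measure_itv/=; case: ifPn => _; last first.
  by rewrite lte_fin => r0; have := H _ _ Ip0 Ip0; lra.
by rewrite -EFinB lte_fin; lra.
Qed.

(** [W] contains the combinations of the left points and of the right points of long segments in [I]
    and [J], and, being an interval, everything in between. *)
Lemma brunn_minkowski_interval (I J W : set R) (l : R) : 0 < l < 1 ->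
  is_interval I -> is_interval J -> is_interval W -> I !=set0 -> J !=set0 ->
  (forall x y, I x -> J y -> W ((1 - l) * x + l * y)) ->
  ((1 - l)%:E * mu I + l%:E * mu J <= mu W)%E.
Proof.
move=> l01 iI iJ iW I0 J0 IJW; apply: lee_conv => // r s rI sJ.
have [p [q [Ip Iq rpq]]] := interval_length iI I0 rI.
have [p' [q' [Jp' Jq' spq]]] := interval_length iJ J0 sJ.
have /andP[l0 l1] := l01.
have key : (1 - l) * r + l * s <=
    ((1 - l) * q + l * q') - ((1 - l) * p + l * p') by nra.
have [lo|lo] := ltP ((1 - l) * p + l * p') ((1 - l) * q + l * q'); last first.
  by apply: (@le_trans _ _ 0%E) => //; rewrite lee_fin; lra.
apply: (@le_trans _ _ (mu `[(1 - l) * p + l * p', (1 - l) * q + l * q']%classic)).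
  by rewrite lebesgue_measure_itv/= lte_fin lo -EFinB lee_fin.
apply: le_measure; rewrite ?inE.
- exact: measurable_itv.
- exact: is_interval_measurable.
by move=> z /=; rewrite in_itv/= => zI; apply: iW zI; exact: IJW.
Qed.

Definition quasiconcave1 (F : R -> \bar R) :=
  forall s : R, 0 <= s -> is_interval [set x | (s%:E < F x)%E].

Lemma quasiconcave1_measurable (F : R -> \bar R) : (forall x, (0 <= F x)%E) ->
  quasiconcave1 F -> measurable_fun setT F.
Proof.
move=> F0 qF; apply: (measurability _ (ErealGenOInfty.measurableE R)).
move=> /= _ [_ [a ->]] <-; rewrite setTI.
have [a0|a0] := leP 0 a.
  rewrite (_ : _ @^-1` _ = [set x | (a%:E < F x)%E]).
    by apply: is_interval_measurable; exact: qF.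
  by apply/seteqP; split => x /=; rewrite in_itv/= andbT.
rewrite (_ : _ @^-1` _ = setT)//; apply/seteqP; split => // x _ /=.
by rewrite in_itv/= andbT (lt_le_trans _ (F0 x))// lte_fin.
Qed.

Section layer_cake.
Local Open Scope ereal_scope.
Variable F : R -> \bar R.
Hypotheses (F0 : forall x, 0 <= F x) (mF : measurable_fun setT F).

Let E : set (measurableTypeR R * measurableTypeR R) := [set p | p.2%:E < F p.1].

Let mE : measurable E.
Proof.
rewrite -[X in measurable X]setTI; apply: measurable_lte => //.
  exact: (measurableT_comp (@EFin_measurable R setT) measurable_snd).
exact: (measurableT_comp mF measurable_fst).
Qed.

Let ysectionE s : ysection E s = [set x | s%:E < F x].
Proof. by rewrite ysectionE. Qed.

Lemma measurable_superlevel :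
  measurable_fun setT (fun s : measurableTypeR R => mu [set x | s%:E < F x]).
Proof.
have := @measurable_fun_ysection _ _ _ _ R mu E mE.
by congr (measurable_fun _ _); apply/funext => s /=; rewrite ysectionE.
Qed.

(** Tonelli for the indicator of the region under [F] at heights between 0 and 1; the section above
    x is the open interval from 0 to min (F x, 1). *)
Lemma layer_cake1 : \int[mu]_x mine (F x) 1 =
  \int[mu]_(s in `]0%R, 1%R[) mu [set x | s%:E < F x].
Proof.
pose E' := E `&` (setT `*` `]0%R, 1%R[%classic).
have mE' : measurable E' by apply: measurableI => //; apply: measurableX.
have mi : measurable_fun setT (fun p => (\1_E' p : R)%:E).
  by apply/measurable_EFinP; exact: measurable_indic.
transitivity (\int[mu]_x \int[mu]_s (\1_E' (x, s) : R)%:E).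
  apply: eq_integral => x _.
  pose Sx : set R := [set s | s%:E < F x].
  have -> : (fun s => (\1_E' (x, s))%:E) =
      (fun s => (\1_(Sx `&` `]0%R, 1%R[%classic) s : R)%:E).
    apply/funext => s; rewrite !indicE; congr ((_ : bool)%:R%:E).
    by apply/idP/idP; rewrite !inE /E' /E /=; [move=> [? []]|move=> []].
  have im : Sx `&` `]0%R, 1%R[%classic =
      [set` `]0%R, fine (mine (F x) 1)[].
    apply/seteqP; split => s /=; rewrite !in_itv/=.
      move=> [sF /andP[-> s1]]/=; rewrite -lte_fin fineK ?lt_min ?sF ?lte_fin//.
      by rewrite ge0_fin_numE ?le_min ?F0 ?lee01// gt_min ltry orbT.
    move=> /andP[->]; rewrite -lte_fin fineK.
      by rewrite lt_min lte_fin => /andP[].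
    by rewrite ge0_fin_numE ?le_min ?F0 ?lee01// gt_min ltry orbT.
  rewrite im integral_indic// setIT.
  transitivity (mu `]0%R, fine (mine (F x) 1)[%classic); last by [].
  rewrite lebesgue_measure_itv/= lte_fin.
  have fm : mine (F x) 1 \is a fin_num.
    by rewrite ge0_fin_numE ?le_min ?F0 ?lee01// gt_min ltry orbT.
  case: ifPn => [_|]; first by rewrite sube0 fineK.
  rewrite -leNgt => h; apply/eqP; rewrite eq_le le_min F0 lee01 andbT.
  by move: h; rewrite -lee_fin fineK// andbT.
rewrite (@fubini_tonelli _ _ _ _ _ mu mu (fun p => (\1_E' p : R)%:E))//.
rewrite [RHS]integral_mkcond; apply: eq_integral => s _ /=.
rewrite /patch; case: ifPn => sI.
  pose Fs : set (measurableTypeR R) := [set x | (s : R)%:E < F x].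
  have ms : measurable Fs by rewrite /Fs -ysectionE; exact: measurable_ysection.
  transitivity (\int[mu]_x (\1_Fs x : R)%:E); last first.
    by rewrite integral_indic// setIT.
  apply: eq_integral => x _; rewrite !indicE; congr ((_ : bool)%:R%:E).
  by apply/idP/idP; rewrite !inE /E' /E /=; [move=> []|move=> ?; split => //; split => //; exact: set_mem].
rewrite integral0_eq// => x _; rewrite indicE memNset// => -[_ [_ /=]].
by move: sI; rewrite notin_setE.
Qed.

End layer_cake.

(* Below height 1 all superlevel sets of [F] and [G] are nonempty, which the
   one-dimensional Brunn-Minkowski inequality requires. *)
Lemma prekopa_leindler_normalized (l : R) (F G H : R -> \bar R) : 0 < l < 1 ->
  (forall x, (0 <= F x)%E) -> (forall x, (0 <= G x)%E) -> (forall x, (0 <= H x)%E) ->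
  quasiconcave1 F -> quasiconcave1 G -> quasiconcave1 H ->
  (exists x, (1 < F x)%E) -> (exists x, (1 < G x)%E) ->
  (forall x y (s : R), 0 < s -> (s%:E < F x)%E -> (s%:E < G y)%E ->
     (s%:E < H ((1 - l) * x + l * y)%R)%E) ->
  ((1 - l)%:E * \int[mu]_x mine (F x) 1 + l%:E * \int[mu]_x mine (G x) 1 <=
   \int[mu]_x H x)%E.
Proof.
move=> l01 F0 G0 H0 qF qG qH [x1 Fx1] [y1 Gy1] FGH.
have /andP[l0 l1] := l01.
have mF := quasiconcave1_measurable F0 qF.
have mG := quasiconcave1_measurable G0 qG.
have mH := quasiconcave1_measurable H0 qH.
apply: (@le_trans _ _ (\int[mu]_x mine (H x) 1)%E); last first.
  apply: ge0_le_integral => //.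
  - by move=> x _; rewrite le_min H0 lee01.
  - exact: measurable_mine.
  - by move=> x _; rewrite ge_min lexx.
rewrite !layer_cake1//.
have mm (K : R -> \bar R) : (forall x, (0 <= K x)%E) -> measurable_fun setT K ->
   measurable_fun (`]0, 1[%classic : set (measurableTypeR R))
    (fun s : measurableTypeR R => mu [set x | (s%:E < K x)%E]).
  by move=> K0 mK; apply: measurable_funTS; exact: measurable_superlevel.
rewrite -!ge0_integralZl//; try exact: mm; try by rewrite lee_fin ?subr_ge0 ltW.
rewrite -ge0_integralD//; last 4 first.
- by move=> s _; rewrite mule_ge0// lee_fin subr_ge0 ltW.
- by apply: emeasurable_funM => //; exact: mm.
- by move=> s _; rewrite mule_ge0// lee_fin ltW.
- by apply: emeasurable_funM => //; exact: mm.
apply: ge0_le_integral => //.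
- by move=> s _; rewrite adde_ge0// mule_ge0// lee_fin ?subr_ge0 ltW.
- by apply: emeasurable_funD; apply: emeasurable_funM => //; exact: mm.
- exact: mm.
move=> s /=; rewrite in_itv/= => /andP[s0 s1].
apply: brunn_minkowski_interval => //; try by apply: (qF, qG, qH); exact: ltW.
- by apply: qF; exact: ltW.
- by apply: qG; exact: ltW.
- by apply: qH; exact: ltW.
- by exists x1; apply: lt_trans Fx1; rewrite lte_fin.
- by exists y1; apply: lt_trans Gy1; rewrite lte_fin.
- by move=> x y /= Fx Gy; exact: FGH.
Qed.

Import HBSimple HBNNSimple.

(** The truncation level must be strictly exceeded by [F] somewhere and yet keep the integral above
    [a]. Take a simple h <= F with integral above some b > a, and t = a / b < 1. The level t sup h
    works, because min (F, t sup h) >= t h. *)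
Lemma integral_truncation (F : R -> \bar R) (a : R) :
  (forall x, (0 <= F x)%E) -> measurable_fun setT F ->
  0 < a -> (a%:E < \int[mu]_x F x)%E ->
  exists A, [/\ 0 < A, exists x, (A%:E < F x)%E &
     (a%:E < \int[mu]_x mine (F x) A%:E)%E].
Proof.
move=> F0 mF a0; rewrite ge0_integralTE// => /ereal_sup_gt[_ [h hF <-] ah].
have [M [_ /(_ (M + 1))]] := simple_bounded h.
rewrite ltrDl ltr01 => /(_ isT) hM.
have hM' x : h x <= M + 1 by apply: le_trans (ler_norm _) _; exact: hM.
have [b ab bh] := real_between ah.
pose S := sup (range h).
have hS x : h x <= S.
  by apply: ub_le_sup; [exists (M + 1) => _ [y _ <-]|exists x].
have b0 : 0 < b by exact: lt_trans ab.
have S0 : 0 < S.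
  rewrite ltNge; apply/negP => S0; move: bh.
  rewrite -integralT_nnsfun (eq_integral (cst 0%E)).
    by rewrite integral0 lte_fin => /(lt_trans b0); rewrite ltxx.
  move=> x _ /=; congr EFin; apply/eqP; rewrite eq_le fun_ge0 andbT.
  exact: le_trans (hS x) S0.
pose t := a / b.
have t0 : 0 < t by rewrite divr_gt0.
have t1 : t < 1 by rewrite ltr_pdivrMr// mul1r.
exists (t * S); split.
- by rewrite mulr_gt0.
- have : t * S < S by rewrite gtr_pMl.
  move=> /(@sup_gt _ (range h))[]; first by exists (h 0), 0.
  move=> _ [x _ <-] tx; exists x; apply: lt_le_trans (hF x).
  by rewrite lte_fin.
apply: (@lt_le_trans _ _ (\int[mu]_x (t%:E * (h x)%:E))%E).
  rewrite ge0_integralZl//; last 3 first.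
  - exact/measurable_EFinP.
  - by move=> x _; rewrite lee_fin fun_ge0.
  - by rewrite lee_fin ltW.
  rewrite integralT_nnsfun (_ : a = t * b); last by rewrite /t divfK// gt_eqF.
  by rewrite EFinM lte_pmul2l// lte_fin.
apply: ge0_le_integral => //.
- by move=> x _; rewrite mule_ge0// lee_fin ?(ltW t0)// fun_ge0.
- by apply: emeasurable_funM => //; apply/measurable_EFinP.
- exact: measurable_mine.
move=> x _; rewrite le_min; apply/andP; split.
  apply: le_trans (hF x); rewrite -EFinM lee_fin ler_piMl ?fun_ge0//.
  exact: ltW.
by rewrite -EFinM lee_fin ler_pM2l.
Qed.

(** Divide [F] by [A] and [G] by [B], so that both rise above height 1, apply the normalized form,
    and pass from the weighted arithmetic mean to the geometric one. *)
Lemma prekopa_leindler1 (l : R) (F G H : R -> \bar R) : 0 < l < 1 ->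
  (forall x, (0 <= F x)%E) -> (forall x, (0 <= G x)%E) -> (forall x, (0 <= H x)%E) ->
  quasiconcave1 F -> quasiconcave1 G -> quasiconcave1 H ->
  (forall x y (a b : R), 0 < a -> 0 < b -> (a%:E < F x)%E -> (b%:E < G y)%E ->
     ((a `^ (1 - l) * b `^ l)%:E < H ((1 - l) * x + l * y)%R)%E) ->
  forall a b : R, 0 < a -> 0 < b -> (a%:E < \int[mu]_x F x)%E ->
    (b%:E < \int[mu]_x G x)%E ->
    ((a `^ (1 - l) * b `^ l)%:E < \int[mu]_x H x)%E.
Proof.
(* The normalized form gives a non-strict inequality. Strictness comes from replacing [a0] by a
   larger [a] still below the integral of [F]. *)
move=> l01 F0 G0 H0 qF qG qH FGH a0 b a00 b0 /real_between[a a0a aF] bG.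
have a_gt0 : 0 < a by exact: lt_trans a0a.
have /andP[l0 l1] := l01.
have l1' : 0 < 1 - l by rewrite subr_gt0.
apply: (@lt_le_trans _ _ ((a `^ (1 - l) * b `^ l)%:E)).
  by rewrite lte_fin ltr_pM2r ?powR_gt0// gt0_ltr_powR// nnegrE ltW.
have mF := quasiconcave1_measurable F0 qF.
have mG := quasiconcave1_measurable G0 qG.
have mH := quasiconcave1_measurable H0 qH.
have [A [A0 AF aA]] := integral_truncation F0 mF a_gt0 aF.
have [B [B0 BG bB]] := integral_truncation G0 mG b0 bG.
(* The matching scale for [H]: heights A s and B s combine to C s, since the exponents of s add up
   to 1. *)
pose C := A `^ (1 - l) * B `^ l.
have C0 : 0 < C by rewrite mulr_gt0// powR_gt0.
pose sc (c : R) (K : R -> \bar R) x := (c^-1%:E * K x)%E.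
have lt_sc (c s : R) K x : 0 < c -> (s%:E < sc c K x)%E = ((c * s)%:E < K x)%E.
  move=> c0; rewrite /sc -(@lte_pmul2l _ c%:E)// muleA -!EFinM divff ?gt_eqF//.
  by rewrite mul1e.
have sc0 c K x : 0 < c -> (forall y, (0 <= K y)%E) -> (0 <= sc c K x)%E.
  by move=> c0 K0; rewrite mule_ge0// lee_fin invr_ge0 ltW.
have qsc c K : 0 < c -> quasiconcave1 K -> quasiconcave1 (sc c K).
  move=> c0 qK s s0 x y; rewrite /= !lt_sc// => sx sy z xyz.
  rewrite lt_sc//; apply: (qK (c * s) _ x y) => //.
  by rewrite mulr_ge0// ltW.
have isc c K : 0 < c -> (forall y, (0 <= K y)%E) -> measurable_fun setT K ->
    (\int[mu]_x sc c K x = c^-1%:E * \int[mu]_x K x)%E.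
  by move=> c0 K0 mK; rewrite ge0_integralZl// lee_fin invr_ge0 ltW.
have imin c K : 0 < c -> (forall y, (0 <= K y)%E) -> measurable_fun setT K ->
    (\int[mu]_x mine (sc c K x) 1 = c^-1%:E * \int[mu]_x mine (K x) c%:E)%E.
  move=> c0 K0 mK; rewrite -ge0_integralZl//; last 3 first.
  - exact: measurable_mine.
  - by move=> x _; rewrite le_min K0 lee_fin ltW.
  - by rewrite lee_fin invr_ge0 ltW.
  apply: eq_integral => x _; rewrite /sc.
  have -> : 1%E = (c^-1%:E * c%:E)%E by rewrite -EFinM mulVf// gt_eqF.
  by rewrite !minEle lee_pmul2l// ?lte_fin ?invr_gt0//; case: ifP.
have : ((1 - l)%:E * \int[mu]_x mine (sc A F x) 1 + l%:E * \int[mu]_x mine (sc B G x) 1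
    <= \int[mu]_x sc C H x)%E.
  apply: prekopa_leindler_normalized => //.
  - by move=> x; exact: sc0.
  - by move=> x; exact: sc0.
  - by move=> x; exact: sc0.
  - exact: qsc.
  - exact: qsc.
  - exact: qsc.
  - by have [x Ax] := AF; exists x; rewrite lt_sc// mulr1.
  - by have [x Bx] := BG; exists x; rewrite lt_sc// mulr1.
  move=> x y s s0; rewrite !lt_sc// => sF sG.
  have := FGH x y _ _ (mulr_gt0 A0 s0) (mulr_gt0 B0 s0) sF sG.
  rewrite !powRM ?(ltW A0) ?(ltW B0) ?(ltW s0)// mulrACA -powRD ?subrK ?powRr1 ?(ltW s0)//.
  by rewrite oner_eq0.
rewrite !imin// isc// => le.
rewrite -(@lee_pmul2l _ C^-1%:E) ?lte_fin ?invr_gt0//.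
apply: le_trans le.
apply: (@le_trans _ _ ((1 - l) * (A^-1 * a) + l * (B^-1 * b))%:E).
  rewrite -EFinM lee_fin; apply: le_trans; last first.
    by apply: weighted_amgm => //; rewrite mulr_gt0// invr_gt0.
  rewrite !powRM ?invr_ge0 ?(ltW A0) ?(ltW B0) ?(ltW a_gt0) ?(ltW b0)//.
  rewrite -!powR_inv1 ?(ltW A0) ?(ltW B0) ?(ltW C0)// -!powRrM !mulN1r !powRN.
  by rewrite powRr1 ?(ltW C0)// mulrACA -invfM.
rewrite EFinD !EFinM; apply: leeD.
  rewrite lee_pmul2l ?lte_fin// lee_pmul2l ?lte_fin ?invr_gt0//; exact: ltW.
by rewrite lee_pmul2l ?lte_fin// lee_pmul2l ?lte_fin ?invr_gt0//; exact: ltW.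
Qed.

(* The pointwise hypothesis of Prekopa-Leindler, phrased with strict lower bounds so
   that no product [0 * +oo] arises and the statement has the same shape for integrals. *)
Definition pl_triple (V : lmodType R) (l : R) (F G H : V -> \bar R) :=
  forall (x y : V) (a b : R), 0 < a -> 0 < b -> (a%:E < F x)%E -> (b%:E < G y)%E ->
     ((a `^ (1 - l) * b `^ l)%:E < H ((1 - l) *: x + l *: y)%R)%E.

Lemma pl_quasiconcave1 (F : R -> \bar R) : (forall x, (0 <= F x)%E) ->
  (forall l, 0 < l < 1 -> @pl_triple R^o l F F F) -> quasiconcave1 F.
Proof.
move=> F0 plF s s0 x y /= sx sy z /andP[xz zy].
have [->//|xz'] := eqVneq z x; have [->//|zy'] := eqVneq z y.
have {xz' }xz : x < z by rewrite lt_neqAle eq_sym xz'.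
have {zy' }zy : z < y by rewrite lt_neqAle zy'.
have [a sa ax] := real_between sx; have [b sb bx] := real_between sy.
(* A common level for both endpoints, for which c^(1 - l) c^l is [c] again; it is strictly above
   [s]. *)
pose c := Num.min a b.
have sc : s < c by rewrite lt_min sa.
have c0 : 0 < c by exact: le_lt_trans sc.
have cx : (c%:E < F x)%E by apply: le_lt_trans ax; rewrite lee_fin /c ge_min lexx.
have cy : (c%:E < F y)%E by apply: le_lt_trans bx; rewrite lee_fin /c ge_min lexx orbT.
pose l := (z - x) / (y - x).
have yx0 : 0 < y - x by lra.
have l01 : 0 < l < 1.
  by apply/andP; split; [rewrite divr_gt0//; lra|rewrite ltr_pdivrMr//; lra].
have := plF l l01 x y c c c0 c0 cx cy.
rewrite -powRD ?subrK ?oner_eq0// powRr1 ?(ltW c0)//.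
have -> : (1 - l) *: (x : R^o) + l *: (y : R^o) = z.
  by rewrite /GRing.scale /= /l; field; lra.
by apply: lt_trans; rewrite lte_fin.
Qed.

Definition log_concave_ereal (V : lmodType R) (F : V -> \bar R) :=
  forall l, 0 < l < 1 -> pl_triple l F F F.

Lemma pl_slice n l (F G H : 'rV[R]_n.+1 -> \bar R) x y :
  pl_triple l F G H -> pl_triple l (fun v => F (rv_cons x v)) (fun v => G (rv_cons y v))
    (fun v => H (rv_cons ((1 - l) * x + l * y) v)).
Proof.
move=> FGH v w a b a0 b0 aF bG; have := FGH _ _ _ _ a0 b0 aF bG.
by rewrite !rv_consZ rv_consD.
Qed.

Lemma lc_slice n (F : 'rV[R]_n.+1 -> \bar R) x :
  log_concave_ereal F -> log_concave_ereal (fun v => F (rv_cons x v)).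
Proof.
move=> lcF l l01; have := @pl_slice n l F F F x x (lcF l l01).
by rewrite -mulrDl subrK mul1r.
Qed.

(** The functions may be non-Borel. By induction the marginals in the first coordinate satisfy the
    hypothesis of the one-dimensional case. The induction hypothesis with three equal functions
    makes each marginal log-concave, hence quasiconcave on the line, hence measurable. *)
Lemma prekopa_leindler n l (F G H : 'rV[R]_n -> \bar R) : 0 < l < 1 ->
  (forall x, (0 <= F x)%E) -> (forall x, (0 <= G x)%E) -> (forall x, (0 <= H x)%E) ->
  log_concave_ereal F -> log_concave_ereal G -> log_concave_ereal H -> pl_triple l F G H ->
  forall a b : R, 0 < a -> 0 < b -> (a%:E < lebint F)%E -> (b%:E < lebint G)%E ->
    ((a `^ (1 - l) * b `^ l)%:E < lebint H)%E.
Proof.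
elim: n l F G H => [|n IH] l F G H l01 F0 G0 H0 lcF lcG lcH FGH a b a0 b0.
  by move=> aF bG; have := FGH 0 0 _ _ a0 b0 aF bG; rewrite !scaler0 addr0.
have qc (K : 'rV[R]_n.+1 -> \bar R) : (forall x, (0 <= K x)%E) -> log_concave_ereal K ->
    quasiconcave1 (fun x => lebint (fun v => K (rv_cons x v))).
  move=> K0 lcK; apply: pl_quasiconcave1 => [x|k k01 x y c d c0 d0].
    exact: lebint_ge0.
  apply: IH => //; try exact: lc_slice.
  by apply: pl_slice; exact: lcK.
rewrite !lebintS; apply: prekopa_leindler1 => //; try exact: qc;
  try by move=> x; apply: lebint_ge0.
move=> x y c d c0 d0; apply: IH => //; try exact: lc_slice.
exact: pl_slice.
Qed.

End prekopa_leindler.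

(** * One-dimensional integrals and the Gamma function *)

Section integrals.
Context {R : realType}.
Notation mu := (@lebesgue_measure R).

Lemma is_derive_continuous (F : R -> R) (x d : R) :
  is_derive x 1 F d -> {for x, continuous F}.
Proof.
by move=> [dF _]; apply: differentiable_continuous; exact/derivable1_diffP.
Qed.

Lemma FTC_segment (f F : R -> R) (a b : R) : a <= b ->
  (forall x, a <= x -> is_derive x 1 F (f x)) ->
  (forall x, a <= x -> {for x, continuous f}) ->
  (\int[mu]_(x in `[a, b]) (f x)%:E = (F b - F a)%:E)%E.
Proof.
move=> ab dF cf; move: ab; rewrite le_eqVlt => /predU1P[->|ab].
  by rewrite set_itv1 integral_set1 subrr.
rewrite (@continuous_FTC2 _ f F)//.
- apply: continuous_in_subspaceT => x; rewrite inE/= in_itv/= => /andP[ax _].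
  exact: cf.
- split.
  + by move=> x; rewrite in_itv/= => /andP[/ltW/dF[]].
  + by apply: cvg_at_right_filter; exact: (is_derive_continuous (dF a (lexx _))).
  + by apply: cvg_at_left_filter; exact: (is_derive_continuous (dF b (ltW ab))).
- move=> x; rewrite in_itv/= => /andP[/ltW/dF[_ <-] _].
  by rewrite derive1E.
Qed.

Lemma FTC_ray (f F : R -> R) (a l : R) :
  (forall x, a <= x -> is_derive x 1 F (f x)) ->
  (forall x, a <= x -> {for x, continuous f}) ->
  (forall x, a <= x -> 0 <= f x) -> F x @[x --> +oo] --> l ->
  (\int[mu]_(x in `[a, +oo[) (f x)%:E = (l - F a)%:E)%E.
Proof.
move=> dF cf f0 Fl; rewrite (@ge0_continuous_FTC2y _ f F a l)//.
- apply: continuous_in_subspaceT => x; rewrite inE/= in_itv/= andbT => ax.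
  exact: cf.
- by move=> x /ltW/dF[].
- by apply: cvg_at_right_filter; exact: (is_derive_continuous (dF a (lexx _))).
- move=> x; rewrite in_itv/= andbT => /ltW/dF[_ <-].
  by rewrite derive1E.
Qed.

Lemma measurable_EFin_comp (f : R -> R) (D : set R) : measurable_fun setT f ->
  measurable_fun (D : set (measurableTypeR R)) (fun x : measurableTypeR R => (f x)%:E).
Proof.
by move=> mf; apply: measurable_funTS; exact/measurable_EFinP.
Qed.

Lemma measurable_expRN : measurable_fun setT (fun t : R => expR (- t)).
Proof. exact: measurableT_comp (@measurable_expR R) (@oppr_measurable R setT). Qed.

Lemma continuous_expRN (x : R) : {for x, continuous (fun t : R => expR (- t))}.
Proof.
apply: continuous_comp; last exact: continuous_expR.
exact: continuousN.
Qed.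

Lemma is_derive_NexpRN (x : R) : is_derive x 1 (fun t : R => - expR (- t)) (expR (- x)).
Proof.
apply: is_derive_eq; rewrite /GRing.scale/= mulrN1 ?mulr1 ?opprK//.
Qed.

Lemma integral_expRN_below (t : R) : 0 <= t ->
  (\int[mu]_(s in `]0%R, t[) (expR (- s))%:E = (1 - expR (- t))%:E)%E.
Proof.
move=> t0; rewrite -(@integral_itv_bndoo _ 0 t _ true false); last first.
  exact: measurable_EFin_comp measurable_expRN.
have -> := FTC_segment t0 (fun x _ => is_derive_NexpRN x) (fun x _ => @continuous_expRN x).
by rewrite oppr0 expR0 opprK addrC.
Qed.

Lemma integral_expRN_above (s : R) :
  (\int[mu]_(t in `]s, +oo[) (expR (- t))%:E = (expR (- s))%:E)%E.
Proof.
rewrite integral_itv_obnd_cbnd; last exact: measurable_EFin_comp measurable_expRN.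
have F0 : - expR (- t) @[t --> +oo] --> (0 : R).
  by rewrite -oppr0; apply: cvgN; exact: cvgr_expR.
have -> := @FTC_ray _ _ s 0 (fun x _ => is_derive_NexpRN x)
  (fun x _ => @continuous_expRN x) (fun x _ => expR_ge0 (- x)) F0.
by rewrite sub0r opprK.
Qed.

Lemma integral_exprn_below (m : nat) (t : R) : 0 <= t ->
  (\int[mu]_(s in `]0%R, t[) (s ^+ m)%:E = (t ^+ m.+1 / m.+1%:R)%:E)%E.
Proof.
move=> t0; rewrite -(@integral_itv_bndoo _ 0 t _ true false); last first.
  by apply: measurable_EFin_comp; exact: exprn_measurable.
have dF (x : R) : 0 <= x -> is_derive x 1 (fun t => t ^+ m.+1 / m.+1%:R) (x ^+ m).
  move=> _; have d1 : is_derive x 1 (@GRing.exp R ^~ m.+1) (m.+1%:R * x ^+ m).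
    split; first exact: exprn_derivable.
    by rewrite exp_derive /GRing.scale/= mulr1.
  rewrite (_ : (fun t => _) = m.+1%:R^-1 *: (@GRing.exp R ^~ m.+1)); last first.
    by apply/funext => t' /=; rewrite mulrC.
  apply: is_derive_eq; rewrite /GRing.scale/= mulrA mulVf ?pnatr_eq0//.
  by rewrite mul1r.
have -> := FTC_segment t0 dF (fun x _ => @exprn_continuous _ m x).
by rewrite expr0n mul0r subr0.
Qed.

Lemma cvg_powRN (a : R) : 0 < a -> t `^ (- a) @[t --> +oo] --> (0 : R).
Proof.
move=> a0; apply/cvgrPdist_lt => e e0; near=> t.
have t0 : e `^ (- a^-1) < t by near: t; exact: nbhs_pinfty_gt.
have tp : 0 < t by apply: le_lt_trans t0; exact: powR_ge0.
rewrite sub0r normrN ger0_norm ?powR_ge0// powRN.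
rewrite -[ltRHS]invrK ltf_pV2 ?posrE ?powR_gt0 ?invr_gt0//.
rewrite -[ltLHS](_ : (e `^ (- a^-1)) `^ a = _).
  by apply: gt0_ltr_powR => //; rewrite nnegrE ?powR_ge0 ?ltW.
by rewrite -powRrM mulNr mulVf ?gt_eqF// powR_inv1 ?ltW.
Unshelve. all: by end_near. Qed.

Lemma integral_powR_above (a s : R) : 0 < a -> 0 < s ->
  (\int[mu]_(t in `]s, +oo[) (t `^ (- a - 1))%:E = (s `^ (- a) / a)%:E)%E.
Proof.
move=> a0 s0; rewrite integral_itv_obnd_cbnd; last first.
  by apply: measurable_EFin_comp; exact: measurable_powR.
have dF (x : R) : s <= x -> is_derive x 1 (fun t => - a^-1 * t `^ (- a)) (x `^ (- a - 1)).
  move=> sx; have x0 : 0 < x by exact: lt_le_trans sx.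
  have := is_derive1_powR (- a) x0 => dx; apply: is_derive_eq.
  by rewrite /GRing.scale/= ?scaler0 ?mulr0 ?addr0 mulrA mulrNN mulVf ?mul1r// gt_eqF.
have cf (x : R) : s <= x -> {for x, continuous (fun t => t `^ (- a - 1))}.
  move=> sx; have x0 : 0 < x by exact: lt_le_trans sx.
  exact: (is_derive_continuous (is_derive1_powR (- a - 1) x0)).
have F0 : - a^-1 * t `^ (- a) @[t --> +oo] --> (0 : R).
  by rewrite -(mulr0 (- a^-1)); apply: cvgMr; exact: cvg_powRN.
have -> := @FTC_ray _ _ s 0 dF cf (fun x _ => powR_ge0 x (- a - 1)) F0.
by rewrite sub0r mulNr opprK mulrC.
Qed.

End integrals.

Section half_line.
Context {R : realType}.
Notation mu := (@lebesgue_measure R).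
Local Open Scope ereal_scope.

Lemma tonelli_in (D : set (measurableTypeR R))
    (F : measurableTypeR R * measurableTypeR R -> \bar R) : measurable D ->
  (forall p, 0 <= F p) -> measurable_fun setT F ->
  \int[mu]_(t in D) \int[mu]_(s in D) F (t, s) =
  \int[mu]_(s in D) \int[mu]_(t in D) F (t, s).
Proof.
move=> mD F0 mF.
pose G (p : measurableTypeR R * measurableTypeR R) :=
  F p * (\1_D p.1)%:E * (\1_D p.2)%:E.
have mi : measurable_fun setT (\1_D : measurableTypeR R -> R).
  exact: measurable_indic.
have mG : measurable_fun setT G.
  apply: emeasurable_funM; first apply: emeasurable_funM => //.
    by apply/measurable_EFinP; exact: (measurableT_comp mi measurable_fst).
  by apply/measurable_EFinP; exact: (measurableT_comp mi measurable_snd).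
have G0 p : 0 <= G p by rewrite !mule_ge0// lee_fin.
transitivity (\int[mu]_t \int[mu]_s G (t, s)).
  rewrite integral_mkcond; apply: eq_integral => t _; rewrite /patch /G /= indicE.
  case: ifPn => tD; last by rewrite integral0_eq// => s _; rewrite mule0 mul0e.
  rewrite integral_mkcond; apply: eq_integral => s _; rewrite /patch mule1 indicE.
  by case: ifPn; rewrite ?mule1 ?mule0.
rewrite (@fubini_tonelli _ _ _ _ _ mu mu)//.
rewrite [RHS]integral_mkcond; apply: eq_integral => s _; rewrite /patch /G /= !indicE.
case: ifPn => sD; last by rewrite integral0_eq// => t _; rewrite mule0.
rewrite [RHS]integral_mkcond; apply: eq_integral => t _; rewrite /patch mule1 indicE.
by case: ifPn; rewrite ?mule1 ?mule0.
Qed.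

Lemma eq_integral_gt0 (A B : R -> \bar R) : (forall t, (0 < t)%R -> A t = B t) ->
  \int[mu]_(t in `]0%R, +oo[) A t = \int[mu]_(t in `]0%R, +oo[) B t.
Proof.
by move=> AB; apply: eq_integral => t; rewrite inE/= in_itv/= andbT; exact: AB.
Qed.

(** Integration by parts for nonnegative integrands, with no boundary terms to control. It yields
    both the recursion for the factorial moments and the integral of t^(- a - 1) (1 - exp (- t)). *)
Lemma tonelli_triangle (w v : R -> R) :
  measurable_fun setT w -> measurable_fun setT v ->
  (forall t, (0 < t)%R -> (0 <= w t)%R) -> (forall t, (0 < t)%R -> (0 <= v t)%R) ->
  \int[mu]_(t in `]0%R, +oo[) ((w t)%:E * \int[mu]_(s in `]0%R, t[) (v s)%:E) =
  \int[mu]_(s in `]0%R, +oo[) ((v s)%:E * \int[mu]_(t in `]s, +oo[) (w t)%:E).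
Proof.
move=> mw mv w0 v0.
(* [w] and [v] are nonnegative on the positive half-line only; absolute values extend this to the
   whole plane. *)
pose F (p : measurableTypeR R * measurableTypeR R) :=
  (`|w p.1| * `|v p.2| * (p.2 < p.1)%R%:R)%:E.
have F0 p : 0 <= F p by rewrite lee_fin !mulr_ge0.
have mF : measurable_fun setT F.
  apply/measurable_EFinP; apply: measurable_funM.
    apply: measurable_funM; apply: measurableT_comp => //.
      exact: (measurableT_comp mw measurable_fst).
    exact: (measurableT_comp mv measurable_snd).
  have mb : measurable_fun setT
      (fun p : measurableTypeR R * measurableTypeR R => (p.2 < p.1)%R).
    by apply: measurable_fun_ltr.
  have mN : measurable_fun setT (fun b : bool => (b%:R : R)) by [].
  exact: (measurableT_comp mN mb).
transitivity (\int[mu]_(t in `]0%R, +oo[) \int[mu]_(s in `]0%R, +oo[) F (t, s)).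
  apply: eq_integral_gt0 => t t0; rewrite -ge0_integralZl//; last 3 first.
  - exact: measurable_EFin_comp.
  - by move=> s /=; rewrite in_itv/= lee_fin => /andP[/v0].
  - by rewrite lee_fin w0.
  rewrite [LHS]integral_mkcond [RHS]integral_mkcond; apply: eq_integral => s _.
  rewrite /patch !mem_setE !in_itv/= andbT /F /= (ger0_norm (w0 _ t0)).
  case: (ltP 0%R s) => //= s0; rewrite (ger0_norm (v0 _ s0)) -EFinM.
  by case: ifPn; rewrite ?mulr1 ?mulr0.
rewrite tonelli_in//; apply: eq_integral_gt0 => s s0; rewrite -ge0_integralZl//; last 3 first.
- exact: measurable_EFin_comp.
- move=> t /=; rewrite in_itv/= andbT lee_fin => st; apply: w0; exact: lt_trans st.
- by rewrite lee_fin v0.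
rewrite [LHS]integral_mkcond [RHS]integral_mkcond; apply: eq_integral => t _.
rewrite /patch !mem_setE !in_itv/= !andbT /F /= (ger0_norm (v0 _ s0)).
case: (ltP s t) => st.
  have t0 : (0 < t)%R by exact: lt_trans st.
  by rewrite t0 (ger0_norm (w0 _ t0)) mulr1 -EFinM mulrC.
by rewrite mulr0; case: ifP.
Qed.

Lemma integral_gt0_ge0 (A : R -> \bar R) : (forall t, (0 < t)%R -> 0 <= A t) ->
  0 <= \int[mu]_(t in `]0%R, +oo[) A t.
Proof.
by move=> A0; apply: integral_ge0 => t /=; rewrite in_itv/= andbT; exact: A0.
Qed.

Lemma le_integral_gt0 (A B : R -> \bar R) :
  measurable_fun setT A -> measurable_fun setT B ->
  (forall t, (0 < t)%R -> 0 <= A t) -> (forall t, (0 < t)%R -> A t <= B t) ->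
  \int[mu]_(t in `]0%R, +oo[) A t <= \int[mu]_(t in `]0%R, +oo[) B t.
Proof.
move=> mA mB A0 AB; apply: ge0_le_integral => //.
- by move=> t /=; rewrite in_itv/= andbT; exact: A0.
- exact: measurable_funTS.
- exact: measurable_funTS.
- by move=> t /=; rewrite in_itv/= andbT; exact: AB.
Qed.

Lemma integralZl_gt0 (k : R) (A : R -> \bar R) : (0 <= k)%R ->
  measurable_fun setT A -> (forall t, (0 < t)%R -> 0 <= A t) ->
  \int[mu]_(t in `]0%R, +oo[) (k%:E * A t) = k%:E * \int[mu]_(t in `]0%R, +oo[) A t.
Proof.
move=> k0 mA A0; rewrite ge0_integralZl//; first exact: measurable_funTS.
by move=> t /=; rewrite in_itv/= andbT; exact: A0.
Qed.

Lemma integralD_gt0 (A B : R -> \bar R) :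
  measurable_fun setT A -> measurable_fun setT B ->
  (forall t, (0 < t)%R -> 0 <= A t) -> (forall t, (0 < t)%R -> 0 <= B t) ->
  \int[mu]_(t in `]0%R, +oo[) (A t + B t) =
  \int[mu]_(t in `]0%R, +oo[) A t + \int[mu]_(t in `]0%R, +oo[) B t.
Proof.
move=> mA mB A0 B0; rewrite ge0_integralD//.
- by move=> t /=; rewrite in_itv/= andbT; exact: A0.
- exact: measurable_funTS.
- by move=> t /=; rewrite in_itv/= andbT; exact: B0.
- exact: measurable_funTS.
Qed.

Let measurable_exp_scaled (c : R) : measurable_fun setT (fun t : R => expR (- (c * t))).
Proof.
apply: (measurableT_comp (@measurable_expR R)).
by apply: measurableT_comp => //; exact: mulrl_measurable.
Qed.

Lemma moment_expRN (m : nat) :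
  \int[mu]_(t in `]0%R, +oo[) (t ^+ m * expR (- t))%:E = (m`!%:R)%:E.
Proof.
elim: m => [|m IH].
  transitivity (\int[mu]_(t in `]0%R, +oo[) (expR (- t))%:E).
    by apply: eq_integral => t _; rewrite expr0 mul1r.
  by rewrite integral_expRN_above oppr0 expR0.
have := @tonelli_triangle (fun t => expR (- t)) (fun s => s ^+ m)%R measurable_expRN
  (@exprn_measurable _ _ m) (fun t _ => expR_ge0 (- t))
  (fun t t0 => exprn_ge0 m (ltW t0)).
have -> : \int[mu]_(s in `]0%R, +oo[) ((s ^+ m)%:E * \int[mu]_(t in `]s, +oo[) (expR (- t))%:E)
    = (m`!%:R)%:E.
  by rewrite -IH; apply: eq_integral => s _; rewrite integral_expRN_above EFinM.
have -> : \int[mu]_(t in `]0%R, +oo[) ((expR (- t))%:E * \int[mu]_(s in `]0%R, t[) (s ^+ m)%:E)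
  = (m.+1%:R^-1)%:E * \int[mu]_(t in `]0%R, +oo[) (t ^+ m.+1 * expR (- t))%:E.
  rewrite -integralZl_gt0//.
  - apply: eq_integral_gt0 => t t0; rewrite integral_exprn_below ?(ltW t0)//.
    by rewrite -!EFinM; congr EFin; rewrite mulrC [(t ^+ m.+1 / _)%R]mulrC mulrA.
  - apply/measurable_EFinP; apply: measurable_funM; first exact: exprn_measurable.
    exact: measurable_expRN.
  - by move=> t t0; rewrite lee_fin mulr_ge0 ?expR_ge0// exprn_ge0// ltW.
move=> /(congr1 (fun x => (m.+1%:R)%:E * x)).
by rewrite muleA -EFinM divff ?pnatr_eq0// mul1e => ->; rewrite -EFinM factS natrM.
Qed.

Lemma moment_expRN_scaled (m : nat) (c : R) : (0 < c)%R ->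
  \int[mu]_(t in `]0%R, +oo[) (t ^+ m * expR (- (c * t)))%:E = (m`!%:R / c ^+ m.+1)%:E.
Proof.
move=> c0; have ci0 : (0 < c^-1)%R by rewrite invr_gt0.
rewrite (@ge0_integral_scale_gt0 _ c^-1)//; last 2 first.
- by move=> t t0; rewrite lee_fin mulr_ge0 ?expR_ge0// exprn_ge0// ltW.
- apply/measurable_EFinP; apply: measurable_funM; first exact: exprn_measurable.
  exact: measurable_exp_scaled.
transitivity ((c^-1)%:E * ((c^-1 ^+ m)%:E * \int[mu]_(t in `]0%R, +oo[) (t ^+ m * expR (- t))%:E)).
  congr (_ * _); rewrite -integralZl_gt0//.
  - apply: eq_integral_gt0 => t t0.
    rewrite mulrA divff ?gt_eqF// mul1r -EFinM mulrA; congr (_ * _)%R%:E.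
    by rewrite -exprMn.
  - by rewrite exprn_ge0// ltW.
  - apply/measurable_EFinP; apply: measurable_funM; first exact: exprn_measurable.
    exact: measurable_expRN.
  - by move=> t t0; rewrite lee_fin mulr_ge0 ?expR_ge0// exprn_ge0// ltW.
by rewrite moment_expRN -!EFinM; congr EFin; rewrite mulrA -exprS exprVn mulrC.
Qed.

Lemma Gamma_natr (n : nat) : Gamma n.+1%:R = n`!%:R :> R.
Proof.
rewrite /Gamma /Rintegral -[RHS]/(fine (n`!%:R)%:E) -moment_expRN; congr fine.
apply: eq_integral_gt0 => t t0.
by rewrite -natr1 addrK powR_mulrn// ltW.
Qed.

Section gamma_fractional.
Variable a : R.
Hypotheses (a0 : (0 < a)%R) (a1 : (a < 1)%R).

Let GE := \int[mu]_(t in `]0%R, +oo[) (t `^ (- a) * expR (- t))%:E.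

Let mGE : measurable_fun setT (fun t : R => (t `^ (- a) * expR (- t))%:E).
Proof.
apply/measurable_EFinP; apply: measurable_funM; first exact: measurable_powR.
exact: measurable_expRN.
Qed.

(** The integrand is singular at 0, so the fundamental theorem is applied on [1 / (i + 1), 1] and
    the bound passes to the increasing union. *)
Let pow_below1 : \int[mu]_(t in `]0%R, 1%R]) (t `^ (- a))%:E <= ((1 - a)^-1)%:E.
Proof.
have E : `]0%R, 1%R]%classic = \bigcup_(i : nat) `[(i.+1%:R^-1)%R, 1%R]%classic :> set R.
  apply/seteqP; split => t /=; rewrite ?in_itv/=.
    move=> /andP[t0 t1]; exists (Num.truncn (t^-1)) => //=; rewrite in_itv/= t1 andbT.
    rewrite -[leRHS]invrK lef_pV2 ?posrE ?invr_gt0//; apply: ltW; exact: truncnS_gt.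
  move=> [i _ /=]; rewrite in_itv/= => /andP[it ->]; rewrite andbT.
  by apply: lt_le_trans it; rewrite invr_gt0.
have mp : measurable_fun setT (fun t : R => (t `^ (- a))%:E).
  by apply/measurable_EFinP; exact: measurable_powR.
pose F (i : nat) : set (measurableTypeR R) := `[(i.+1%:R^-1)%R, 1%R]%classic.
have ndF : nondecreasing_seq F.
  move=> i j ij; apply/subsetPset => t /=; rewrite /F /= !in_itv/=.
  move=> /andP[it ->]; rewrite andbT; apply: le_trans it.
  by rewrite lef_pV2 ?posrE// ler_nat.
have C : \int[mu]_(t in F i) (t `^ (- a))%:E @[i --> \oo] -->
    \int[mu]_(t in \bigcup_i F i) (t `^ (- a))%:E.
  apply: ge0_nondecreasing_set_cvg_integral => //.
  - by move=> i; exact: measurable_itv.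
  - by move=> i; exact: measurable_funTS.
  - by move=> i t _; rewrite lee_fin powR_ge0.
rewrite E -(cvg_lim _ C)//; apply: lime_le; first by apply/cvg_ex; eexists; exact: C.
apply: nearW => i; have i0 : (0 < i.+1%:R^-1 :> R)%R by rewrite invr_gt0.
have a1' : (0 < 1 - a)%R by rewrite subr_gt0.
have dF (x : R) : (i.+1%:R^-1 <= x)%R ->
    is_derive x 1%R (fun t => (1 - a)^-1 * t `^ (1 - a))%R (x `^ (- a))%R.
  move=> ix; have x0 : (0 < x)%R by exact: lt_le_trans ix.
  have := is_derive1_powR (1 - a) x0 => dx; apply: is_derive_eq.
  rewrite /GRing.scale/= ?scaler0 ?mulr0 ?addr0 mulrA mulVf ?gt_eqF// mul1r.
  by congr (_ `^ _)%R; lra.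
have cf (x : R) : (i.+1%:R^-1 <= x)%R -> {for x, continuous (fun t => t `^ (- a))%R}.
  move=> ix; have x0 : (0 < x)%R by exact: lt_le_trans ix.
  exact: (is_derive_continuous (is_derive1_powR (- a) x0)).
have i1 : (i.+1%:R^-1 <= 1 :> R)%R by rewrite invf_le1// ler1n.
rewrite (FTC_segment i1 dF cf) lee_fin powR1 mulr1 gerBl.
by rewrite mulr_ge0 ?powR_ge0// invr_ge0 ltW.
Qed.

Let GE_fin : GE < +oo.
Proof.
have E : `]0%R, +oo[%classic = `]0%R, 1%R]%classic `|` `]1%R, +oo[%classic :> set R.
  apply/seteqP; split => t /=; rewrite !in_itv/= !andbT.
    by move=> t0; rewrite t0 /=; case: (leP t 1%R); [left|right].
  by move=> [/andP[]//|]; exact: lt_trans.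
rewrite /GE E ge0_integral_setU//; last 3 first.
- exact: measurable_funTS.
- by move=> t _; rewrite lee_fin mulr_ge0 ?powR_ge0 ?expR_ge0.
- apply/disj_setPRL => t /=; rewrite !in_itv/= andbT => t1.
  by apply/negP; rewrite negb_and -!leNgt -ltNge t1 orbT.
have p0 t : 0 <= (t `^ (- a) * expR (- t))%:E.
  by rewrite lee_fin mulr_ge0 ?powR_ge0 ?expR_ge0.
apply: lte_add_pinfty.
  apply: (@le_lt_trans _ _ ((1 - a)^-1)%:E); last exact: ltry.
  apply: le_trans pow_below1; apply: ge0_le_integral => //.
  - exact: measurable_funTS.
  - by apply: measurable_EFin_comp; exact: measurable_powR.
  move=> t /=; rewrite in_itv/= => /andP[t0 t1].
  by rewrite lee_fin ler_piMr ?powR_ge0// expR_le1 oppr_le0 ltW.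
apply: (@le_lt_trans _ _ (expR (- 1))%:E); last exact: ltry.
rewrite -integral_expRN_above; apply: ge0_le_integral => //.
- exact: measurable_funTS.
- exact: measurable_EFin_comp measurable_expRN.
move=> t /=; rewrite in_itv/= andbT => t1.
rewrite lee_fin ler_piMl ?expR_ge0// -(powRr0 t).
by apply: ler_powR; rewrite ?ltW// oppr_lt0.
Qed.

Let GE_gt0 : 0 < GE.
Proof.
have h : (\int[mu]_(t in `]0%R, 1%R[) (expR (- t))%:E <= GE).
  apply: (@le_trans _ _ (\int[mu]_(t in `]0%R, 1%R[) (t `^ (- a) * expR (- t))%:E)).
    apply: ge0_le_integral => //.
    - exact: measurable_EFin_comp measurable_expRN.
    - exact: measurable_funTS.
    move=> t /=; rewrite in_itv/= => /andP[t0 t1].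
    rewrite lee_fin ler_peMl ?expR_ge0// -(powRr0 t).
    by apply: ger_powR; rewrite ?t0 ?ltW ?oppr_lt0.
  apply: ge0_subset_integral => //.
  - exact: measurable_funTS.
  - by move=> t _; rewrite lee_fin mulr_ge0 ?powR_ge0 ?expR_ge0.
  - by move=> t /=; rewrite !in_itv/= => /andP[->].
apply: lt_le_trans h; by rewrite integral_expRN_below// lte_fin subr_gt0.
Qed.

(** [Gamma] is the [fine] part of an integral and would be 0 if that integral were infinite;
    finiteness lets it stand for the integral itself. *)
Lemma Gamma_fractional : (0 < Gamma (1 - a))%R /\
  \int[mu]_(t in `]0%R, +oo[) (t `^ (- a) * expR (- t))%:E = (Gamma (1 - a))%:E.
Proof.
have E : \int[mu]_(t in `]0%R, +oo[) (t `^ (- a) * expR (- t))%:E = (Gamma (1 - a))%:E.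
  have Ea : (1 - a - 1 = - a)%R by ring.
  by rewrite /Gamma /Rintegral Ea fineK// ge0_fin_numE// ltW.
split => //; rewrite -lte_fin -E; exact: GE_gt0.
Qed.

(** For c = 1, write 1 - exp (- t) as the integral of exp (- s) over 0 < s < t and exchange: the
    inner integral of t^(- a - 1) beyond s is s^(- a) / a, which leaves the Gamma integral. Scaling
    t gives the factor c^a. *)
Lemma integral_powR_expR (c : R) : (0 < c)%R ->
  \int[mu]_(t in `]0%R, +oo[) (t `^ (- a - 1) * (1 - expR (- (c * t))))%:E =
  (c `^ a * (Gamma (1 - a) / a))%:E.
Proof.
move=> c0.
have K1 : \int[mu]_(t in `]0%R, +oo[) (t `^ (- a - 1) * (1 - expR (- t)))%:E =
    (Gamma (1 - a) / a)%:E.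
  transitivity (\int[mu]_(t in `]0%R, +oo[) ((t `^ (- a - 1))%:E *
      \int[mu]_(s in `]0%R, t[) (expR (- s))%:E)).
    apply: eq_integral_gt0 => t t0.
    by rewrite integral_expRN_below ?(ltW t0)// EFinM.
  rewrite tonelli_triangle//; [|exact: measurable_expRN|by move=> t _; exact: powR_ge0].
  rewrite mulrC EFinM -(proj2 Gamma_fractional) -integralZl_gt0//.
  - apply: eq_integral_gt0 => t t0; rewrite integral_powR_above// -!EFinM.
    by congr EFin; rewrite mulrA mulrC [(expR _ * _)%R]mulrC.
  - by rewrite invr_ge0 ltW.
  - by move=> t _; rewrite lee_fin mulr_ge0 ?powR_ge0 ?expR_ge0.
have ci0 : (0 < c^-1)%R by rewrite invr_gt0.
have p0 (k t : R) : (0 < k)%R -> (0 < t)%R ->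
    0 <= (t `^ (- a - 1) * (1 - expR (- (k * t))))%:E.
  move=> k0 t0; rewrite lee_fin mulr_ge0 ?powR_ge0// subr_ge0 expR_le1 oppr_le0.
  by rewrite mulr_ge0// ltW.
have mk (k : R) : measurable_fun setT
    (fun t : R => (t `^ (- a - 1) * (1 - expR (- (k * t))))%:E).
  apply/measurable_EFinP; apply: measurable_funM; first exact: measurable_powR.
  by apply: measurable_funB => //; exact: measurable_exp_scaled.
rewrite (@ge0_integral_scale_gt0 _ c^-1)//; [|by move=> t t0; exact: p0|exact: mk].
transitivity ((c^-1)%:E * ((c^-1 `^ (- a - 1))%:E *
    \int[mu]_(t in `]0%R, +oo[) (t `^ (- a - 1) * (1 - expR (- (1 * t))))%:E)).
  congr (_ * _); rewrite -integralZl_gt0//.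
  - apply: eq_integral_gt0 => t t0.
    rewrite mulrA divff ?gt_eqF// mul1r -EFinM mulrA; congr (_ * _)%R%:E.
    by rewrite powRM// ltW.
  - exact: powR_ge0.
  - by move=> t t0; exact: p0.
rewrite (_ : \int[mu]_(t in _) _ = (Gamma (1 - a) / a)%:E); last first.
  by rewrite -K1; apply: eq_integral => t _; rewrite mul1r.
rewrite -!EFinM mulrA; congr (_ * _)%R%:E.
rewrite -(powR_inv1 (ltW c0)) -powRrM -powRD; last by rewrite (gt_eqF c0) /= implybT.
by congr (_ `^ _)%R; lra.
Qed.

End gamma_fractional.
End half_line.

(** * The extremal problem on a half-line *)

Section radial.
Context {R : realType}.
Notation mu := (@lebesgue_measure R).
Variables (a : R) (m : nat).
Hypotheses (a0 : 0 < a) (a1 : a < 1).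

(** The value of \int t^(- a - 1) (1 - exp (- t)) over the half-line; the rate [c] multiplies it by
    c^a. *)
Let k := Gamma (1 - a) / a.

Let k0 : 0 < k.
Proof. by rewrite divr_gt0//; case: (Gamma_fractional a0 a1). Qed.

Section bound.
Variable u : R -> R.
Hypothesis mu_ : measurable_fun setT u.
Hypothesis u01 : forall t, 0 < t -> 0 <= u t <= 1.
Hypothesis u_star : forall c s t, 0 < s -> s < t ->
  expR (- (c * t)) < u t -> expR (- (c * s)) <= u s.

Let L := (\int[mu]_(t in `]0%R, +oo[) (t `^ (- a - 1) * (1 - u t))%:E)%E.
Let X := (\int[mu]_(t in `]0%R, +oo[) (t ^+ m * u t)%:E)%E.

Let mw : measurable_fun setT (fun t : R => t `^ (- a - 1)).
Proof. exact: measurable_powR. Qed.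

Let mexp (c : R) : measurable_fun setT (fun t : R => expR (- (c * t))).
Proof.
apply: (measurableT_comp (@measurable_expR R)).
by apply: measurableT_comp => //; exact: mulrl_measurable.
Qed.

Let mwu : measurable_fun setT (fun t : R => (t `^ (- a - 1) * (1 - u t))%:E).
Proof.
by apply/measurable_EFinP; apply: measurable_funM => //; apply: measurable_funB.
Qed.

Let wu0 t : 0 < t -> (0 <= (t `^ (- a - 1) * (1 - u t))%:E)%E.
Proof.
by move=> /u01/andP[_ u1]; rewrite lee_fin mulr_ge0 ?powR_ge0 ?subr_ge0.
Qed.

(* [u] crosses [e = exp (- c t)] at most once, at [t0] say, so
   [(t ^ q - t0 ^ q) * (e t - u t) >= 0]; take [q = m + a + 1] and integrate
   against [t ^ (- a - 1)]. *)
Lemma radial_bound (c : R) : 0 < c -> ((c `^ a * k)%:E < L)%E ->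
  (X <= (m`!%:R / c ^+ m.+1)%:E)%E.
Proof.
move=> c0 cL.
pose e t := expR (- (c * t)).
(* If [u] were above the exponential everywhere, [L] would be at most c^a k. Such a point [t1]
   bounds the set [S] below. *)
have [t1 t10 ut1] : exists2 t1, 0 < t1 & u t1 < e t1.
  apply: contrapT => nex; move: cL; apply/negP; rewrite -leNgt.
  rewrite /L -(integral_powR_expR a0 a1 c0); apply: le_integral_gt0 => //.
    apply/measurable_EFinP; apply: measurable_funM => //.
    exact: measurable_funB.
  move=> t t0; rewrite lee_fin ler_wpM2l ?powR_ge0// lerB// leNgt.
  by apply/negP => ut; apply: nex; exists t.
(* Including 0 makes [S] nonempty and its supremum nonnegative even when [u] never exceeds the
   exponential. *)
pose S := [set t | t = 0 \/ 0 < t /\ e t < u t].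
have Sub : has_sup S.
  split; first by exists 0; left.
  exists t1 => t [->|[t0 et]]; first exact: ltW.
  rewrite leNgt; apply/negP => t1t.
  by move: ut1; apply/negP; rewrite -leNgt; exact: u_star et.
pose t0 := sup S.
have t00 : 0 <= t0 by apply: ub_le_sup => //; [case: Sub|left].
have below t : 0 < t -> t < t0 -> e t <= u t.
  move=> tp /(sup_gt (proj1 Sub))[s [->|[s0 es]] ts].
    by move: tp; rewrite ltNge ltW.
  exact: u_star es.
have above t : 0 < t -> t0 < t -> u t <= e t.
  move=> tp t0t; rewrite leNgt; apply/negP => et.
  move: t0t; apply/negP; rewrite -leNgt; apply: ub_le_sup; first by case: Sub.
  by right.
pose q := m%:R + a + 1.
have q0 : 0 < q by rewrite /q ltr_pwDr// addr_ge0 ?ler0n ?ltW.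
pose La := t0 `^ q.
have La0 : 0 <= La by exact: powR_ge0.
have tm t : 0 < t -> t ^+ m = t `^ (- a - 1) * t `^ q.
  move=> tp; rewrite -powRD; last by rewrite (gt_eqF tp) /= implybT.
  by rewrite -powR_mulrn ?(ltW tp)//; congr (_ `^ _); rewrite /q; ring.
have pointwise t : 0 < t -> t ^+ m * u t + La * (t `^ (- a - 1) * (1 - u t)) <=
    t ^+ m * e t + La * (t `^ (- a - 1) * (1 - e t)).
  move=> tp; rewrite -subr_ge0.
  have -> : t ^+ m * e t + La * (t `^ (- a - 1) * (1 - e t)) -
     (t ^+ m * u t + La * (t `^ (- a - 1) * (1 - u t))) =
     t `^ (- a - 1) * ((t `^ q - La) * (e t - u t)) by rewrite tm//; ring.
  rewrite mulr_ge0 ?powR_ge0//.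
  have [tt0|t0t|->] := ltgtP t t0.
  - rewrite mulr_le0// subr_le0; last exact: below.
    by rewrite ge0_ler_powR ?nnegrE ?(ltW tp) ?(ltW q0) ?(ltW tt0).
  - rewrite mulr_ge0// subr_ge0; last exact: above.
    by rewrite ge0_ler_powR ?nnegrE ?(ltW tp) ?(ltW q0) ?(ltW t0t).
  - by rewrite /La subrr mul0r.
have mtu : measurable_fun setT (fun t : R => (t ^+ m * u t)%:E).
  apply/measurable_EFinP; apply: measurable_funM => //; exact: exprn_measurable.
have tu0 t : 0 < t -> (0 <= (t ^+ m * u t)%:E)%E.
  move=> tp; have /andP[ut0 _] := u01 tp.
  by rewrite lee_fin mulr_ge0// exprn_ge0// ltW.
have mte : measurable_fun setT (fun t : R => (t ^+ m * e t)%:E).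
  apply/measurable_EFinP; apply: measurable_funM; first exact: exprn_measurable.
  exact: mexp.
have te0 t : 0 < t -> (0 <= (t ^+ m * e t)%:E)%E.
  by move=> tp; rewrite lee_fin mulr_ge0 ?expR_ge0// exprn_ge0// ltW.
have mwe : measurable_fun setT (fun t : R => (t `^ (- a - 1) * (1 - e t))%:E).
  apply/measurable_EFinP; apply: measurable_funM => //.
  by apply: measurable_funB => //; exact: mexp.
have we0 t : 0 < t -> (0 <= (t `^ (- a - 1) * (1 - e t))%:E)%E.
  move=> tp; rewrite lee_fin mulr_ge0 ?powR_ge0// subr_ge0 expR_le1 oppr_le0.
  by rewrite mulr_ge0// ltW.
have : (X + La%:E * L <= (m`!%:R / c ^+ m.+1)%:E + La%:E * (c `^ a * k)%:E)%E.
  rewrite -(moment_expRN_scaled m c0) -(integral_powR_expR a0 a1 c0).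
  rewrite -!integralZl_gt0// -!integralD_gt0//; last 4 first.
  - by apply: emeasurable_funM.
  - by move=> t tp; rewrite mule_ge0// we0.
  - by apply: emeasurable_funM.
  - by move=> t tp; rewrite mule_ge0// wu0.
  apply: le_integral_gt0.
  - by apply: emeasurable_funD => //; apply: emeasurable_funM.
  - by apply: emeasurable_funD => //; apply: emeasurable_funM.
  - by move=> t tp; rewrite adde_ge0 ?mule_ge0 ?tu0 ?wu0.
  - by move=> t tp; rewrite -!EFinM -!EFinD lee_fin; exact: pointwise.
move=> H.
(* As [La] is nonnegative, [L] may be lowered to c^a k on the left; this term is finite and
   cancels. *)
have : (X + La%:E * (c `^ a * k)%:E <= (m`!%:R / c ^+ m.+1)%:E + La%:E * (c `^ a * k)%:E)%E.
  by apply: le_trans H; apply: leeD => //; apply: lee_wpmul2l => //; exact: ltW.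
by rewrite -EFinM leeD2rE.
Qed.

End bound.

Lemma ray_mass (r : \bar R) : (0 <= r)%E ->
  (\int[mu]_(t in `]0%R, +oo[) (t ^+ m * (t%:E <= r)%E%:R)%:E =
   if r is r'%:E then (r' ^+ m.+1 / m.+1%:R)%:E else +oo)%E.
Proof.
have below s : 0 <= s -> (\int[mu]_(t in `]0%R, +oo[) (t ^+ m * (t%:E <= s%:E)%E%:R)%:E =
    (s ^+ m.+1 / m.+1%:R)%:E)%E.
  move=> s0; rewrite -integral_exprn_below// -(@integral_itv_bndoo _ 0 s _ false false); last first.
    by apply: measurable_EFin_comp; exact: exprn_measurable.
  rewrite integral_mkcond [RHS]integral_mkcond; apply: eq_integral => t _.
  rewrite /patch !mem_setE !in_itv/= andbT.
  by case: (0 < t) => //=; rewrite lee_fin; case: ifP; rewrite ?mulr1 ?mulr0.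
case: r => [r| |]//; first by rewrite lee_fin; exact: below.
move=> _; apply/eqyP => A A0.
(* From s >= 1 follows s^(m + 1) >= s >= A (m + 1), so the mass up to [s] already reaches [A]. *)
pose s := Num.max 1 (A * m.+1%:R).
have s1 : 1 <= s by rewrite le_max lexx.
have s0 : 0 <= s by exact: le_trans s1.
apply: (@le_trans _ _ (s ^+ m.+1 / m.+1%:R)%:E).
  rewrite lee_fin ler_pdivlMr//; apply: (@le_trans _ _ s).
    by rewrite le_max lexx orbT.
  by rewrite exprS ler_peMr// exprn_ege1.
rewrite -(below _ s0); apply: ge0_le_integral => //.
- move=> t /=; rewrite in_itv/= andbT => t0.
  by rewrite lee_fin mulr_ge0// exprn_ge0// ltW.
- apply/measurable_funTS/measurable_EFinP; apply: measurable_funM.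
    exact: exprn_measurable.
  have mN : measurable_fun setT (fun b : bool => (b%:R : R)) by [].
  apply: (measurableT_comp mN); exact: measurable_fun_ler.
- apply: (eq_measurable_fun (fun t : R => (t ^+ m)%:E)).
    by move=> t _; rewrite leey mulr1.
  by apply: measurable_EFin_comp; exact: exprn_measurable.
move=> t /=; rewrite in_itv/= andbT => t0; rewrite lee_fin leey mulr1.
rewrite ler_piMr//; first by rewrite exprn_ge0// ltW.
by rewrite lee_fin; case: (t <= s)%R; rewrite ?ler01.
Qed.

(** The factor [q] in the constant cancels the one in the radius. At l = c^a k the value is m! /
    c^(m + 1), exactly the moment of exp (- c t). *)
Let ball_value (q l : R) : 0 < q -> 0 < l ->
  ((m.+1`!%:R * (q * k) `^ (m.+1%:R / a))%:E *
   \int[mu]_(t in `]0%R, +oo[)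
     (t ^+ m * (t%:E <= epowN (q%:E * l%:E) a^-1)%E%:R)%:E =
   (m`!%:R * (k / l) `^ (m.+1%:R / a))%:E)%E.
Proof.
move=> q0 l0; have ql0 : 0 < q * l by exact: mulr_gt0.
have -> : (epowN (q%:E * l%:E) a^-1 = (((q * l) `^ a^-1)^-1)%:E)%E.
  by rewrite /epowN -EFinM poweR_EFin inver gt_eqF// powR_gt0.
rewrite ray_mass ?lee_fin ?invr_ge0 ?powR_ge0// -EFinM; congr EFin.
have -> : q * k = (k / l) * (q * l) by field; rewrite gt_eqF.
have kl0 : 0 < k / l by exact: divr_gt0.
rewrite powRM ?(ltW kl0) ?(ltW ql0)//.
have -> : (q * l) `^ (m.+1%:R / a) = (q * l) `^ a^-1 ^+ m.+1.
  by rewrite [m.+1%:R / a]mulrC powRrM powR_mulrn ?powR_ge0.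
rewrite factS natrM exprVn; field.
by rewrite expf_neq0 ?gt_eqF ?powR_gt0//= pnatr_eq0.
Qed.

(** By contradiction: take a real [x] strictly between the two sides and the rate [c] with m! / c^(m
    + 1) = x. The contrapositive of [radial_bound] gives L <= c^a k, and the radius decreases in
    [L], so the right side is at least [x]. *)
Lemma radial_moment_le (u : R -> R) (q : R) : 0 < q -> measurable_fun setT u ->
  (forall t, 0 < t -> 0 <= u t <= 1) ->
  (forall c s t, 0 < s -> s < t ->
     expR (- (c * t)) < u t -> expR (- (c * s)) <= u s) ->
  forall L, L = (\int[mu]_(t in `]0%R, +oo[) (t `^ (- a - 1) * (1 - u t))%:E)%E ->
  (\int[mu]_(t in `]0%R, +oo[) (t ^+ m * u t)%:E <=
   (m.+1`!%:R * (q * k) `^ (m.+1%:R / a))%:E *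
   \int[mu]_(t in `]0%R, +oo[) (t ^+ m * (t%:E <= epowN (q%:E * L) a^-1)%E%:R)%:E)%E.
Proof.
move=> q0 m_u u01 u_star L LE.
have L0 : (0 <= L)%E.
  rewrite LE; apply: integral_gt0_ge0 => t /u01/andP[_ u1].
  by rewrite lee_fin mulr_ge0 ?powR_ge0 ?subr_ge0.
have D0 : 0 < m.+1`!%:R * (q * k) `^ (m.+1%:R / a).
  by rewrite mulr_gt0 ?ltr0n ?fact_gt0// powR_gt0// mulr_gt0.
set X := (\int[mu]_(t in _) _)%E; set Y := (_ * _)%E.
have Y0 : (0 <= Y)%E.
  rewrite mule_ge0 ?lee_fin ?(ltW D0)//; apply: integral_gt0_ge0 => t t0.
  by rewrite lee_fin mulr_ge0// exprn_ge0// ltW.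
rewrite leNgt; apply/negP => YX.
have [y Yy] : exists y : R, Y = y%:E.
  by exists (fine Y); rewrite fineK// ge0_fin_numE// (lt_le_trans YX) ?leey.
rewrite Yy in YX Y0; rewrite lee_fin in Y0.
have [x yx xX] := real_between YX.
have x0 : 0 < x by exact: le_lt_trans yx.
pose M : R := m`!%:R; have M0 : 0 < M by rewrite ltr0n fact_gt0.
have Mx0 : 0 < M / x by exact: divr_gt0.
pose c := (M / x) `^ (m.+1%:R^-1).
have c0 : 0 < c by exact: powR_gt0.
have cm : c ^+ m.+1 = M / x.
  by rewrite -powR_mulrn ?(ltW c0)// -powRrM mulVf ?pnatr_eq0// powRr1// ltW.
have Lc : (L <= (c `^ a * k)%:E)%E.
  rewrite leNgt LE; apply/negP => /(radial_bound m_u u01 u_star c0).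
  rewrite cm -/M invf_div mulrCA divff ?gt_eqF// mulr1; apply/negP.
  by rewrite -ltNge.
have [l Ll] : exists l : R, L = l%:E.
  by exists (fine L); rewrite fineK// ge0_fin_numE// (le_lt_trans Lc) ?ltry.
rewrite Ll lee_fin in L0 Lc.
(* For L = 0 the radius is infinite, and so is the right side, although it was assumed to be the
   real [y]. *)
move: L0; rewrite le_eqVlt => /predU1P[l0|l0].
  move: Yy; rewrite /Y Ll -l0 mule0 /epowN poweR0r ?invr_eq0 ?gt_eqF// inve0.
  by rewrite ray_mass// gt0_muley ?lte_fin.
have : x <= y.
  rewrite -lee_fin -Yy /Y Ll ball_value// lee_fin -/M.
  have lk0 : 0 < l / k by exact: divr_gt0.
  have -> : k / l = (l / k) `^ (-1) by rewrite powR_inv1 ?(ltW lk0)// invf_div.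
  rewrite -powRrM mulN1r powRN ler_pdivlMr ?powR_gt0// mulrC -ler_pdivlMr//.
  rewrite -cm -powR_mulrn ?(ltW c0)//.
  have -> : c `^ m.+1%:R = (c `^ a) `^ (m.+1%:R / a).
    by rewrite -powRrM mulrC divfK// gt_eqF.
  rewrite ge0_ler_powR ?nnegrE ?powR_ge0 ?(ltW lk0)//.
    by rewrite divr_ge0// ltW.
  by move: Lc; rewrite lee_fin ler_pdivrMr.
by rewrite leNgt yx.
Qed.

Lemma radial_moment_eq (u : R -> R) (q c : R) : 0 < q -> 0 < c ->
  (forall t, 0 < t -> u t = expR (- (c * t))) ->
  forall L, L = (\int[mu]_(t in `]0%R, +oo[) (t `^ (- a - 1) * (1 - u t))%:E)%E ->
  (\int[mu]_(t in `]0%R, +oo[) (t ^+ m * u t)%:E =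
   (m.+1`!%:R * (q * k) `^ (m.+1%:R / a))%:E *
   \int[mu]_(t in `]0%R, +oo[) (t ^+ m * (t%:E <= epowN (q%:E * L) a^-1)%E%:R)%:E)%E.
Proof.
move=> q0 c0 uE L LE.
have -> : L = (c `^ a * k)%:E.
  rewrite LE -(integral_powR_expR a0 a1 c0); apply: eq_integral_gt0 => t t0.
  by rewrite uE.
have l0 : 0 < c `^ a * k by apply: mulr_gt0 => //; exact: powR_gt0.
rewrite ball_value//.
transitivity (\int[mu]_(t in `]0%R, +oo[) (t ^+ m * expR (- (c * t)))%:E)%E.
  by apply: eq_integral_gt0 => t t0; rewrite uE.
rewrite moment_expRN_scaled//; congr (_ * _)%:E.
have -> : k / (c `^ a * k) = c `^ (- a).
  by rewrite powRN; field; rewrite !gt_eqF ?powR_gt0.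
by rewrite -powRrM mulNr mulrC divfK ?gt_eqF// powRN powR_mulrn// ltW.
Qed.

End radial.

Lemma measurable_le_ereal (R : realType) (r : \bar R) :
  measurable_fun setT (fun t : R => (t%:E <= r)%E%:R : R).
Proof.
have mN : measurable_fun setT (fun b : bool => (b%:R : R)) by [].
case: r => [r| |].
- by apply: (measurableT_comp mN); exact: measurable_fun_ler.
- apply: (eq_measurable_fun (fun _ : R => 1 : R)) => // t _; by rewrite leey.
- by apply: (eq_measurable_fun (fun _ : R => 0 : R)).
Qed.

(** * The Euclidean norm and comparison of radii *)

Section euclidean_norm.
Context {R : realType}.

Lemma measurable_enorm n : measurable_fun setT (@enorm R n).
Proof.
apply: (@measurableT_comp _ _ _ _ _ _ (@Num.sqrt R)).
  by apply: continuous_measurable_fun; exact: sqrt_continuous.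
apply: measurable_sum => i; apply: measurable_funX; exact: measurable_coord.
Qed.

Lemma enormZ n (t : R) (v : 'rV[R]_n) : enorm (t *: v) = `|t| * enorm v.
Proof.
rewrite /enorm -sqrtr_sqr -sqrtrM ?sqr_ge0// mulr_sumr; congr Num.sqrt.
by apply: eq_bigr => i _; rewrite mxE exprMn.
Qed.

Lemma enorm_eq0 n (v : 'rV[R]_n) : (enorm v == 0) = (v == 0).
Proof.
have s0 : forall i, true -> 0 <= v ord0 i ^+ 2 by move=> i _; exact: sqr_ge0.
apply/idP/eqP => [|->]; last first.
  by rewrite /enorm big1 ?sqrtr0// => i _; rewrite mxE expr0n.
rewrite /enorm sqrtr_eq0 => s; apply/rowP => i; rewrite mxE.
have /eqP : \sum_(i < n) v ord0 i ^+ 2 = 0.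
  by apply/eqP; rewrite eq_le s sumr_ge0.
by rewrite psumr_eq0// => /allP/(_ i (mem_index_enum _)); rewrite /= sqrf_eq0 => /eqP.
Qed.

Lemma enorm_gt0 n (v : 'rV[R]_n) : v != 0 -> 0 < enorm v.
Proof. by move=> v0; rewrite lt_neqAle sqrtr_ge0 eq_sym enorm_eq0 v0. Qed.

(** Turns membership in the polar body into an upper bound on [Pi_integral], from which
    measurability of the body can be read off. *)
Lemma le_epowN (r p : R) (Q : \bar R) : 0 < r -> 0 < p -> (0 <= Q)%E ->
  (r%:E <= epowN Q p)%E = (Q <= (r `^ (- p^-1))%:E)%E.
Proof.
move=> r0 p0; case: Q => [l| |]// Q0; rewrite /epowN; last first.
  by rewrite poweRyr ?gt_eqF// invey lee_fin leNgt r0.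
rewrite poweR_EFin inver lee_fin; rewrite lee_fin in Q0.
move: Q0; rewrite le_eqVlt => /predU1P[<-|l0].
  by rewrite (powR0 (lt0r_neq0 p0)) eqxx leey powR_ge0.
have lp0 : 0 < l `^ p by exact: powR_gt0.
rewrite gt_eqF// lee_fin -[leLHS]invrK lef_pV2 ?posrE ?invr_gt0//.
have -> : r^-1 = (r `^ (- p^-1)) `^ p.
  by rewrite -powRrM mulNr mulVf ?gt_eqF// powR_inv1// ltW.
apply/idP/idP => h; last by rewrite ge0_ler_powR ?nnegrE ?powR_ge0 ?(ltW p0) ?(ltW l0).
rewrite leNgt; apply/negP => h'; move: h; apply/negP; rewrite -ltNge.
by rewrite gt0_ltr_powR ?nnegrE ?powR_ge0 ?(ltW l0).
Qed.

End euclidean_norm.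

#[local] Arguments lebint : simpl never.

(** * The covariogram and the polar projection body *)

Section covariogram.
Context {R : realType}.
Notation mu := (@lebesgue_measure R).
Variables (m : nat) (alpha : R) (f : 'rV[R]_m.+1 -> R) (g0 : R).
Hypotheses (alpha0 : 0 < alpha) (alpha1 : alpha < 2^-1).
Hypotheses (f0 : forall x, 0 <= f x) (mf : measurable_fun setT f).
Hypotheses (g00 : 0 < g0) (fg0 : lebint (fun x => (f x ^+ 2)%:E) = g0%:E).

Definition cov (z : 'rV[R]_m.+1) : \bar R := lebint (fun x => (f x * f (x + z))%:E).

Let g z := fine (cov z).

Let a := 2 * alpha.
Let a_gt0 : 0 < a. Proof. by rewrite mulr_gt0. Qed.
Let a_lt1 : a < 1.
Proof. by have := alpha1; rewrite /a -ltr_pdivlMl// mulr1. Qed.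

Let mfz z : measurable_fun setT (fun x : 'rV[R]_m.+1 => f (x + z)).
Proof. exact: (measurableT_comp mf (measurable_addrv z)). Qed.

Let mf2 : measurable_fun setT (fun x : 'rV[R]_m.+1 => (f x ^+ 2)%:E).
Proof. by apply/measurable_EFinP; exact: measurable_funX. Qed.

Let mfz2 z : measurable_fun setT (fun x : 'rV[R]_m.+1 => (f (x + z) ^+ 2)%:E).
Proof. by apply/measurable_EFinP; exact: measurable_funX. Qed.

Let mff z : measurable_fun setT (fun x : 'rV[R]_m.+1 => (f x * f (x + z))%:E).
Proof. by apply/measurable_EFinP; exact: measurable_funM. Qed.

Let ff0 z x : (0 <= (f x * f (x + z))%:E)%E.
Proof. by rewrite lee_fin mulr_ge0. Qed.

Let f20 x : (0 <= (f x ^+ 2)%:E)%E.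
Proof. by rewrite lee_fin exprn_ge0. Qed.

Let cov0 z : (0 <= cov z)%E.
Proof. exact: lebint_ge0. Qed.

Let lebint_translated_sq z : lebint (fun x => (f (x + z) ^+ 2)%:E) = g0%:E.
Proof. by rewrite -fg0 -(lebint_translate (F := fun x => (f x ^+ 2)%:E) z). Qed.

(** The expanded square, kept as a sum because [cov z] is not yet known to be finite; finiteness is
    deduced from this very identity through [cov_le]. *)
Let cov_diff z : (lebint (fun x => ((f (x + z) - f x) ^+ 2)%:E) + 2%:E * cov z =
  (2 * g0)%:E)%E.
Proof.
have md : measurable_fun setT (fun x : 'rV[R]_m.+1 => ((f (x + z) - f x) ^+ 2)%:E).
  by apply/measurable_EFinP; apply: measurable_funX; exact: measurable_funB.
rewrite /cov -lebintZ ?lee_fin// -lebintD//; last 3 first.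
- by move=> x; rewrite lee_fin sqr_ge0.
- by move=> x; rewrite mule_ge0 ?ff0 ?lee_fin.
- by apply: emeasurable_funM => //; exact: mff.
transitivity (lebint (fun x => (f x ^+ 2)%:E + (f (x + z) ^+ 2)%:E)%E).
  by apply: eq_lebint => x; rewrite -EFinM -!EFinD; congr EFin; ring.
rewrite lebintD//.
by rewrite fg0 lebint_translated_sq -EFinD; congr EFin; ring.
Qed.

Let cov_le z : (cov z <= g0%:E)%E.
Proof.
have : (2%:E * cov z <= 2%:E * g0%:E)%E.
  rewrite -EFinM -(cov_diff z); apply: leeDr; apply: lebint_ge0 => x.
  by rewrite lee_fin sqr_ge0.
by rewrite lee_pmul2l// lte_fin.
Qed.

Lemma cov_fineK z : (fine (cov z))%:E = cov z.
Proof.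
by rewrite fineK// ge0_fin_numE// (le_lt_trans (cov_le z))// ltry.
Qed.

Let covE z : cov z = (g z)%:E. Proof. by rewrite /g cov_fineK. Qed.
Let g_ge0 z : 0 <= g z. Proof. exact: fine_ge0. Qed.
Let g_le z : g z <= g0. Proof. by rewrite -lee_fin -covE. Qed.

Let diffE z : lebint (fun x => ((f (x + z) - f x) ^+ 2)%:E) = (2 * (g0 - g z))%:E.
Proof.
have := cov_diff z; rewrite covE -EFinM => h.
by rewrite -[LHS](@addeK _ (2 * g z)%:E)// h -EFinB; congr EFin; ring.
Qed.

Lemma measurable_cov : measurable_fun setT cov.
Proof.
apply: (@measurable_lebint R m.+1 _ 'rV[R]_m.+1
  (fun p => (f p.2 * f (p.2 + p.1))%:E)) => [p|].
  by rewrite lee_fin mulr_ge0.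
apply/measurable_EFinP; apply: measurable_funM.
  exact: (measurableT_comp mf measurable_snd).
apply: (measurableT_comp mf).
exact: (measurable_addrv2 measurable_snd measurable_fst).
Qed.

Let mg : measurable_fun setT g.
Proof. by apply: (measurableT_comp _ measurable_cov). Qed.

Lemma lebint_cov : (lebint cov =
  lebint (fun x => (f x)%:E) * lebint (fun x => (f x)%:E))%E.
Proof.
have mfE : measurable_fun setT (fun x : 'rV[R]_m.+1 => (f x)%:E) by exact/measurable_EFinP.
have fE0 v : (0 <= (f v)%:E)%E by rewrite lee_fin.
rewrite /cov (@lebint_swap R m.+1 m.+1 (fun p => (f p.2 * f (p.2 + p.1))%:E)); last 2 first.
- by move=> p; rewrite lee_fin mulr_ge0.
- apply/measurable_EFinP; apply: measurable_funM.
    exact: (measurableT_comp mf measurable_snd).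
  apply: (measurableT_comp mf).
  exact: (measurable_addrv2 measurable_snd measurable_fst).
rewrite -lebintZ//; last by apply: lebint_ge0 => x; rewrite lee_fin.
apply: eq_lebint => x.
transitivity (lebint (fun z => (f x)%:E * (f (z + x))%:E))%E.
  by apply: eq_lebint => z; rewrite EFinM addrC.
rewrite lebintZ ?lee_fin//; last by apply/measurable_EFinP; exact: mfz.
by rewrite (lebint_translate (F := fun x => (f x)%:E))// muleC.
Qed.

Let u (xi : 'rV[R]_m.+1) (t : R) := g (t *: xi) / g0.

Let measurable_u xi : measurable_fun setT (u xi).
Proof.
apply: measurable_funM => //; apply: (measurableT_comp mg).
by apply: measurable_scalerv.
Qed.

Let u01 xi t : 0 <= u xi t <= 1.
Proof.
by rewrite /u divr_ge0 ?(ltW g00)//= ler_pdivrMr// mul1r.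
Qed.

Let Pi_integralE xi : Pi_integral alpha f xi = ((2 * g0)%:E *
  \int[mu]_(t in `]0%R, +oo[) (t `^ (- a - 1) * (1 - u xi t))%:E)%E.
Proof.
rewrite -integralZl_gt0//; last 3 first.
- by rewrite mulr_ge0// ltW.
- apply/measurable_EFinP; apply: measurable_funM; first exact: measurable_powR.
  by apply: measurable_funB.
- move=> t _; rewrite lee_fin mulr_ge0 ?powR_ge0// subr_ge0.
  by case/andP: (u01 xi t).
apply: eq_integral => t _; rewrite diffE -!EFinM; congr EFin.
by rewrite /u; field; rewrite gt_eqF.
Qed.

Let Pi_integral_ge0 xi : (0 <= Pi_integral alpha f xi)%E.
Proof.
rewrite Pi_integralE mule_ge0 ?lee_fin ?mulr_ge0 ?(ltW g00)//.
apply: integral_gt0_ge0 => t _; rewrite lee_fin mulr_ge0 ?powR_ge0// subr_ge0.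
by case/andP: (u01 xi t).
Qed.

Let measurable_Pi_integral : measurable_fun setT (Pi_integral alpha f).
Proof.
pose F (p : 'rV[R]_m.+1 * measurableTypeR R) :=
  ((p.2 `^ (- a - 1)) * (2 * (g0 - g (p.2 *: p.1))) * \1_`]0, +oo[ p.2)%:E.
apply: (eq_measurable_fun (fun xi => \int[mu]_t F (xi, t))%E).
  move=> xi _; rewrite /Pi_integral [RHS]integral_mkcond; apply: eq_integral => t _.
  rewrite /patch /F /= indicE; case: ifPn => _; last by rewrite mulr0.
  by rewrite mulr1 EFinM diffE.
apply: (@measurable_fun_fubini_tonelli_F _ _ _ _ _ mu F).
  apply/measurable_EFinP; apply: measurable_funM; first apply: measurable_funM.
  - exact: (measurableT_comp (@measurable_powR R _) measurable_snd).
  - apply: measurable_funM => //; apply: measurable_funB => //.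
    apply: (measurableT_comp mg); exact: measurable_scalerv.
  - by apply: (measurableT_comp (measurable_indic _)).
move=> p; rewrite lee_fin mulr_ge0// mulr_ge0 ?powR_ge0// mulr_ge0// subr_ge0.
exact: g_le.
Qed.

(** The origin is split off since it has no unit direction. Elsewhere membership reads [Pi_integral]
    <= |x|^(- 2 alpha), a comparison of two measurable functions. *)
Lemma measurable_Pi_star : measurable (Pi_star alpha f).
Proof.
have mE := @measurable_enorm R m.+1.
have mz : measurable [set x : 'rV[R]_m.+1 | x = 0].
  rewrite (_ : [set _ | _] = @enorm R m.+1 @^-1` [set 0]).
    by rewrite -[X in measurable X]setTI; apply: mE => //; exact: measurable_set1.
  apply/seteqP; split => x /= /eqP; first by rewrite -enorm_eq0 => /eqP.
  by rewrite enorm_eq0 => /eqP.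
have mQ : measurable_fun setT
    (fun x : 'rV[R]_m.+1 => Pi_integral alpha f ((enorm x)^-1 *: x)).
  apply: (measurableT_comp measurable_Pi_integral).
  apply: measurable_scalerv => //.
  apply: (eq_measurable_fun (fun x => enorm x `^ (-1))).
    by move=> x _; rewrite powR_inv1// sqrtr_ge0.
  exact: (measurableT_comp (@measurable_powR R _) mE).
have mr : measurable_fun setT (fun x : 'rV[R]_m.+1 => ((enorm x) `^ (- a))%:E).
  by apply/measurable_EFinP; exact: (measurableT_comp (@measurable_powR R _) mE).
have ml := measurable_lee measurableT mQ mr.
rewrite setTI in ml.
rewrite (_ : Pi_star alpha f = [set x : 'rV[R]_m.+1 | x = 0] `|`
   (~` [set x : 'rV[R]_m.+1 | x = 0] `&`
    [set x | (Pi_integral alpha f ((enorm x)^-1 *: x) <= ((enorm x) `^ (- a))%:E)%E])).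
  by apply: measurableU => //; apply: measurableI => //; exact: measurableC.
have key (x : 'rV[R]_m.+1) : x != 0 ->
   ((enorm x)%:E <= Pi_radial alpha f ((enorm x)^-1 *: x))%E =
   (Pi_integral alpha f ((enorm x)^-1 *: x) <= ((enorm x) `^ (- a))%:E)%E.
  move=> x0; rewrite /Pi_radial le_epowN ?enorm_gt0// ?invr_gt0 ?invrK//.
apply/seteqP; split => x /=.
  have [->|x0] := eqVneq x 0; first by left.
  by move=> [->|h]; [left|right; split; [exact/eqP|rewrite -key]].
have [->|x0] := eqVneq x 0; first by left.
by move=> [->|[_ h]]; [left|right; rewrite key].
Qed.

(** The constant of [radial_moment_le] for q = 2 g0, the factor by which [Pi_integral] exceeds the
    integral for [u]. The leading g0 undoes the normalization u = cov / g0. *)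
Definition ray_cst : R := g0 * (m.+1`!%:R *
  (2 * g0 * (Gamma (1 - a) / a)) `^ (m.+1%:R / a)).

Lemma ray_cst_gt0 : 0 < ray_cst.
Proof.
have [G0 _] := Gamma_fractional a_gt0 a_lt1.
rewrite mulr_gt0// mulr_gt0 ?ltr0n ?fact_gt0// powR_gt0// mulr_gt0 ?mulr_gt0//.
by rewrite invr_gt0.
Qed.

Let indic_Pi_star xi t : enorm xi = 1 -> 0 < t ->
  \1_(Pi_star alpha f) (t *: xi) = (t%:E <= Pi_radial alpha f xi)%E%:R :> R.
Proof.
move=> xi1 t0; rewrite indicE; congr (_ : bool)%:R.
have tx0 : t *: xi <> 0.
  move=> /eqP; rewrite scaler_eq0 gt_eqF//= -enorm_eq0 xi1; exact/negP/oner_neq0.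
apply/idP/idP; rewrite inE /Pi_star /= enormZ xi1 mulr1 gtr0_norm//
  scalerA mulVf ?gt_eqF// scale1r; first by case.
by right.
Qed.

(** The polar decomposition uses directions on hyperplanes, the radial function uses unit vectors.
    Normalizing [y] multiplies both sides of a ray comparison by |y|^(m + 1). *)
Let ray_scale (F : 'rV[R]_m.+1 -> \bar R) y : y != 0 -> (forall v, 0 <= F v)%E ->
  measurable_fun setT F ->
  (\int[mu]_(t in `]0%R, +oo[) ((t ^+ m)%:E * F (t *: ((enorm y)^-1 *: y))) =
   (enorm y ^+ m.+1)%:E * \int[mu]_(t in `]0%R, +oo[) ((t ^+ m)%:E * F (t *: y)))%E.
Proof.
move=> y0 F0 mF; have r0 := enorm_gt0 y0.
have mray v : measurable_fun setT (fun t : R => ((t ^+ m)%:E * F (t *: v))%E).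
  apply: emeasurable_funM.
    by apply/measurable_EFinP; exact: exprn_measurable.
  by apply: (measurableT_comp mF); exact: measurable_scalerv.
have ray0 v t : 0 < t -> (0 <= (t ^+ m)%:E * F (t *: v))%E.
  by move=> t0; rewrite mule_ge0// lee_fin exprn_ge0// ltW.
rewrite (@ge0_integral_scale_gt0 _ (enorm y))//; last 2 first.
- by move=> t; exact: ray0.
- exact: mray.
rewrite exprS EFinM -muleA; congr (_ * _)%E.
rewrite -integralZl_gt0//; last 2 first.
- by rewrite exprn_ge0// ltW.
- by move=> t; exact: ray0.
apply: eq_integral => t _; rewrite exprMn EFinM -muleA; congr (_ * (_ * F _))%E.
by rewrite scalerA mulrAC divff ?gt_eqF// mul1r.
Qed.

(** [P] is later taken to be [<=] for the inequality and [=] for the simplex, so that both share one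
    reduction to the half-line problem. *)
Let ray_unit (P : \bar R -> \bar R -> Prop) xi : enorm xi = 1 ->
  P (g0%:E * \int[mu]_(t in `]0%R, +oo[) (t ^+ m * u xi t)%:E)%E
    (ray_cst%:E * \int[mu]_(t in `]0%R, +oo[)
      (t ^+ m * (t%:E <= Pi_radial alpha f xi)%E%:R)%:E)%E ->
  P (\int[mu]_(t in `]0%R, +oo[) ((t ^+ m)%:E * cov (t *: xi)))%E
    (\int[mu]_(t in `]0%R, +oo[)
       ((t ^+ m)%:E * (ray_cst%:E * (\1_(Pi_star alpha f) (t *: xi))%:E)))%E.
Proof.
move=> xi1; congr P.
  rewrite -integralZl_gt0 ?(ltW g00)//; last 2 first.
  - apply/measurable_EFinP; apply: measurable_funM => //; exact: exprn_measurable.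
  - move=> t t0; rewrite lee_fin mulr_ge0 ?exprn_ge0 ?(ltW t0)//.
    by case/andP: (u01 xi t).
  apply: eq_integral => t _; rewrite covE -!EFinM; congr EFin.
  by rewrite /u; field; rewrite gt_eqF.
have D0 := ray_cst_gt0.
rewrite -integralZl_gt0 ?(ltW D0)//; last 2 first.
- apply/measurable_EFinP; apply: measurable_funM; first exact: exprn_measurable.
  exact: measurable_le_ereal.
- by move=> t t0; rewrite lee_fin mulr_ge0// exprn_ge0// ltW.
apply: eq_integral_gt0 => t t0; rewrite indic_Pi_star// -!EFinM; congr EFin.
by ring.
Qed.

Let integrand0 v : (0 <= ray_cst%:E * (\1_(Pi_star alpha f) v)%:E)%E.
Proof. by rewrite mule_ge0 ?lee_fin ?(ltW ray_cst_gt0). Qed.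

Let measurable_integrand :
  measurable_fun setT (fun v => (ray_cst%:E * (\1_(Pi_star alpha f) v)%:E)%E).
Proof.
apply: emeasurable_funM => //; apply/measurable_EFinP.
exact: measurable_indic measurable_Pi_star.
Qed.

Let cov_rays (P : \bar R -> \bar R -> Prop) :
  (forall (c : R) x y, 0 < c -> P (c%:E * x)%E (c%:E * y)%E -> P x y) ->
  (forall xi, enorm xi = 1 ->
    P (g0%:E * \int[mu]_(t in `]0%R, +oo[) (t ^+ m * u xi t)%:E)%E
      (ray_cst%:E * \int[mu]_(t in `]0%R, +oo[)
        (t ^+ m * (t%:E <= Pi_radial alpha f xi)%E%:R)%:E)%E) ->
  forall y, y != 0 ->
  P (\int[mu]_(t in `]0%R, +oo[) ((t ^+ m)%:E * cov (t *: y)))%E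
    (\int[mu]_(t in `]0%R, +oo[)
       ((t ^+ m)%:E * (ray_cst%:E * (\1_(Pi_star alpha f) (t *: y))%:E)))%E.
Proof.
move=> Pcancel Pxi y y0; have r0 := enorm_gt0 y0.
have xi1 : enorm ((enorm y)^-1 *: y) = 1.
  by rewrite enormZ gtr0_norm ?invr_gt0// mulVf// gt_eqF.
have D0 := ray_cst_gt0.
apply: (Pcancel (enorm y ^+ m.+1)); first exact: exprn_gt0.
move: (ray_unit (P := P) xi1 (Pxi _ xi1)); congr P.
  exact: (ray_scale y0 cov0 measurable_cov).
exact: (ray_scale y0 integrand0 measurable_integrand).
Qed.

Let volE : (ray_cst%:E * vol (Pi_star alpha f) =
  lebint (fun v => ray_cst%:E * (\1_(Pi_star alpha f) v)%:E))%E.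
Proof.
have D0 := ray_cst_gt0.
rewrite lebintZ ?lee_fin ?(ltW D0)//.
by apply/measurable_EFinP; exact: measurable_indic measurable_Pi_star.
Qed.

Lemma lebint_cov_le :
  (forall xi c s t, 0 < s -> s < t -> expR (- (c * t)) < fine (cov (t *: xi)) / g0 ->
     expR (- (c * s)) <= fine (cov (s *: xi)) / g0) ->
  (lebint cov <= ray_cst%:E * vol (Pi_star alpha f))%E.
Proof.
move=> star; rewrite volE; apply: le_lebint_rays => //; first exact: measurable_cov.
apply: (cov_rays (P := fun x y => (x <= y)%E)) => [c x y c0|xi xi1].
  by rewrite lee_pmul2l// lte_fin.
rewrite /Pi_radial /ray_cst EFinM -muleA lee_pmul2l ?lte_fin//.
rewrite Pi_integralE; apply: radial_moment_le => //; first exact: mulr_gt0.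
exact: star.
Qed.

Lemma lebint_cov_eq :
  (forall xi, enorm xi = 1 -> exists2 c, 0 < c &
     forall t, 0 < t -> fine (cov (t *: xi)) / g0 = expR (- (c * t))) ->
  (lebint cov = ray_cst%:E * vol (Pi_star alpha f))%E.
Proof.
move=> ex; have rays : forall y, y != 0 ->
    (\int[mu]_(t in `]0%R, +oo[) ((t ^+ m)%:E * cov (t *: y)) =
     \int[mu]_(t in `]0%R, +oo[)
       ((t ^+ m)%:E * (ray_cst%:E * (\1_(Pi_star alpha f) (t *: y))%:E)))%E.
  apply: (cov_rays (P := eq)) => [c x y c0 /(congr1 (mule c^-1%:E))|xi xi1].
    by rewrite !muleA -EFinM mulVf ?gt_eqF// !mul1e.
  have [c c0 cE] := ex _ xi1.
  rewrite /Pi_radial /ray_cst EFinM -muleA; congr (_ * _)%E.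
  rewrite Pi_integralE; apply: (@radial_moment_eq R a m a_gt0 a_lt1 (u xi) (2 * g0) c) => //.
  exact: mulr_gt0.
rewrite volE; apply/eqP; rewrite eq_le.
by rewrite !le_lebint_rays//; try exact: measurable_cov; move=> y /rays ->.
Qed.

End covariogram.

(** * Log-concavity *)

Section log_concave_facts.
Context {R : realType}.
Variables (n : nat) (f : 'rV[R]_n -> R).
Hypothesis lcf : log_concave f.

Let f0 x : 0 <= f x. Proof. by case: lcf. Qed.

Lemma log_concave_powR x y l : 0 <= l <= 1 -> 0 < f x -> 0 < f y ->
  f x `^ (1 - l) * f y `^ l <= f ((1 - l) *: x + l *: y).
Proof.
move=> l01 fx fy; have := lcf.2 x y l l01.
rewrite /elog !(gt_eqF fx, gt_eqF fy).
have [->|fz] := eqVneq (f ((1 - l) *: x + l *: y)) 0; first by rewrite leeNy_eq.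
have fz0 : 0 < f ((1 - l) *: x + l *: y) by rewrite lt_neqAle eq_sym fz f0.
rewrite -!EFinM -EFinD lee_fin => h.
have := h; rewrite /powR (gt_eqF fx) (gt_eqF fy) -expRD -[X in _ -> _ <= X]lnK ?posrE//.
by rewrite ler_expR.
Qed.

Lemma log_concave_superlevel c : convex_set_rv [set x | c < f x].
Proof.
move=> x y l l01 /= cx cy; have [c0|c0] := ltP c 0; first exact: lt_le_trans c0 (f0 _).
have fx : 0 < f x by exact: le_lt_trans cx.
have fy : 0 < f y by exact: le_lt_trans cy.
have /andP[l0 l1] := l01.
apply: lt_le_trans (log_concave_powR l01 fx fy).
pose d := Num.min (f x) (f y).
have cd : c < d by rewrite lt_min cx.
have d0 : 0 < d by exact: le_lt_trans cd.
apply: (lt_le_trans cd); rewrite -[leLHS](powRr1 (ltW d0)) -[X in _ `^ X](subrK l).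
rewrite powRD; last by rewrite (gt_eqF d0) implybT.
rewrite ler_pM ?powR_ge0// ge0_ler_powR ?nnegrE ?subr_ge0 ?(ltW d0) ?(ltW fx) ?(ltW fy)//.
  by rewrite /d ge_min lexx.
by rewrite /d ge_min lexx orbT.
Qed.

Let F z x : \bar R := (f x * f (x + z))%:E.

(** The product of f x and f (x + z) is log-concave jointly in (x, z); allowing two shifts [z] and
    [w] is what makes the covariogram log-concave after integration in x. *)
Lemma log_concave_pl z w l : 0 < l < 1 ->
  pl_triple l (F z) (F w) (F ((1 - l) *: z + l *: w)).
Proof.
move=> /andP[l0 l1] x y a b a0 b0; rewrite !lte_fin => aF bF.
have pos (c d : R) : 0 <= c -> 0 <= d -> 0 < c * d -> 0 < c /\ 0 < d.
  move=> c0 d0; rewrite lt_neqAle => /andP[+ _]; rewrite eq_sym mulf_eq0 negb_or.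
  by move=> /andP[? ?]; split; rewrite lt_neqAle eq_sym; apply/andP.
have [fx fxz] := pos _ _ (f0 _) (f0 _) (lt_trans a0 aF).
have [fy fyw] := pos _ _ (f0 _) (f0 _) (lt_trans b0 bF).
have l01 : 0 <= l <= 1 by rewrite !ltW.
have l1' : 0 < 1 - l by rewrite subr_gt0.
apply: (@lt_le_trans _ _ ((f x * f (x + z)) `^ (1 - l) * (f y * f (y + w)) `^ l)).
  rewrite ltr_pM ?powR_ge0// gt0_ltr_powR ?nnegrE ?(ltW a0) ?(ltW b0) ?mulr_ge0//.
rewrite !powRM// mulrACA ler_pM ?mulr_ge0 ?powR_ge0//.
  exact: log_concave_powR.
have -> : (1 - l) *: x + l *: y + ((1 - l) *: z + l *: w) =
    (1 - l) *: (x + z) + l *: (y + w) by rewrite !scalerDr addrACA.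
exact: log_concave_powR.
Qed.

Lemma log_concave_prekopa z w l : 0 < l < 1 -> forall a b : R, 0 < a -> 0 < b ->
  (a%:E < lebint (F z))%E -> (b%:E < lebint (F w))%E ->
  ((a `^ (1 - l) * b `^ l)%:E < lebint (F ((1 - l) *: z + l *: w)))%E.
Proof.
move=> l01; have F0 v x : (0 <= F v x)%E by rewrite lee_fin mulr_ge0.
have lcF v : log_concave_ereal (F v).
  move=> k k01; have := @log_concave_pl v v k k01.
  by rewrite -scalerDl subrK scale1r.
apply: prekopa_leindler => //; exact: log_concave_pl.
Qed.

End log_concave_facts.

Section star.
Context {R : realType}.
Variables (n : nat) (f : 'rV[R]_n -> R) (g : 'rV[R]_n -> R) (g0 : R).
Hypothesis lcf : log_concave f.
Hypotheses (g00 : 0 < g0) (gE0 : g 0 = g0).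
Hypothesis gE : forall z, lebint (fun x => (f x * f (x + z))%:E) = (g z)%:E.

(** Log-concavity along the segment from 0 to t xi, with weight l = s / t: g (s xi) >= g0^(1 - l) g
    (t xi)^l, and g (t xi) > g0 exp (- c t). *)
Lemma log_concave_cov_star xi (c s t : R) : 0 < s -> s < t ->
  expR (- (c * t)) < g (t *: xi) / g0 -> expR (- (c * s)) <= g (s *: xi) / g0.
Proof.
move=> s0 st; set e := expR _ => et.
have t0 : 0 < t by exact: lt_trans st.
pose l := s / t.
have l0 : 0 < l by rewrite divr_gt0.
have l1 : l < 1 by rewrite ltr_pdivrMr// mul1r.
have l1' : 0 < 1 - l by rewrite subr_gt0.
have e0 : 0 < e * g0 by rewrite mulr_gt0// expR_gt0.
have : ((e * g0)%:E < (g (t *: xi))%:E)%E by rewrite lte_fin -ltr_pdivlMr.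
move=> /real_between[b eb bg].
have b0 : 0 < b by exact: lt_trans eb.
have r0 : 0 < e * g0 / b by exact: divr_gt0.
(* Prekopa-Leindler takes bounds strictly below the integrals, so g0 is lowered to g0 r. The gain of
   [b] over e g0 pays for it exactly: r^(1 - l) b^l = (e g0)^l. *)
pose r := (e * g0 / b) `^ (l / (1 - l)).
have rp : 0 < r by exact: powR_gt0.
have r1 : r < 1.
  apply: (@lt_le_trans _ _ (1 `^ (l / (1 - l)))); last by rewrite powR1.
  rewrite gt0_ltr_powR ?nnegrE ?(ltW r0) ?(divr_gt0 l0 l1')//.
  by rewrite ltr_pdivrMr// mul1r.
have l01 : 0 < l < 1 by rewrite l0.
have := log_concave_prekopa lcf (z := 0) (w := t *: xi) l01 (mulr_gt0 g00 rp) b0.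
rewrite !gE gE0 scaler0 add0r scalerA divfK ?gt_eqF// => /(_ _ bg).
rewrite lte_fin gtr_pMr// => /(_ r1); rewrite lte_fin => h.
rewrite ler_pdivlMr//; apply: ltW; apply: le_lt_trans h.
rewrite powRM ?(ltW g00) ?(ltW rp)// -[r `^ _]powRrM divfK ?gt_eqF//.
rewrite -mulrA -powRM ?(ltW r0) ?(ltW b0)// divfK ?gt_eqF//.
rewrite powRM ?expR_ge0 ?(ltW g00)// mulrCA -powRD; last by rewrite (gt_eqF g00) implybT.
rewrite subrK powRr1 ?(ltW g00)// -expRM ler_pM2r// ler_expR.
by rewrite mulNr lerN2 -mulrA [t * l]mulrC divfK// gt_eqF.
Qed.

End star.

(** * Passing from a log-concave function to its Borel representative *)

Section regularization.
Context {R : realType}.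
Variables (n : nat) (f h : 'rV[R]_n -> R).
Hypotheses (f0 : forall x, 0 <= f x) (h0 : forall x, 0 <= h x).
Hypothesis mh : measurable_fun setT h.
Hypothesis fh : thin [set x | f x <> h x].

(** One transfer principle for powers, covariogram and squared differences, according to [K]. The
    integrands differ only on the thin exceptional set and its translate. *)
Lemma lebint_regularize (K : R -> R -> R) (z : 'rV[R]_n) :
  (forall a b, 0 <= a -> 0 <= b -> 0 <= K a b) ->
  measurable_fun setT (fun x => K (h x) (h (x + z))) ->
  lebint (fun x => (K (f x) (f (x + z)))%:E) = lebint (fun x => (K (h x) (h (x + z)))%:E).
Proof.
move=> K0 mK; apply: lebint_thin.
- by move=> v; rewrite lee_fin K0.
- by move=> v; rewrite lee_fin K0.
- exact/measurable_EFinP.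
apply: thin_subset (thinU fh (thin_translate z fh)) => x /=.
apply: contra_notP => /not_orP[/contrapT fx /contrapT fxz].
by rewrite fx fxz.
Qed.

Let mhz z : measurable_fun setT (fun x : 'rV[R]_n => h (x + z)).
Proof. exact: (measurableT_comp mh (measurable_addrv z)). Qed.

Lemma lebint_regularize1 (K : R -> R) : (forall a, 0 <= a -> 0 <= K a) ->
  measurable_fun setT (K \o h) ->
  lebint (fun x => (K (f x))%:E) = lebint (fun x => (K (h x))%:E).
Proof. by move=> K0 mK; apply: (@lebint_regularize (fun a _ => K a) 0) => // a b a0 _; exact: K0. Qed.

Lemma Lpnorm_regularize p : Lpnorm p f = Lpnorm p h.
Proof.
congr (poweR _ _); apply: (@lebint_regularize1 (fun a => `|a| `^ p)).
  by move=> a _; exact: powR_ge0.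
apply: (measurableT_comp (@measurable_powR R p)); exact: measurableT_comp.
Qed.

Lemma cov_regularize z : lebint (fun x => (f x * f (x + z))%:E) =
  lebint (fun x => (h x * h (x + z))%:E).
Proof.
apply: (@lebint_regularize (fun a b => a * b)) => [a b|]; first exact: mulr_ge0.
exact: measurable_funM.
Qed.

Lemma Pi_star_regularize alpha : Pi_star alpha f = Pi_star alpha h.
Proof.
suff E : Pi_integral alpha f = Pi_integral alpha h.
  by rewrite /Pi_star /Pi_radial E.
apply/funext => xi; apply: eq_integral => t _; congr (_ * _)%E.
apply: (@lebint_regularize (fun a b => (b - a) ^+ 2)) => [a b _ _|].
  exact: sqr_ge0.
by apply: measurable_funX; exact: measurable_funB.
Qed.

End regularization.

(** * Interpolation between Lebesgue norms *)

(** A limit argument: the bound holds for positive reals above [a] and [b], which themselves might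
    vanish. It forces a > 0 and survives at (a, b). *)
Lemma le_powR_product_limit (R : realType) (g0 p a b : R) : 0 < g0 -> 0 < p -> p < 1 ->
  0 <= a -> 0 <= b ->
  (forall u v, 0 < u -> 0 < v -> a <= u -> b <= v ->
    g0 `^ (1 + p) <= u `^ (2 * p) * v `^ (1 - p)) ->
  0 < a /\ g0 `^ (1 + p) <= a `^ (2 * p) * b `^ (1 - p).
Proof.
move=> g00 p0 p1 a0 b0 key.
have p1' : 0 < 1 - p by rewrite subr_gt0.
have p20 : 0 < 2 * p by rewrite mulr_gt0.
have gp : 0 < g0 `^ (1 + p) by exact: powR_gt0.
have ag : 0 < a.
  rewrite lt_neqAle a0 andbT eq_sym; apply/eqP => az.
  pose v := b + 1; have v0 : 0 < v by rewrite ltr_wpDl.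
  have vp : 0 < v `^ (1 - p) by exact: powR_gt0.
  (* If a = 0, the first factor may be any positive number; this one makes the product half of g0^(1
     + p). *)
  pose w := g0 `^ (1 + p) / v `^ (1 - p) / 2.
  have w0 : 0 < w by rewrite !divr_gt0.
  have := key (w `^ (2 * p)^-1) v (powR_gt0 _ w0) v0.
  rewrite az powR_ge0 lerDl ler01 => /(_ isT isT).
  rewrite -powRrM mulVf ?gt_eqF// powRr1 ?(ltW w0)// /w mulrAC divfK ?gt_eqF//.
  by move=> le; lra.
split => //; have a2 : 0 < a `^ (2 * p) by exact: powR_gt0.
rewrite leNgt; apply/negP; rewrite mulrC -ltr_pdivlMr// => lt.
pose w := (b `^ (1 - p) + g0 `^ (1 + p) / a `^ (2 * p)) / 2.
have bp0 : 0 <= b `^ (1 - p) by exact: powR_ge0.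
have [bw wK] : b `^ (1 - p) < w /\ w < g0 `^ (1 + p) / a `^ (2 * p).
  by rewrite /w; split; lra.
have w0 : 0 < w by exact: le_lt_trans bw.
pose v := w `^ (1 - p)^-1.
have v0 : 0 < v by exact: powR_gt0.
have vp : v `^ (1 - p) = w by rewrite -powRrM mulVf ?gt_eqF// powRr1// ltW.
have bv : b <= v.
  rewrite leNgt; apply/negP => vb; move: bw; rewrite -vp; apply/negP; rewrite -leNgt.
  by rewrite ge0_ler_powR ?nnegrE ?(ltW p1') ?(ltW v0) ?(ltW vb).
have := key a v ag v0 (lexx _) bv; rewrite vp; apply/negP; rewrite -ltNge mulrC.
by rewrite -ltr_pdivlMr.
Qed.

Section interpolation.
Context {R : realType}.
Variables (n : nat) (h : 'rV[R]_n -> R) (g0 p : R).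
Hypotheses (h0 : forall x, 0 <= h x) (mh : measurable_fun setT h).
Hypotheses (g00 : 0 < g0) (hg0 : lebint (fun x => (h x ^+ 2)%:E) = g0%:E).
Hypotheses (p0 : 0 < p) (p1 : p < 1).

Let q := 2 / (1 - p).
Let A := lebint (fun x => (h x)%:E).
Let B := lebint (fun x => (h x `^ q)%:E).
(** The interpolation weight, defined by 2 = (1 - tau) + tau q. *)
Let tau := (1 - p) / (1 + p).

Let p1' : 0 < 1 - p. Proof. by rewrite subr_gt0. Qed.
Let p1'' : 0 < 1 + p. Proof. exact: addr_gt0. Qed.
Let q0 : 0 < q. Proof. exact: divr_gt0. Qed.
Let tau0 : 0 < tau. Proof. exact: divr_gt0. Qed.
Let tauE : 1 - tau = 2 * p / (1 + p). Proof. by rewrite /tau; field; rewrite gt_eqF. Qed.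
Let tau1 : 0 < 1 - tau. Proof. by rewrite tauE divr_gt0// mulr_gt0. Qed.

Let p2_neq0 : 2 * p != 0. Proof. by rewrite mulf_neq0 ?pnatr_eq0 ?lt0r_neq0. Qed.
Let e1 : (1 - tau) * (1 + p) = 2 * p. Proof. by rewrite /tau; field; rewrite gt_eqF. Qed.
Let e2 : tau * (1 + p) = 1 - p. Proof. by rewrite /tau; field; rewrite gt_eqF. Qed.

Let A0 : (0 <= A)%E. Proof. by apply: lebint_ge0 => x; rewrite lee_fin. Qed.
Let B0 : (0 <= B)%E. Proof. by apply: lebint_ge0 => x; rewrite lee_fin powR_ge0. Qed.

(** Hoelder's inequality, obtained by integrating the weighted arithmetic-geometric mean inequality
    for h / u and h^q / v. *)
Let young (u v : R) : 0 < u -> 0 < v -> (A <= u%:E)%E -> (B <= v%:E)%E ->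
  g0 <= u `^ (1 - tau) * v `^ tau.
Proof.
move=> u0 v0 Au Bv; pose M := u `^ (1 - tau) * v `^ tau.
have M0 : 0 < M by rewrite mulr_gt0// powR_gt0.
have tau01 : 0 < tau < 1 by rewrite tau0 -subr_gt0.
have pw x : h x ^+ 2 <= (M * ((1 - tau) / u)) * h x + (M * (tau / v)) * h x `^ q.
  have [->|hx] := eqVneq (h x) 0.
    by rewrite expr0n mulr0 add0r mulr_ge0 ?powR_ge0// ltW// mulr_gt0// divr_gt0.
  have {}hx : 0 < h x by rewrite lt_neqAle eq_sym hx h0.
  have := weighted_amgm tau01 (divr_gt0 hx u0) (divr_gt0 (powR_gt0 q hx) v0).
  rewrite -(ler_pM2l M0) => le; apply: le_trans (le_trans le _); last first.
    by rewrite le_eqVlt; apply/orP; left; apply/eqP; field; rewrite !gt_eqF.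
  rewrite !powRM ?invr_ge0 ?powR_ge0 ?(ltW u0) ?(ltW v0) ?(ltW hx)//.
  rewrite -!powR_inv1 ?(ltW u0) ?(ltW v0)// -!powRrM !mulN1r !powRN.
  have -> : M * (h x `^ (1 - tau) / u `^ (1 - tau) * (h x `^ (q * tau) / v `^ tau)) =
      h x `^ (1 - tau) * h x `^ (q * tau).
    by rewrite /M; field; rewrite !gt_eqF ?powR_gt0.
  rewrite -powRD; last by rewrite (gt_eqF hx) implybT.
  have -> : 1 - tau + q * tau = 2%:R.
    by rewrite tauE /q /tau; field; rewrite !gt_eqF.
  by rewrite powR_mulrn// ltW.
have mq : measurable_fun setT (fun x => h x `^ q).
  exact: (measurableT_comp (@measurable_powR R q) mh).
have hE0 x : (0 <= (h x)%:E)%E by rewrite lee_fin.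
have hq0 x : (0 <= (h x `^ q)%:E)%E by rewrite lee_fin powR_ge0.
have c1 : 0 <= M * ((1 - tau) / u) by rewrite ltW// mulr_gt0// divr_gt0.
have c2 : 0 <= M * (tau / v) by rewrite ltW// mulr_gt0// divr_gt0.
have m1 : measurable_fun setT (fun x => ((M * ((1 - tau) / u))%:E * (h x)%:E)%E).
  by apply: emeasurable_funM => //; exact/measurable_EFinP.
have m2 : measurable_fun setT (fun x => ((M * (tau / v))%:E * (h x `^ q)%:E)%E).
  by apply: emeasurable_funM => //; exact/measurable_EFinP.
have : (g0%:E <= (M * ((1 - tau) / u))%:E * A + (M * (tau / v))%:E * B)%E.
  rewrite -hg0 /A /B -!lebintZ ?lee_fin//; try exact/measurable_EFinP.
  rewrite -lebintD//; try by move=> x; rewrite mule_ge0// lee_fin.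
  apply: le_lebint => [x|||x].
  - by rewrite lee_fin sqr_ge0.
  - by apply/measurable_EFinP; exact: measurable_funX.
  - exact: emeasurable_funD.
  - by rewrite -!EFinM -EFinD lee_fin.
move=> le; rewrite -lee_fin; apply: (le_trans le).
apply: (@le_trans _ _ ((M * ((1 - tau) / u))%:E * u%:E + (M * (tau / v))%:E * v%:E)%E).
  by apply: leeD; apply: lee_wpmul2l; rewrite ?lee_fin.
rewrite -!EFinM -EFinD lee_fin -/M le_eqVlt; apply/orP; left; apply/eqP.
by field; rewrite !gt_eqF.
Qed.

Lemma interpolation_L1_L2 : ((g0 `^ (1 + p))%:E * epowN A (2 * p) <= poweR B (1 - p))%E.
Proof.
have p20 : 2 * p != 0 by exact: p2_neq0.
have p1n : 1 - p != 0 by rewrite lt0r_neq0.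
(* An infinite [A] makes the left side 0 and an infinite [B] makes the right side infinite; what
   remains concerns real numbers. *)
have [Ay|Afin] := eqVneq A +oo%E.
  by rewrite Ay /epowN (poweRyr p20) invey mule0 poweR_ge0.
have [By|Bfin] := eqVneq B +oo%E.
  by rewrite By (poweRyr p1n) leey.
have AE : A = (fine A)%:E by rewrite fineK// ge0_fin_numE// ltey.
have BE : B = (fine B)%:E by rewrite fineK// ge0_fin_numE// ltey.
have a0 := fine_ge0 A0; have b0 := fine_ge0 B0.
have [a_gt0 le] : 0 < fine A /\
    g0 `^ (1 + p) <= (fine A) `^ (2 * p) * (fine B) `^ (1 - p).
  apply: (le_powR_product_limit g00 p0 p1 a0 b0) => u v u0 v0 au bv; rewrite -e1 -e2.
  have := young u0 v0; rewrite AE BE !lee_fin => /(_ au bv) gy.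
  rewrite (powRrM u) (powRrM v) -powRM ?powR_ge0//.
  apply: (@ge0_ler_powR _ (1 + p) (ltW p1'')) gy; rewrite nnegrE ?(ltW g00)//.
  by rewrite mulr_ge0 ?powR_ge0.
have a2 : 0 < fine A `^ (2 * p) by exact: powR_gt0.
rewrite AE BE /epowN !poweR_EFin inver (gt_eqF a2) -EFinM lee_fin.
by rewrite ler_pdivrMr// mulrC.
Qed.

End interpolation.

(** * Simplices *)

Section simplex.
Context {R : realType}.
Variables (n : nat) (V : 'M[R]_n).
Hypothesis V0 : \det V != 0.

(** Coordinates in the basis formed by the nonzero vertices, the rows of [V]. In them the simplex is
    given by nonnegative entries with sum [S] at most 1, and the gauge is [S] on the nonnegative
    orthant. *)
Let lam (x : 'rV[R]_n) : 'rV[R]_n := x *m invmx V.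
Let S (x : 'rV[R]_n) := \sum_i lam x ord0 i.

Let uV : V \in unitmx. Proof. by rewrite unitmxE unitfE. Qed.

Let lamK x : lam x *m V = x. Proof. by rewrite mulmxKV. Qed.
Let lamVK l : lam (l *m V) = l. Proof. by rewrite /lam mulmxK. Qed.

Let lamZ k x : lam (k *: x) = k *: lam x. Proof. by rewrite /lam scalemxAl. Qed.
Let lamD x y : lam (x + y) = lam x + lam y. Proof. by rewrite /lam mulmxDl. Qed.

Let lamDE x y i : lam (x + y) ord0 i = lam x ord0 i + lam y ord0 i.
Proof. by rewrite lamD [LHS]mxE. Qed.

Let simplex_mem (y : 'rV[R]_n) : simplex0 V y ->
  (forall i, 0 <= lam y ord0 i) /\ S y <= 1.
Proof. by move=> [l [l0 [l1 ->]]]; rewrite /S lamVK. Qed.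

Lemma gauge_simplex_in x : (forall i, 0 <= lam x ord0 i) ->
  gauge (simplex0 V) x = (S x)%:E.
Proof.
move=> x0; have Sx0 : 0 <= S x by exact: sumr_ge0.
apply/eqP; rewrite eq_le; apply/andP; split.
  (* The infimum runs over positive factors and is not attained when S x = 0, hence the approach
     from above. *)
  apply/lee_addgt0Pr => e e0; apply: ereal_inf_lbound.
  have l0 : 0 < S x + e by exact: ltr_wpDl.
  exists (S x + e) => //; split => //; exists ((S x + e)^-1 *: x); split.
    exists (lam ((S x + e)^-1 *: x)); split; [|split]; last by rewrite lamK.
      by move=> i; rewrite lamZ mxE mulr_ge0// invr_ge0 ltW.
    rewrite lamZ; under eq_bigr do rewrite mxE; rewrite -mulr_sumr.
    by rewrite mulrC ler_pdivrMr// mul1r lerDl ltW.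
  by rewrite scalerA divff ?scale1r// gt_eqF.
apply: le_ereal_inf_tmp => _ [l [l0 [y [Dy xy]]] <-].
have [_ Sy1] := simplex_mem Dy.
rewrite lee_fin xy /S lamZ; under eq_bigr do rewrite mxE.
by rewrite -mulr_sumr ler_piMr// ltW.
Qed.

Lemma gauge_simplex_out x : ~ (forall i, 0 <= lam x ord0 i) ->
  gauge (simplex0 V) x = +oo%E.
Proof.
move=> nx; rewrite /gauge (_ : [set l%:E | l in _] = set0) ?ereal_inf0//.
apply/seteqP; split => // t [l [l0 [y [Dy xy]]] _]; apply: nx => i.
have [y0 _] := simplex_mem Dy.
by rewrite xy lamZ mxE mulr_ge0// ltW.
Qed.

Definition simplex_exponent (z : 'rV[R]_n) : R := \sum_i `|(z *m invmx V) ord0 i|.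

Lemma simplex_exponentZ t z : 0 <= t -> simplex_exponent (t *: z) = t * simplex_exponent z.
Proof.
move=> t0; rewrite /simplex_exponent -/(lam _) lamZ mulr_sumr.
by apply: eq_bigr => i _; rewrite mxE normrM ger0_norm.
Qed.

Lemma simplex_exponent_gt0 z : z != 0 -> 0 < simplex_exponent z.
Proof.
move=> z0; rewrite lt_neqAle sumr_ge0// andbT eq_sym; apply: contra z0 => /eqP s0.
have l0 : lam z = 0.
  apply/rowP => i; rewrite [RHS]mxE; apply: normr0_eq0.
  exact: (psumr_eq0P _ s0).
by rewrite -(lamK z) l0 mul0mx.
Qed.

(** In coordinates, x and x + z both lie in the cone at x0 iff x minus the negative part [mz] of z
    does. On the cone the exponents add up: S (x) + S (x + z) is twice the [S] of the shifted point
    plus the sum of z_i + 2 max (0, - z_i), which equals |z_i|. Off the cone the gauge is infinite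
    and both sides vanish. *)
Lemma simplex_product (a : R) (x0 : 'rV[R]_n) (f : 'rV[R]_n -> R) z :
  (forall x, f x = a * fine (expeR (- gauge (simplex0 V) (x - x0)))) ->
  exists w, forall x, f x * f (x + z) = expR (- simplex_exponent z) * f (x + w) ^+ 2.
Proof.
move=> fE.
have fin x : (forall i, 0 <= lam (x - x0) ord0 i) -> f x = a * expR (- S (x - x0)).
  by move=> /gauge_simplex_in gx; rewrite fE gx.
have fout x : ~ (forall i, 0 <= lam (x - x0) ord0 i) -> f x = 0.
  by move=> /gauge_simplex_out gx; rewrite fE gx/= mulr0.
pose mz : 'rV[R]_n := \row_i Num.max 0 (- lam z ord0 i).
have mzE i : mz ord0 i = Num.max 0 (- lam z ord0 i) by exact: mxE.
exists (- (mz *m V)) => x.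
have lw i : lam (x - mz *m V - x0) ord0 i = lam (x - x0) ord0 i - mz ord0 i.
  have -> : x - mz *m V - x0 = (x - x0) + (- mz) *m V by rewrite mulNmx addrAC.
  by rewrite lamD lamVK !mxE.
have lz i : lam (x + z - x0) ord0 i = lam (x - x0) ord0 i + lam z ord0 i.
  by rewrite addrAC [LHS]lamDE.
have [inw|outw] := pselect (forall i, 0 <= lam (x - mz *m V - x0) ord0 i).
  have mz0 i : 0 <= mz ord0 i by rewrite mzE le_max lexx.
  have mzz i : - lam z ord0 i <= mz ord0 i by rewrite mzE le_max lexx orbT.
  rewrite (fin _ inw) fin; last first.
    by move=> i; have := inw i; have := mz0 i; rewrite lw; lra.
  rewrite fin; last first.
    by move=> i; have := inw i; have := mzz i; rewrite lw lz; lra.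
  rewrite exprMn -expRM_natl mulrACA -expr2 -expRD [RHS]mulrCA -expRD; congr (_ * expR _).
  rewrite /S /simplex_exponent mulrN mulr_sumr -!sumrN -!big_split /=.
  apply: eq_bigr => i _; rewrite lw lz mzE -/(lam z).
  by have [l0|l0] := leP 0 (lam z ord0 i);
    [rewrite ger0_norm ?max_l; lra|rewrite ltr0_norm ?max_r; lra].
rewrite (fout _ outw) expr0n mulr0.
have [inx|outx] := pselect (forall i, 0 <= lam (x - x0) ord0 i); last first.
  by rewrite (fout _ outx) mul0r.
have [inxz|outxz] := pselect (forall i, 0 <= lam (x + z - x0) ord0 i); last first.
  by rewrite (fout _ outxz) mulr0.
exfalso; apply: outw => i; rewrite lw mzE subr_ge0 ge_max inx.
by have := inxz i; rewrite lz; lra.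
Qed.

End simplex.

(** * The two inequalities and the equality case *)

Section epowN_facts.
Context {R : realType}.
Implicit Types (x y : \bar R) (p D : R).

Lemma le_epowN2 p x y : 0 <= p -> (0 <= x)%E -> (x <= y)%E ->
  (epowN y p <= epowN x p)%E.
Proof.
move=> p0 x0 xy; rewrite /epowN lee_pV2 ?inE ?poweR_ge0//.
by apply: gt0_ler_poweR => //; rewrite in_itv/= ?leey ?andbT// (le_trans x0).
Qed.

Lemma epowNZ D p x : 0 < D -> 0 < p -> (0 <= x)%E ->
  epowN (D%:E * x) p = ((D `^ p)^-1%:E * epowN x p)%E.
Proof.
move=> D0 p0 x0; rewrite /epowN poweRM ?lee_fin ?(ltW D0)//.
have Dp : 0 < D `^ p by exact: powR_gt0.
rewrite poweR_EFin; have := poweR_ge0 x p; case: (poweR x p) => [r| |] // r0.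
  have [->|rn] := eqVneq r 0.
    by rewrite mule0 inve0 gt0_muley// lte_fin invr_gt0.
  by rewrite -EFinM !inver mulf_eq0 (gt_eqF Dp) (negbTE rn)/= -EFinM invfM.
by rewrite gt0_muley ?lte_fin// invey mule0.
Qed.

End epowN_facts.

Section main.
Context {R : realType}.
Variables (m : nat) (alpha : R) (f : 'rV[R]_m.+1 -> R).
Hypotheses (alpha0 : 0 < alpha) (alpha1 : alpha < 2^-1).
Hypothesis lcf : log_concave f.
Hypothesis f2fin : (lebint (fun x => (f x ^+ 2)%:E) < +oo)%E.
Hypothesis f2pos : (0 < lebint (fun x => (f x ^+ 2)%:E))%E.

Let N : R := m.+1%:R.
Let p := 2 * alpha / N.
Let g0 := fine (lebint (fun x => (f x ^+ 2)%:E)).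
Let C := alpha / (Gamma m.+2%:R `^ p * Gamma (1 - 2 * alpha)).
Let lhs := (C%:E * epowN (vol (Pi_star alpha f)) p)%E.
Let mid := (poweR (Lpnorm 2 f) (2 + 4 * alpha / N) * epowN (Lpnorm 1 f) (4 * alpha / N))%E.
Let A := lebint (fun x => (f x)%:E).

Let N0 : 0 < N. Proof. by rewrite ltr0n. Qed.
Let p0 : 0 < p. Proof. by rewrite divr_gt0// mulr_gt0. Qed.
Let a1 : 2 * alpha < 1.
Proof. by move: alpha1; rewrite -(ltr_pM2l (_ : 0 < 2))// divff// pnatr_eq0. Qed.
Let p1 : p < 1.
Proof.
rewrite ltr_pdivrMr// mul1r; apply: (lt_le_trans a1).
by rewrite /N ler1n.
Qed.

Let f0 x : 0 <= f x. Proof. by case: lcf. Qed.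

Let fg0 : lebint (fun x => (f x ^+ 2)%:E) = g0%:E.
Proof. by rewrite /g0 fineK// ge0_fin_numE// ltW. Qed.

Let g00 : 0 < g0. Proof. by rewrite -lte_fin -fg0. Qed.

Let A0 : (0 <= A)%E. Proof. by apply: lebint_ge0 => x; rewrite lee_fin. Qed.

Let vol0 : (0 <= vol (Pi_star alpha f))%E.
Proof. by apply: lebint_ge0 => x; rewrite lee_fin. Qed.

Let D := ray_cst m alpha g0.
Let D0 : 0 < D. Proof. exact: ray_cst_gt0. Qed.

(** Since A * A is the integral of the covariogram, both sides of the first inequality acquire the
    common factor g0^(1 + p), and only the arguments of [epowN] are left to compare. *)
Let midE : mid = ((g0 `^ (1 + p))%:E * epowN (A * A) p)%E.
Proof.
rewrite /mid /Lpnorm; congr (_ * _)%E.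
  rewrite -poweRrM (_ : lebint _ = g0%:E); last first.
    rewrite -fg0; apply: eq_lebint => x; congr EFin.
    by rewrite powR_mulrn// ger0_norm.
  rewrite poweR_EFin; congr (_ `^ _)%:E.
  by rewrite /p; field; rewrite gt_eqF.
rewrite invr1 (_ : lebint _ = A); last first.
  by apply: eq_lebint => x; rewrite powRr1 ?ger0_norm.
rewrite poweRe1// /epowN poweRM// -poweRD; last first.
  by rewrite poweRD_defE gt_eqF ?addr_gt0.
by congr ((poweR _ _)^-1)%E; rewrite /p; field; rewrite gt_eqF.
Qed.

(** This is where the constant of the theorem arises: as p (m + 1) / (2 alpha) = 1, D^p equals g0^(1
    + p) Gamma (n + 1)^p Gamma (1 - 2 alpha) / alpha, with n = m + 1. *)
Let lhsE : lhs = ((g0 `^ (1 + p))%:E * epowN (D%:E * vol (Pi_star alpha f)) p)%E.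
Proof.
rewrite /lhs epowNZ// muleA -EFinM; congr (_%:E * _)%E.
have a0 : 0 < 2 * alpha by rewrite mulr_gt0.
have [G0 _] := Gamma_fractional a0 a1.
have F0 : 0 < m.+1`!%:R :> R by rewrite ltr0n fact_gt0.
have E0 : 0 < 2 * g0 * (Gamma (1 - 2 * alpha) / (2 * alpha)).
  by rewrite mulr_gt0 ?mulr_gt0// invr_gt0.
rewrite /C Gamma_natr /D /ray_cst; move: (Gamma _) G0 E0 => G G0 E0.
have pE : m.+1%:R / (2 * alpha) * p = 1 by rewrite /p /N; field; rewrite !gt_eqF.
rewrite powRM ?mulr_ge0 ?powR_ge0 ?(ltW g00) ?(ltW F0)// powRM ?powR_ge0 ?(ltW F0)//.
rewrite -powRrM pE powRr1 ?(ltW E0)// powRD; last by rewrite (gt_eqF g00) implybT.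
rewrite powRr1 ?(ltW g00)//; have := powR_gt0 p g00; have := powR_gt0 p F0.
move: (g0 `^ p) (_ `^ p) (g0) G0 g00 alpha alpha0 => x y g gg G0 a aa y0 x0.
by field; rewrite !gt_eqF.
Qed.

Let regular : exists h : 'rV[R]_m.+1 -> R, [/\ measurable_fun setT h, forall x, 0 <= h x &
  thin [set x | f x <> h x]].
Proof. by apply: quasiconcave_measurable => // c; exact: log_concave_superlevel. Qed.

Let fcovE z (h : 'rV[R]_m.+1 -> R) (h0 : forall x, 0 <= h x)
  (mh : measurable_fun setT h) (fh : thin [set x | f x <> h x]) :
  lebint (fun x => (f x * f (x + z))%:E) = cov h z.
Proof. exact: cov_regularize. Qed.

Let hg0 (h : 'rV[R]_m.+1 -> R) (h0 : forall x, 0 <= h x)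
  (mh : measurable_fun setT h) (fh : thin [set x | f x <> h x]) :
  lebint (fun x => (h x ^+ 2)%:E) = g0%:E.
Proof.
rewrite -fg0; apply/esym/(lebint_regularize1 f0 h0 fh (K := fun a => a ^+ 2)).
  by move=> a _; exact: sqr_ge0.
exact: measurable_funX.
Qed.

Let AE (h : 'rV[R]_m.+1 -> R) (h0 : forall x, 0 <= h x)
  (mh : measurable_fun setT h) (fh : thin [set x | f x <> h x]) :
  A = lebint (fun x => (h x)%:E).
Proof. exact: (lebint_regularize1 f0 h0 fh (K := id)). Qed.

Lemma affine_polar_projection_le : (lhs <= mid)%E.
Proof.
have [h [mh h0 fh]] := regular.
have hE := hg0 h0 mh fh.
rewrite lhsE midE; apply: lee_wpmul2l; first by rewrite lee_fin powR_ge0.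
apply: le_epowN2; [exact: ltW|exact: mule_ge0|].
rewrite (AE h0 mh fh) -(lebint_cov h0 mh) (Pi_star_regularize f0 h0 mh fh).
apply: (lebint_cov_le alpha0 alpha1 h0 mh g00 hE) => xi c s t.
(* [h] is not known to be log-concave. The crossing property is proved for the covariogram of [f],
   which coincides with that of [h]. *)
apply: (log_concave_cov_star (g := fun z => fine (cov h z)) lcf g00).
  rewrite /cov (_ : lebint _ = g0%:E)// -hE; apply: eq_lebint => x.
  by rewrite addr0 -expr2.
by move=> z; rewrite (cov_fineK h0 mh hE) (fcovE z h0 mh fh).
Qed.

Lemma mid_le_rhs : (mid <= poweR (Lpnorm (2 * N / (N - 2 * alpha)) f) 2)%E.
Proof.
have [h [mh h0 fh]] := regular.
have hE := hg0 h0 mh fh.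
have Na : 0 < N - 2 * alpha.
  by rewrite subr_gt0 (lt_le_trans a1)// /N ler1n.
have qE : 2 * N / (N - 2 * alpha) = 2 / (1 - p).
  rewrite /p; move: N N0 Na => k k0 ka.
  by field; rewrite !gt_eqF.
have p1' : 0 < 1 - p by rewrite subr_gt0.
rewrite midE (AE h0 mh fh) (Lpnorm_regularize f0 h0 mh fh) /Lpnorm -poweRrM qE.
rewrite (_ : (2 / (1 - p))^-1 * 2 = 1 - p); last by field; rewrite gt_eqF.
rewrite (_ : lebint (fun x => (`|h x| `^ _)%:E) =
  lebint (fun x => (h x `^ (2 / (1 - p)))%:E)); last first.
  by apply: eq_lebint => x; rewrite ger0_norm.
have := interpolation_L1_L2 h0 mh g00 hE p0 p1.
have B0 : (0 <= lebint (fun x => (h x)%:E))%E by rewrite -(AE h0 mh fh).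
rewrite /epowN poweRM// -poweRD; last by rewrite poweRD_defE gt_eqF ?addr_gt0.
by rewrite mulr_natl mulr2n.
Qed.

Lemma simplex_equality (a : R) (x0 : 'rV[R]_m.+1) (V : 'M[R]_m.+1) :
  \det V != 0 ->
  (forall x, f x = a * fine (expeR (- gauge (simplex0 V) (x - x0)))) -> lhs = mid.
Proof.
move=> V0 fE; have [h [mh h0 fh]] := regular.
have hE := hg0 h0 mh fh.
rewrite lhsE midE (AE h0 mh fh) -(lebint_cov h0 mh) (Pi_star_regularize f0 h0 mh fh).
congr (_ * epowN _ _)%E; apply/esym.
apply: (lebint_cov_eq alpha0 alpha1 h0 mh g00 hE) => xi xi1.
have xi0 : xi != 0 by rewrite -enorm_eq0 xi1 oner_eq0.
exists (simplex_exponent V xi); first exact: simplex_exponent_gt0.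
move=> t t0; rewrite -(fcovE _ h0 mh fh).
have [w wE] := simplex_product V0 (t *: xi) fE.
pose E := expR (- simplex_exponent V (t *: xi)).
rewrite (_ : lebint _ = (E * g0)%:E) /=; last first.
  rewrite EFinM -hE.
  transitivity (lebint (fun x => (E * f (x + w) ^+ 2)%:E)).
    by apply: eq_lebint => x; rewrite wE.
  have mhw : measurable_fun setT (fun x : 'rV[R]_m.+1 => h x ^+ 2).
    exact: measurable_funX.
  rewrite (lebint_regularize f0 h0 fh (K := fun _ b => E * b ^+ 2) (z := w)).
  - transitivity (lebint (fun x => E%:E * (h (x + w) ^+ 2)%:E)%E).
      by apply: eq_lebint => x; rewrite EFinM.
    rewrite lebintZ ?lee_fin ?expR_ge0//.
    + rewrite (lebint_translate (F := fun x => (h x ^+ 2)%:E))//.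
      * by move=> v; rewrite lee_fin sqr_ge0.
      * exact/measurable_EFinP.
    + by move=> v; rewrite lee_fin sqr_ge0.
    + apply/measurable_EFinP; exact: (measurableT_comp mhw (measurable_addrv w)).
  - by move=> u v _ _; rewrite mulr_ge0 ?expR_ge0 ?sqr_ge0.
  - by apply: measurable_funM => //; exact: (measurableT_comp mhw (measurable_addrv w)).
by rewrite mulfK ?gt_eqF// /E simplex_exponentZ ?(ltW t0)// mulrC.
Qed.

End main.

Theorem theorem20 (R : realType) (n : nat) (alpha : R) (f : 'rV[R]_n -> R) :
  (0 < n)%N -> 0 < alpha -> alpha < 2^-1 ->
  log_concave f ->
  (lebint (fun x => (f x ^+ 2)%:E) < +oo)%E ->
  (0 < lebint (fun x => (f x ^+ 2)%:E))%E ->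
  let lhs := ((alpha / (Gamma (n.+1)%:R `^ (2 * alpha / n%:R)
                          * Gamma (1 - 2 * alpha)))%:E
              * epowN (vol (Pi_star alpha f)) (2 * alpha / n%:R))%E in
  let mid := (poweR (Lpnorm 2 f) (2 + 4 * alpha / n%:R)
              * epowN (Lpnorm 1 f) (4 * alpha / n%:R))%E in
  let rhs := poweR (Lpnorm (2 * n%:R / (n%:R - 2 * alpha)) f) 2 in
  ((lhs <= mid)%E /\ (mid <= rhs)%E) /\
  (forall (a : R) (x0 : 'rV[R]_n) (V : 'M[R]_n),
     0 <= a -> \det V != 0 ->
     (forall x, f x = a * fine (expeR (- gauge (simplex0 V) (x - x0)))) ->
     lhs = mid).
Proof.
case: n f => // m f _ alpha0 alpha1 lcf ffin fpos lhs mid rhs.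
split; first by split; [exact: affine_polar_projection_le|exact: mid_le_rhs].
by move=> a x0 V _; exact: simplex_equality.
Qed.
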